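(* Let $T\in\boldsymbol{B}(\mathcal{H})$ be a normal operator on a Hilbert space $\mathcal{H}$, let $F\colon\mathfrak{B}(\mathbb{C})\to\boldsymbol{B}(\mathcal{H})$ be a semispectral measure with compact support, and let $\Xi\subseteq\mathbb{Z}_+^2$ be a set such that $\gcd\{m-n\colon (m,n)\in\Xi\}=1$ and such that there exist $p,q,r\in\mathbb{Z}_+$ with $p\neq q$, $p+q<2r$ and $(p,q),(r,r)\in\Xi$. Then the following conditions are equivalent: (i) $F$ is the spectral measure of $T$; (ii) $T^{*m}T^n=\int_{\mathbb{C}}\bar z^m z^n\,F(\mathrm{d}z)$ for all $(m,n)\in\Xi$.
   Context: $\mathbb{Z}_+$ is the set of nonnegative integers. Hilbert spaces are complex; $\boldsymbol{B}(\mathcal{H})$ denotes bounded linear operators on $\mathcal{H}$; $\mathfrak{B}(\mathbb{C})$ is the Borel $\sigma$-algebra of $\mathbb{C}$. A map $F\colon\mathfrak{B}(\mathbb{C})\to\boldsymbol{B}(\mathcal{H})$ is a semispectral measure if $\langle F(\cdot)h,h\rangle$ is a positive measure for every $h\in\mathcal{H}$ and $F(\mathbb{C})=I$. For a function $f$ integrable with respect to all these measures, $\int f\,\mathrm{d}F\in\boldsymbol{B}(\mathcal{H})$ is the unique operator with $\langle(\int f\,\mathrm{d}F)h,h\rangle=\int f(z)\,\langle F(\mathrm{d}z)h,h\rangle$ for all $h\in\mathcal{H}$. The gcd of a (possibly infinite) set of integers, not all $0$, is taken positive; writing $\gcd(J)$ presupposes that $J$ contains a nonzero integer. Conventions: $T^0=T^{*0}=I$,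 $z^0=1$. *)

(* Defs.v *)
From mathcomp Require Import all_boot all_order all_algebra sesquilinear.
From mathcomp Require Import complex.
From mathcomp Require Import all_classical all_reals all_analysis.

Set Implicit Arguments.
Unset Strict Implicit.
Unset Printing Implicit Defensive.

Import Order.TTheory GRing.Theory Num.Theory numFieldNormedType.Exports.

Local Open Scope classical_set_scope.
Local Open Scope ring_scope.

(* The topology of the complex plane lives on R[i]^o; its ball radii are the
   positive elements of R[i], that is, the positive reals. *)
Notation borelC R := (g_sigma_algebraType (@open (R[i]^o))).

Section Operators.
Context {R : realType} {V : completeNormedModType R[i]}.

(* A complex Hilbert space is a Banach space whose norm comes from an inner
   product; forms of type {dot V for Num.conj} are linear on the left and
   conjugate-linear on the right. *)
Definition hilbert_norm (dot : {dot V for Num.conj}) : Prop :=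
  forall x : V, `|x| ^+ 2 = dot x x.

Definition bounded_operator (S : V -> V) : Prop :=
  linear S /\ bounded_near S (nbhs (0 : V)).

Variable dot : {dot V for Num.conj}.

(* For a bounded T on a Hilbert space, S exists and is unique (Riesz); the
   default value 0 is never used then. *)
Definition adjoint (T : V -> V) : V -> V :=
  xget (fun=> 0)
    [set S | bounded_operator S /\ forall x y, dot (T x) y = dot x (S y)].

Definition normal_operator (T : V -> V) : Prop :=
  bounded_operator T /\ T \o adjoint T = adjoint T \o T.

Definition orthogonal_projection (P : V -> V) : Prop :=
  [/\ bounded_operator P, P \o P = P & adjoint P = P].

End Operators.

Section SemispectralMeasures.
Context {R : realType} {V : completeNormedModType R[i]}.
Variable dot : {dot V for Num.conj}.
Implicit Types (F : set (borelC R) -> V -> V) (h : V).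

(* The set function <F(.)h, h>. Operator-valued measures are total functions on
   sets whose values outside the Borel sets are irrelevant: library integrals
   evaluate the underlying set function on measurable sets only. The inner
   product is real wherever F is positive, so no information is lost by Re. *)
Definition diag_measure F h : set (borelC R) -> \bar R :=
  fun A => (complex.Re (dot (F A h) h))%:E.

(* The order of R[i] is partial: 0 <= z states that z is real and z >= 0. *)
Definition semispectral F : Prop :=
  [/\ forall A, measurable A -> bounded_operator (F A),
      forall h, [/\ diag_measure F h set0 = 0%E,
                    forall A, measurable A -> 0 <= dot (F A h) h
                  & semi_sigma_additive (diag_measure F h)]
    & F setT = id].

(* S is the closed support of F. *)
Definition is_support F (S : set R[i]^o) : Prop :=
  [/\ closed S, F (~` S) = (fun=> 0)
    & forall Z : set R[i]^o, closed Z -> F (~` Z) = (fun=> 0) -> S `<=` Z].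

Definition compactly_supported F : Prop :=
  exists2 S, is_support F S & compact S.

Definition integralC (mu : set (borelC R) -> \bar R) (f : R[i] -> R[i]) : R[i] :=
  Complex (fine (\int[mu]_(z in setT) (complex.Re (f z))%:E)%E)
          (fine (\int[mu]_(z in setT) (complex.Im (f z))%:E)%E).

(* For a semispectral F of compact support and f continuous, S exists and is
   unique; the default value 0 is never used then. *)
Definition op_integral F (f : R[i] -> R[i]) : V -> V :=
  xget (fun=> 0)
    [set S | bounded_operator S /\
             forall h, dot (S h) h = integralC (diag_measure F h) f].

Definition spectral F : Prop :=
  semispectral F /\ forall A, measurable A -> orthogonal_projection dot (F A).

Definition is_spectral_measure_of (T : V -> V) F : Prop :=
  spectral F /\ T = op_integral F id.

End SemispectralMeasures.

Definition common_divisor (J : set int) (d : nat) : Prop :=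
  forall j, J j -> (d%:Z %| j)%Z.

(* No g qualifies when J is contained in {0}, every d being then a common
   divisor. *)
Definition is_gcd (J : set int) (g : nat) : Prop :=
  common_divisor J g /\ forall d, common_divisor J d -> (d <= g)%N.

(* Main.v *)
Require Import Defs.
From mathcomp Require Import all_boot all_order all_algebra sesquilinear.
From mathcomp Require Import complex.
From mathcomp Require Import all_classical all_reals all_analysis.
From HB Require Import structures.
From mathcomp Require Import measurable_realfun zify ring lra.

(* A complex Hilbert space is handled as a real one with [rip x y = Re <x, y>] and
   the complex structure [Jop = i]; [Phi f] is the operator [\int f dF] for real
   [f], and [Psi f = Phi (Re f) + i Phi (Im f)].  [Phi] is completely positive, so
   the functions with [Phi (f^2) = (Phi f)^2] form an algebra [mdom], closed under
   bounded pointwise limits, on which [Phi] is multiplicative.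

   (i) -> (ii): the indicators lie in [mdom], hence so do all functions.

   (ii) -> (i): let [X_j = \int |z|^j dF], [A = |T|], [k = p + q < N = 2 r].
   Cauchy-Schwarz gives [[X_(j-1), X_j], [X_j, X_(j+1)]] >= 0.  As [X_0 = 1] and
   [X_N = A^N], a maximum principle built on the operator geometric mean yields
   [X_j <= A^j] for [j <= N].  With [C = T*^p T^q = \int \bar z^p z^q dF], the
   matrix [[X_k, C], [C^*, X_k]] is positive; evaluated at [(A^k y, - C^* y)], where
   [C C^* = A^(2k)] commutes with [A], it gives [A^k X_k A^k >= A^(3k)], whence
   [X_k = A^k].  Equality in the geometric mean inequality then spreads to all
   [j <= N]; in particular [X_2 = X_1^2], so [|z|] lies in [mdom].  Normality gives
   [\int |z|^(2(m+n)) dF = |T*^m T^n|^2], so [\bar z^m z^n] is multiplicative for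
   all [(m, n)] in [Xi].  By the gcd condition some product [z |z|^(2a)] is too; as
   [z] is a bounded limit of [z |z|^(2a)] times polynomials in [|z|^2], so is [z],
   and hence every Borel indicator.  Finally [T = \int z dF] because both sides have
   the same modulus and agree after multiplication by [|T|^(2a)]. *)

Set Implicit Arguments.
Unset Strict Implicit.
Unset Printing Implicit Defensive.

Import Order.TTheory GRing.Theory Num.Theory numFieldNormedType.Exports.

Local Open Scope classical_set_scope.
Local Open Scope ring_scope.

(** * Real Hilbert spaces *)

(** Scalar interpolation cannot give [X_j <= A^j]: for a unit vector [x], log-convexity of
    [j |-> <X_j x, x>] yields [<X_j x, x> <= <A^N x, x>^(j/N)], but [<A^j x, x>] lies below that
    bound as well. Inequalities with two independent vectors are needed; they link only neighbouring
    indices, while a comparison with [A] is known at first only at both ends. Hence a maximum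
    principle. The ends alone do not determine [F]: for [H = C] and [T = 1], every probability
    measure with [\int |z|^N dF = 1] fits them. The pair [(p, q)] supplies equality strictly between
    the ends, since [p <> q] forces [k > 0] and [p + q < 2 r] is [k < N]. Neither a dilation of [F]
    nor the spectral theorem for [T] enters: the multiplicative domain replaces the former, and
    [|T|] is the only function of [T] needed besides the monomials. Over the reals all integrands
    stay real; the complex structure returns as one skew operator commuting with every [Phi f]. *)

Record rhilbert (R : realType) := RHilbert {
  rhsort :> lmodType R;
  ip : rhsort -> rhsort -> R;
  ipDl : forall x y z, ip (x + y) z = ip x z + ip y z;
  ipZl : forall a x z, ip (a *: x) z = a * ip x z;
  ipC : forall x y, ip x y = ip y x;
  ip_gt0 : forall x, x != 0 -> 0 < ip x x;
  ip_complete : forall u : nat -> rhsort,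
    (forall e, 0 < e -> exists N, forall m n, (N <= m)%N -> (N <= n)%N ->
       ip (u m - u n) (u m - u n) < e) ->
    exists l, (fun n => ip (u n - l) (u n - l)) @ \oo --> (0 : R)
}.

Section InnerProduct.
Context {R : realType} {H : rhilbert R}.
Implicit Types (x y z : H) (a c : R).

Lemma ipDr x y z : ip z (x + y) = ip z x + ip z y.
Proof. by rewrite ipC ipDl !(ipC z). Qed.
Lemma ipZr a x z : ip z (a *: x) = a * ip z x.
Proof. by rewrite ipC ipZl (ipC z). Qed.
Lemma ip0l z : ip 0 z = 0 :> R.
Proof. by rewrite -(scale0r (0 : H)) ipZl mul0r. Qed.
Lemma ip0r z : ip z 0 = 0 :> R.
Proof. by rewrite ipC ip0l. Qed.
Lemma ipNl x z : ip (- x) z = - ip x z.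
Proof. by rewrite -scaleN1r ipZl mulN1r. Qed.
Lemma ipNr x z : ip z (- x) = - ip z x.
Proof. by rewrite ipC ipNl ipC. Qed.
Lemma ipBl x y z : ip (x - y) z = ip x z - ip y z.
Proof. by rewrite ipDl ipNl. Qed.
Lemma ipBr x y z : ip z (x - y) = ip z x - ip z y.
Proof. by rewrite ipDr ipNr. Qed.

Definition ipE := (ipDl, ipDr, ipBl, ipBr, ipNl, ipNr, ipZl, ipZr, ip0l, ip0r).

Lemma ip_ge0 x : 0 <= ip x x.
Proof. by have [->|/ip_gt0/ltW//] := eqVneq x 0; rewrite ip0l. Qed.

Lemma ip_eq0 x : ip x x = 0 -> x = 0.
Proof.
by move=> h; apply/eqP/negPn/negP => /ip_gt0; rewrite h ltxx.
Qed.

Lemma ip_inj x y : (forall z, ip x z = ip y z) -> x = y.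
Proof. by move=> h; apply/subr0_eq/ip_eq0; rewrite ipBl h subrr. Qed.

End InnerProduct.

Lemma cvgR_unique (R : realType) (u : nat -> R) (a b : R) :
  u @ \oo --> (a : R) -> u @ \oo --> (b : R) -> a = b.
Proof. exact: (cvg_unique (@norm_hausdorff _ _)). Qed.

Lemma cvgR_le (R : realType) (u : nat -> R) (a b : R) :
  u @ \oo --> a -> (forall n, u n <= b) -> a <= b.
Proof. by move=> ua ub; apply: (cvgr_to_le ua); exact: nearW. Qed.

Lemma cvgR_ge (R : realType) (u : nat -> R) (a b : R) :
  u @ \oo --> a -> (forall n, b <= u n) -> b <= a.
Proof. by move=> ua ub; apply: (cvgr_to_ge ua); exact: nearW. Qed.

Lemma cvg0Ml (R : realType) (c : R) (u : nat -> R) :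
  u @ \oo --> (0 : R) -> (fun n => c * u n) @ \oo --> (0 : R).
Proof. by move=> h; rewrite -(mulr0 c); exact: cvgMl_tmp h. Qed.

Lemma cvg0Mr (R : realType) (c : R) (u : nat -> R) :
  u @ \oo --> (0 : R) -> (fun n => u n * c) @ \oo --> (0 : R).
Proof. by move=> h; rewrite -(mul0r c); exact: cvgMr_tmp h. Qed.

Lemma cvg0D (R : realType) (u v : nat -> R) : u @ \oo --> (0 : R) ->
  v @ \oo --> (0 : R) -> (fun n => u n + v n) @ \oo --> (0 : R).
Proof. by move=> hu hv; rewrite -(addr0 (0 : R)); exact: cvgD hu hv. Qed.

Lemma cvgR_squeeze0 (R : realType) (u v : nat -> R) : v @ \oo --> (0 : R) ->
  (forall n, 0 <= u n <= v n) -> u @ \oo --> (0 : R).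
Proof.
move=> v0 uv; apply: (@squeeze_cvgr _ _ _ _ (fun=> 0) v) => //; last exact: cvg_cst.
exact: nearW.
Qed.

(** The leading coefficient may vanish, and then [b] must vanish too; [mdomPl] rests on exactly this
    degenerate case. *)
Lemma discriminant_le (R : realType) (a b c : R) :
  (forall t, 0 <= c + 2 * t * b + t ^+ 2 * a) -> b ^+ 2 <= a * c.
Proof.
move=> h.
have a0 : 0 <= a.
  rewrite leNgt; apply/negP => a0.
  have c0 : 0 <= c by have := h 0; lra.
  (* At [t] and [- t] the linear terms cancel; this [t >= 1] makes [t^2 a <= - (c + 1)], which
     contradicts the sum of the two inequalities. *)
  pose t := (c + 1 + `|b|) / (- a) + 1.
  have := h t; have := h (- t).
  have : (t ^+ 2) * a <= - (c+1).
    have t1 : 1 <= t by rewrite lerDr divr_ge0// ?oppr_ge0 ?(ltW a0)//; have := normr_ge0 b; lra.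
    have ta : t * a = - (c + 1 + `|b|) + a by rewrite /t; field; lra.
    rewrite expr2 -mulrA ta; have := normr_ge0 b; nra.
  lra.
have [a1|a1] := eqVneq a 0.
  rewrite a1 mul0r; have [->|b0] := eqVneq b 0; first by rewrite expr0n.
  have := h (- (c + 1) / (2 * b)); rewrite a1 mulr0 addr0.
  have -> : 2 * (- (c + 1) / (2 * b)) * b = - (c + 1) by field.
  lra.
have := h (- b / a).
have -> : c + 2 * (- b / a) * b + (- b / a) ^+ 2 * a = (a * c - b ^+ 2) / a by field.
by rewrite pmulr_lge0 ?invr_gt0 ?lt0r ?a1// subr_ge0.
Qed.

Section PositiveForms.
Context {R : realType} {V : lmodType R} (s : V -> V -> R).
Hypothesis sDl : forall x y z, s (x + y) z = s x z + s y z.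
Hypothesis sZl : forall a x z, s (a *: x) z = a * s x z.
Hypothesis sC : forall x y, s x y = s y x.
Hypothesis s0 : forall x, 0 <= s x x.

Lemma form_cauchy_schwarz x y : s x y ^+ 2 <= s x x * s y y.
Proof.
rewrite mulrC; apply: discriminant_le => t.
have := s0 (x + t *: y).
by rewrite sDl sZl sC sDl sZl (sC _ (x + _)) sDl sZl (sC y x); congr (_ <= _); ring.
Qed.
End PositiveForms.

Section Norm.
Context {R : realType} {H : rhilbert R}.
Implicit Types (x y z : H) (a c : R).

Definition nrm x : R := Num.sqrt (ip x x).

Lemma nrm_ge0 x : 0 <= nrm x. Proof. exact: sqrtr_ge0. Qed.
Lemma nrm_sqr x : nrm x ^+ 2 = ip x x. Proof. by rewrite sqr_sqrtr// ip_ge0. Qed.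
Lemma nrm0 : nrm (0 : H) = 0. Proof. by rewrite /nrm ip0l sqrtr0. Qed.
Lemma nrmZ a x : nrm (a *: x) = `|a| * nrm x.
Proof. by rewrite /nrm ipZl ipZr mulrA -expr2 sqrtrM ?sqr_ge0// sqrtr_sqr. Qed.
Lemma nrmN x : nrm (- x) = nrm x.
Proof. by rewrite /nrm ipNl ipNr opprK. Qed.

Lemma cauchy_schwarz x y : `|ip x y| <= nrm x * nrm y.
Proof.
rewrite -[leRHS]ger0_norm ?mulr_ge0 ?nrm_ge0// -ler_sqr ?nnegrE ?normr_ge0//.
rewrite !real_normK ?num_real// exprMn !nrm_sqr.
by apply: form_cauchy_schwarz; [exact: ipDl|exact: ipZl|exact: ipC|exact: ip_ge0].
Qed.

Lemma ip_le_nrm x y : ip x y <= nrm x * nrm y.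
Proof. exact: le_trans (ler_norm _) (cauchy_schwarz _ _). Qed.

Lemma nrmD x y : nrm (x + y) <= nrm x + nrm y.
Proof.
rewrite -ler_sqr ?nnegrE ?addr_ge0 ?nrm_ge0// sqrrD !nrm_sqr ipDl !ipDr (ipC y x).
by have := ip_le_nrm x y; lra.
Qed.

Lemma nrm_dist_tri z x y : nrm (x - y) <= nrm (x - z) + nrm (z - y).
Proof. by rewrite -(subrKA z) nrmD. Qed.

Lemma nrm_complete (u : nat -> H) :
  (forall e, 0 < e -> exists N, forall m n, (N <= m)%N -> (N <= n)%N ->
     nrm (u m - u n) < e) ->
  exists l, (fun n => nrm (u n - l)) @ \oo --> (0 : R).
Proof.
move=> h; have [|l hl] := @ip_complete _ H u.
  move=> e e0; have [|N hN] := h (Num.sqrt e); first by rewrite sqrtr_gt0.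
  by exists N => m n hm hn; have := hN _ _ hm hn; rewrite /nrm ltr_sqrt.
exists l; rewrite -sqrtr0.
by apply: cvg_comp hl _; exact: sqrt_continuous.
Qed.

Lemma cvg_ipl (u : nat -> H) l z :
  (fun n => nrm (u n - l)) @ \oo --> (0 : R) ->
  (fun n => ip (u n) z) @ \oo --> ip l z.
Proof.
move=> h; apply/subr_cvg0.
apply/norm_cvg0P.
apply: (@squeeze_cvgr _ _ _ _ (fun=> 0) (fun n => nrm (u n - l) * nrm z)).
- by near=> n; rewrite normr_ge0/= -ipBl cauchy_schwarz.
- exact: cvg_cst.
- by rewrite -(mul0r (nrm z)); apply: cvgMl.
Unshelve. all: by end_near.
Qed.

Lemma cvg_nrm_unique (u : nat -> H) l l' :
  (fun n => nrm (u n - l)) @ \oo --> (0 : R) ->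
  (fun n => nrm (u n - l')) @ \oo --> (0 : R) -> l = l'.
Proof.
move=> h h'; apply: ip_inj => z.
exact: (@cvgR_unique _ (fun n => ip (u n) z) _ _ (@cvg_ipl u l z h) (@cvg_ipl u l' z h')).
Qed.

Lemma nrm_sub_cvg (u : nat -> H) l z :
  (fun n => nrm (u n - l)) @ \oo --> (0 : R) ->
  (fun n => nrm (u n - z)) @ \oo --> nrm (l - z).
Proof.
move=> h; apply/subr_cvg0/norm_cvg0P.
apply: (@squeeze_cvgr _ _ _ _ (fun=> 0) (fun n => nrm (u n - l))) => //; last exact: cvg_cst.
near=> n; rewrite normr_ge0/= ler_norml; apply/andP; split.
  by have := nrm_dist_tri (u n) l z; rewrite -(nrmN (l - u n)) opprB; lra.
by have := nrm_dist_tri l (u n) z; lra.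
Unshelve. all: by end_near.
Qed.

(** The representing vector minimizes [<x, x> - 2 phi x]: the parallelogram identity makes any
    minimizing sequence Cauchy. *)
Lemma riesz (phi : H -> R) C :
  (forall x y, phi (x + y) = phi x + phi y) ->
  (forall a x, phi (a *: x) = a * phi x) ->
  (forall x, `|phi x| <= C * nrm x) ->
  exists y, forall x, phi x = ip y x.
Proof.
move=> phiD phiZ phiC.
pose I x := ip x x - 2 * phi x.
have IC x : - C ^+ 2 <= I x.
  rewrite /I -nrm_sqr; have := phiC x; have := ler_norm (phi x).
  by have := sqr_ge0 (nrm x - C); nra.
pose E := [set I x | x in setT].
have Einf : has_inf E.
  by split; [exists (I 0), 0|exists (- C ^+ 2) => _ [x _ <-]].
pose d (n : nat) : R := n.+1%:R^-1.
have d0 n : 0 < d n by rewrite invr_gt0 ltr0n.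
have {}Emin x : inf E <= I x by apply: ge_inf; [case: Einf|exists x].
have /choice[u hu] n : exists x, I x < inf E + d n.
  by have [_ [x _ <-] h] := inf_adherent (d0 n) Einf; exists x.
have uu m n : ip (u m - u n) (u m - u n) <= 2 * (d m + d n).
  have := Emin (2^-1 *: (u m + u n)).
  have := hu m; have := hu n; rewrite /I phiZ phiD.
  rewrite !ipE (ipC (u n) (u m)); lra.
have [|l hl] := @nrm_complete u.
  move=> e e0.
  have [N hN] : exists N, d N < e ^+ 2 / 4.
    have := archi_boundP (ltW (_ : 0 < (e ^+ 2 / 4)^-1)).
    rewrite invr_gt0 divr_gt0 ?exprn_gt0// => /(_ isT) hN.
    exists (Num.bound (e ^+ 2 / 4)^-1); rewrite /d -[ltRHS]invrK ltf_pV2 ?posrE//.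
    - by apply: lt_le_trans hN _; rewrite ler_nat.
    - by rewrite invr_gt0 divr_gt0 ?exprn_gt0.
  exists N => m n hm hn.
  have dN k : (N <= k)%N -> d k <= d N.
    by move=> h; rewrite lef_pV2 ?posrE// ler_nat.
  rewrite -ltr_sqr ?nnegrE ?nrm_ge0 ?(ltW e0)// nrm_sqr.
  by apply: le_lt_trans (uu m n) _; have := dN _ hm; have := dN _ hn; lra.
exists l => x.
apply: (@cvgR_unique _ (fun n => ip (u n) x)); last exact: cvg_ipl.
(* Moving from [u n] by [t *: x] lowers the functional by less than [d n], whatever [t] is; the
   discriminant turns this into a bound on the defect in the direction [x]. *)
have b n : (ip (u n) x - phi x) ^+ 2 <= ip x x * d n.
  apply: discriminant_le => t.
  have := Emin (u n + t *: x); have := hu n.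
  by rewrite /I phiD phiZ !ipE (ipC x (u n)); lra.
apply/subr_cvg0/norm_cvg0P.
have d_cvg : d @ \oo --> (0 : R) by exact: cvg_harmonic.
apply: (@squeeze_cvgr _ _ _ _ (fun=> 0) (fun n => Num.sqrt (ip x x * d n))); last 2 first.
- exact: cvg_cst.
- rewrite -[X in _ --> X]sqrtr0 -(mulr0 (ip x x)).
  apply: (@cvg_comp _ _ _ (fun n => ip x x * d n) Num.sqrt); last exact: sqrt_continuous.
  by apply: cvgMl_tmp.
near=> n; rewrite normr_ge0/= -sqrtr_sqr ler_wsqrtr//.
Unshelve. all: by end_near.
Qed.
End Norm.

(** * Bounded operators *)

Section BoundedOperators.
Context {R : realType} {H : rhilbert R}.

Definition blin (f : H -> H) : Prop :=
  [/\ forall x y, f (x + y) = f x + f y, forall a x, f (a *: x) = a *: f x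
    & exists2 C, 0 <= C & forall x, nrm (f x) <= C * nrm x].

Record bop := Bop { bfun :> H -> H; bfunP : blin bfun }.

HB.instance Definition _ := gen_eqMixin bop.
HB.instance Definition _ := gen_choiceMixin bop.

Lemma bop_eq (A B : bop) : (forall x, A x = B x) -> A = B.
Proof.
case: A B => [f hf] [g hg] /= /funext fg; move: hf; rewrite fg => hf.
by congr Bop; exact: Prop_irrelevance.
Qed.

Lemma bopDr (A : bop) x y : A (x + y) = A x + A y.
Proof. by case: (bfunP A) => h _ _; exact: h. Qed.
Lemma bopZr (A : bop) a x : A (a *: x) = a *: A x.
Proof. by case: (bfunP A) => _ h _; exact: h. Qed.
Lemma bop0r (A : bop) : A 0 = 0.
Proof. by rewrite -(scale0r (0 : H)) bopZr !scale0r. Qed.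
Lemma bopNr (A : bop) x : A (- x) = - A x.
Proof. by rewrite -scaleN1r bopZr scaleN1r. Qed.
Lemma bopBr (A : bop) x y : A (x - y) = A x - A y.
Proof. by rewrite bopDr bopNr. Qed.
Lemma bop_bounded (A : bop) : exists2 C, 0 <= C & forall x, nrm (A x) <= C * nrm x.
Proof. by case: (bfunP A). Qed.

Lemma blin0 : blin (fun=> 0).
Proof.
split=> [x y|a x|]; rewrite ?addr0 ?scaler0//.
by exists 0 => // x; rewrite nrm0 mul0r.
Qed.

Lemma blin1 : blin id.
Proof. by split=> //; exists 1 => // x; rewrite mul1r. Qed.

Lemma blinD (A B : bop) : blin (fun x => A x + B x).
Proof.
split=> [x y|a x|]; first by rewrite !bopDr addrACA.
  by rewrite !bopZr scalerDr.
have [C C0 hC] := bop_bounded A; have [D D0 hD] := bop_bounded B.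
exists (C + D) => [|x]; first exact: addr_ge0.
by rewrite mulrDl (le_trans (nrmD _ _))// lerD.
Qed.

Lemma blinM (A B : bop) : blin (A \o B).
Proof.
split=> [x y|a x|]; rewrite /= ?bopDr ?bopZr//.
have [C C0 hC] := bop_bounded A; have [D D0 hD] := bop_bounded B.
exists (C * D) => [|x]; first exact: mulr_ge0.
by apply: le_trans (hC _) _; rewrite -mulrA ler_wpM2l.
Qed.

Lemma blinZ a (A : bop) : blin (fun x => a *: A x).
Proof.
split=> [x y|b x|]; first by rewrite bopDr scalerDr.
  by rewrite bopZr !scalerA mulrC.
have [C C0 hC] := bop_bounded A.
exists (`|a| * C) => [|x]; first by rewrite mulr_ge0.
by rewrite nrmZ -mulrA ler_wpM2l.
Qed.

Definition bop_zero := Bop blin0.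
Definition bop_one := Bop blin1.
Definition bop_add A B := Bop (blinD A B).
Definition bop_mul A B := Bop (blinM A B).
Definition bop_scale a A := Bop (blinZ a A).
Definition bop_opp A := bop_scale (- 1) A.

Fact bop_addA : associative bop_add.
Proof. by move=> A B C; apply: bop_eq => x /=; rewrite addrA. Qed.
Fact bop_addC : commutative bop_add.
Proof. by move=> A B; apply: bop_eq => x /=; rewrite addrC. Qed.
Fact bop_add0 : left_id bop_zero bop_add.
Proof. by move=> A; apply: bop_eq => x /=; rewrite add0r. Qed.
Fact bop_addN : left_inverse bop_zero bop_opp bop_add.
Proof. by move=> A; apply: bop_eq => x /=; rewrite scaleN1r addNr. Qed.

HB.instance Definition _ :=
  GRing.isZmodule.Build bop bop_addA bop_addC bop_add0 bop_addN.

Fact bop_mulA : associative bop_mul.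
Proof. by move=> A B C; apply: bop_eq. Qed.
Fact bop_mul1 : left_id bop_one bop_mul.
Proof. by move=> A; apply: bop_eq. Qed.
Fact bop_mulr1 : right_id bop_one bop_mul.
Proof. by move=> A; apply: bop_eq. Qed.
Fact bop_mulDl : left_distributive bop_mul +%R.
Proof. by move=> A B C; apply: bop_eq. Qed.
Fact bop_mulDr : right_distributive bop_mul +%R.
Proof. by move=> A B C; apply: bop_eq => x /=; rewrite bopDr. Qed.

HB.instance Definition _ := GRing.Zmodule_isPzRing.Build bop
  bop_mulA bop_mul1 bop_mulr1 bop_mulDl bop_mulDr.

Fact bop_scaleA a b A : bop_scale a (bop_scale b A) = bop_scale (a * b) A.
Proof. by apply: bop_eq => x /=; rewrite scalerA. Qed.
Fact bop_scale1 : left_id 1 bop_scale.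
Proof. by move=> A; apply: bop_eq => x /=; rewrite scale1r. Qed.
Fact bop_scaleDr : right_distributive bop_scale +%R.
Proof. by move=> a A B; apply: bop_eq => x /=; rewrite scalerDr. Qed.
Fact bop_scaleDl A : {morph bop_scale^~ A : a b / a + b}.
Proof. by move=> a b; apply: bop_eq => x /=; rewrite scalerDl. Qed.

HB.instance Definition _ := GRing.Zmodule_isLmodule.Build R bop
  bop_scaleA bop_scale1 bop_scaleDr bop_scaleDl.

Implicit Types (A B D X : bop) (x y z : H).

Lemma bopD A B x : (A + B) x = A x + B x. Proof. by []. Qed.
Lemma bopN A x : (- A) x = - A x. Proof. by rewrite /= scaleN1r. Qed.
Lemma bopB A B x : (A - B) x = A x - B x. Proof. by rewrite bopD bopN. Qed.
Lemma bopM A B x : (A * B) x = A (B x). Proof. by []. Qed.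
Lemma bopZ a A x : (a *: A) x = a *: A x. Proof. by []. Qed.
Lemma bop0 x : (0 : bop) x = 0. Proof. by []. Qed.
Lemma bop1 x : (1 : bop) x = x. Proof. by []. Qed.
Lemma bop_scalerAl a A B : (a *: A) * B = a *: (A * B).
Proof. exact: bop_eq. Qed.
Lemma bop_scalerAr a A B : A * (a *: B) = a *: (A * B).
Proof. by apply: bop_eq => x; rewrite bopM !bopZ bopZr. Qed.

Definition bopE := (bopD, bopB, bopN, bopM, bopZ, bop0, bop1).
Definition boprE := (bopDr, bopBr, bopNr, bopZr, bop0r).

Lemma bop_inj A B : (forall x y, ip (A x) y = ip (B x) y) -> A = B.
Proof. by move=> h; apply: bop_eq => x; apply: ip_inj => y. Qed.

Lemma form_op (s : H -> H -> R) C : 0 <= C ->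
  (forall x y z, s (x + y) z = s x z + s y z) ->
  (forall a x z, s (a *: x) z = a * s x z) ->
  (forall x y z, s z (x + y) = s z x + s z y) ->
  (forall a x z, s z (a *: x) = a * s z x) ->
  (forall x y, `|s x y| <= C * nrm x * nrm y) ->
  exists A : bop, forall x y, ip (A x) y = s x y.
Proof.
move=> C0 sDl sZl sDr sZr sC.
have /choice[f fP] x : exists v, forall y, s x y = ip v y.
  by apply: (riesz (C := C * nrm x)) => // y; exact: sDr.
have fB : blin f.
  split=> [x y|a x|]; try by apply: ip_inj => z; rewrite !ipE -!fP ?sDl ?sZl.
  exists C => // x; have [->|fx] := eqVneq (nrm (f x)) 0.
    by rewrite mulr_ge0 ?nrm_ge0.
  rewrite -(ler_pM2r (_ : 0 < nrm (f x))) ?lt_def ?fx ?nrm_ge0//.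
  by rewrite -expr2 nrm_sqr -fP (le_trans (ler_norm _)).
by exists (Bop fB) => x y; rewrite /= fP.
Qed.

Lemma adj_exists A : exists B : bop, forall x y, ip (B x) y = ip x (A y).
Proof.
have [C C0 hC] := bop_bounded A.
apply: (form_op C0) => *; rewrite ?boprE ?ipE//.
by rewrite (le_trans (cauchy_schwarz _ _))// mulrAC mulrC ler_wpM2r ?nrm_ge0.
Qed.

Definition adj A := projT1 (cid (adj_exists A)).

Lemma adjl A x y : ip (adj A x) y = ip x (A y).
Proof. by rewrite /adj; case: cid. Qed.
Lemma adjr A x y : ip x (adj A y) = ip (A x) y.
Proof. by rewrite ipC adjl ipC. Qed.
Lemma adj_uniq A B : (forall x y, ip (A x) y = ip x (B y)) -> A = adj B.
Proof. by move=> h; apply: bop_inj => x y; rewrite adjl. Qed.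
Lemma adjK A : adj (adj A) = A.
Proof. by apply/esym/adj_uniq => x y; rewrite adjr. Qed.
Lemma adjD A B : adj (A + B) = adj A + adj B.
Proof. by apply/esym/adj_uniq => x y; rewrite !bopE !ipE !adjl. Qed.
Lemma adjZ a A : adj (a *: A) = a *: adj A.
Proof. by apply/esym/adj_uniq => x y; rewrite !bopE !ipE !adjl. Qed.
Lemma adjN A : adj (- A) = - adj A.
Proof. by apply/esym/adj_uniq => x y; rewrite !bopE !ipE !adjl. Qed.
Lemma adjB A B : adj (A - B) = adj A - adj B.
Proof. by rewrite adjD adjN. Qed.
Lemma adjM A B : adj (A * B) = adj B * adj A.
Proof. by apply/esym/adj_uniq => x y; rewrite !bopE !adjl. Qed.
Lemma adj1 : adj 1 = 1 :> bop.
Proof. by apply/esym/adj_uniq. Qed.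
Lemma adjX A n : adj (A ^+ n) = adj A ^+ n.
Proof. by elim: n => [|n ih]; rewrite ?adj1// exprS adjM ih -exprSr. Qed.

Definition sa A : Prop := adj A = A.

Lemma saP A : sa A <-> forall x y, ip (A x) y = ip x (A y).
Proof.
split=> [h x y|h]; first by rewrite -{1}h adjl.
by apply/esym/adj_uniq.
Qed.
Lemma sa_ip A x y : sa A -> ip (A x) y = ip x (A y).
Proof. by move/saP. Qed.
Lemma saD A B : sa A -> sa B -> sa (A + B).
Proof. by rewrite /sa adjD => -> ->. Qed.
Lemma saB A B : sa A -> sa B -> sa (A - B).
Proof. by rewrite /sa adjB => -> ->. Qed.
Lemma saZ a A : sa A -> sa (a *: A).
Proof. by rewrite /sa adjZ => ->. Qed.
Lemma sa1 : sa 1.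
Proof. exact: adj1. Qed.
Lemma saX A n : sa A -> sa (A ^+ n).
Proof. by rewrite /sa adjX => ->. Qed.
Lemma saM A B : sa A -> sa B -> GRing.comm A B -> sa (A * B).
Proof. by rewrite /sa adjM => -> -> ->. Qed.

Lemma adj_mul_eq0 A : adj A * A = 0 -> A = 0.
Proof.
by move=> h; apply: bop_eq => x; apply: ip_eq0; rewrite -adjr -bopM h ip0r.
Qed.
Lemma sa_sqr_eq0 A : sa A -> A * A = 0 -> A = 0.
Proof. by move=> sA h; apply: adj_mul_eq0; rewrite sA. Qed.

(** The exponent descends by one at a time: if [A^(n+2) B = 0], then [Y = A^(n+1) B] satisfies
    [Y^* Y = B^* A^n A^(n+2) B = 0]. *)
Lemma sa_expr_mul_eq0 A B n : sa A -> A ^+ n.+1 * B = 0 -> A * B = 0.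
Proof.
move=> sA; elim: n => [//|n ih] h; apply: ih; apply: adj_mul_eq0.
by rewrite adjM adjX sA -mulrA [in X in _ * X]mulrA -exprD addSnnS exprD -mulrA h !mulr0.
Qed.

(** An order of quadratic forms only. On a real space the form ignores the skew part of an operator,
    so antisymmetry and Cauchy-Schwarz carry separate [sa] hypotheses. *)
Definition ople A B := forall x, ip (A x) x <= ip (B x) x.

Lemma sa_form_eq A B : sa A -> sa B -> (forall x, ip (A x) x = ip (B x) x) -> A = B.
Proof.
move=> sA sB h; apply: bop_inj => x y.
have := h (x + y); rewrite !boprE !ipE !h.
by rewrite (sa_ip y x sA) (sa_ip y x sB) (ipC y (A x)) (ipC y (B x)); lra.
Qed.

Lemma ople_anti A B : sa A -> sa B -> ople A B -> ople B A -> A = B.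
Proof. by move=> sA sB h k; apply: sa_form_eq => // x; apply: le_anti; rewrite h k. Qed.

Lemma pos_cauchy_schwarz A x y : sa A -> ople 0 A ->
  ip (A x) y ^+ 2 <= ip (A x) x * ip (A y) y.
Proof.
move=> sA A0; apply: (form_cauchy_schwarz (s := fun x y => ip (A x) y)).
- by move=> *; rewrite !boprE !ipE.
- by move=> *; rewrite !boprE !ipE.
- by move=> u v; rewrite sa_ip// ipC.
- by move=> u; have := A0 u; rewrite ip0l.
Qed.

Lemma pos_form_eq0 A x : sa A -> ople 0 A -> ip (A x) x = 0 -> A x = 0.
Proof.
move=> sA A0 h; apply: ip_inj => y; rewrite ip0l.
have := pos_cauchy_schwarz x y sA A0; rewrite h mul0r => k.
by apply/eqP; rewrite -sqrf_eq0 eq_le k sqr_ge0.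
Qed.

Lemma pos_expr A n : sa A -> ople 0 A -> ople 0 (A ^+ n).
Proof.
move=> sA A0 x; rewrite ip0l.
rewrite -(odd_double_half n) -addnn addnA (addnC (odd n)) -addnA exprD bopM.
rewrite (sa_ip _ _ (saX _ sA)) exprD bopM ipC; set y := bfun (A ^+ n./2) x.
case: (odd n); last by rewrite ip_ge0.
by have := A0 y; rewrite ip0l ipC.
Qed.
End BoundedOperators.
Arguments bop {R} H.

(** * Positive square roots *)

Section SquareRoot.
Context {R : realType} {H : rhilbert R}.
Implicit Types (A B P Q : bop H) (x y z : H).

(** Cauchy-Schwarz for the form of [A] at [x] and [A x] gives [|A x|^4 <= <A x, x> <A A x, A x> <=
    c^2 |x|^2 |A x|^2]. *)
Lemma pos_nrm_le A c : 0 <= c -> sa A -> ople 0 A -> ople A (c *: (1 : bop H)) ->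
  forall x, nrm (A x) <= c * nrm x.
Proof.
move=> c0 sA A0 Ac x.
have [->|/eqP Ax0] := eqVneq (nrm (A x)) 0; first by rewrite mulr_ge0 ?nrm_ge0.
have Ax : 0 < nrm (A x) by rewrite lt_def nrm_ge0; apply/andP; split => //; exact/eqP.
rewrite -ler_sqr ?nnegrE ?mulr_ge0 ?nrm_ge0// exprMn.
have := pos_cauchy_schwarz x (A x) sA A0.
have := Ac x; have := Ac (A x); have := A0 x; have := A0 (A x).
rewrite !bopZ !bop1 !bop0 !ipE -!nrm_sqr => h1 h2 h3 h4.
rewrite -(ler_pM2r (exprn_gt0 2 Ax)) -expr2 => h5.
apply: le_trans h5 _; rewrite expr2 mulrACA; nra.
Qed.

(** The scalar sequence [y] majorizes the increments of [A]; being bounded and monotone it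
    converges, so [A n x] is Cauchy for every [x]. *)
Lemma bop_lim (A : nat -> bop H) (y : nat -> R) c : nondecreasing_seq y ->
  (forall n, 0 <= y n <= c) ->
  (forall n x, nrm (A n.+1 x - A n x) <= (y n.+1 - y n) * nrm x) ->
  (forall n x, nrm (A n x) <= c * nrm x) ->
  exists2 L : bop H, forall x, (fun n => nrm (A n x - L x)) @ \oo --> (0 : R)
    & forall x, nrm (L x) <= c * nrm x.
Proof.
move=> ymono yb dA bA.
have c0 : 0 <= c by have /andP[] := yb 0; exact: le_trans.
have dist m k x : nrm (A (m + k)%N x - A m x) <= (y (m + k)%N - y m) * nrm x.
  elim: k => [|k ih]; first by rewrite addn0 !subrr nrm0 mul0r.
  rewrite addnS; apply: le_trans (nrm_dist_tri (A (m + k)%N x) _ _) _.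
  by have := dA (m + k)%N x; lra.
have ycvg : cvgn y.
  apply: nondecreasing_is_cvgn => //; exists c => _ [n _ <-]; by case/andP: (yb n).
have ylim m : y m <= limn y by exact: nondecreasing_cvgn_le.
have distl m k x : (m <= k)%N -> nrm (A k x - A m x) <= (limn y - y m) * nrm x.
  move=> mk; rewrite -(subnKC mk); apply: le_trans (dist _ _ _) _.
  by rewrite ler_wpM2r ?nrm_ge0// lerB.
have tail x : (fun n => (limn y - y n) * nrm x) @ \oo --> (0 : R).
  apply: cvg0Mr; have h : (fun n => limn y - y n) @ \oo --> limn y - limn y.
    by apply: cvgB => //; exact: cvg_cst.
  by rewrite subrr in h.
have /choice[f hf] x : exists l, (fun n => nrm (A n x - l)) @ \oo --> (0 : R).
  apply: (@nrm_complete _ _ (fun n => A n x)) => e e0.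
  have e2 : 0 < e / 2 by lra.
  have /cvgrPdist_lt/(_ _ e2)[N _ hN] := tail x.
  exists N => m n hm hn.
  have {}hN k : (N <= k)%N -> nrm (A k x - A N x) < e / 2.
    move=> hk; apply: le_lt_trans (distl _ _ _ hk) _.
    have := hN N (leqnn N); rewrite /= sub0r normrN ger0_norm//.
    by rewrite mulr_ge0 ?nrm_ge0// subr_ge0.
  apply: le_lt_trans (nrm_dist_tri (A N x) _ _) _.
  by rewrite -(nrmN (A N x - _)) opprB; have := hN _ hm; have := hN _ hn; lra.
have fc x : nrm (f x) <= c * nrm x.
  have h : (fun n => nrm (A n x)) @ \oo --> nrm (f x).
    have := @nrm_sub_cvg _ _ (fun n => A n x) (f x) 0 (hf x).
    by rewrite subr0; under eq_fun do rewrite subr0.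
  exact: (cvgR_le h (fun n => bA n x)).
have additive x x' : f (x + x') = f x + f x'.
  apply: (@cvg_nrm_unique _ _ (fun n => A n (x + x'))) => //.
  apply: (cvgR_squeeze0 (v := fun n => nrm (A n x - f x) + nrm (A n x' - f x'))).
    exact: cvg0D.
  by move=> n; rewrite nrm_ge0 bopDr opprD addrACA nrmD.
have homogeneous a x : f (a *: x) = a *: f x.
  apply: (@cvg_nrm_unique _ _ (fun n => A n (a *: x))) => //.
  under eq_fun do rewrite bopZr -scalerBr nrmZ.
  exact: cvg0Ml.
have fB : blin f by split => //; exists c.
by exists (Bop fB).
Qed.

Section Iteration.
Variable Q : bop H.
Hypotheses (sQ : sa Q) (Q1 : forall x, nrm (Q x) <= nrm x).

(* Picard iteration for [Y = (Q + Y^2) / 2], solved by [Y = 1 - (1 - Q)^(1/2)]. *)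
Fixpoint sqrt_iter n : bop H :=
  if n is m.+1 then 2^-1 *: (Q + sqrt_iter m ^+ 2) else 0.

(** The same iteration for the scalar [Q = 1]. It increases inside [[0, 1]] and serves as the
    majorant [y] of [bop_lim]. *)
Fixpoint sqrt_bound n : R :=
  if n is m.+1 then 2^-1 * (1 + sqrt_bound m ^+ 2) else 0.

Lemma sqrt_bound_itv n : 0 <= sqrt_bound n <= 1.
Proof.
elim: n => [|n /andP[h0 h1]] /=; first by rewrite lexx ler01.
by apply/andP; split; nra.
Qed.

Lemma sqrt_bound_mono : nondecreasing_seq sqrt_bound.
Proof.
apply/nondecreasing_seqP; elim=> [|n ih] /=; first by rewrite expr0n/= addr0 mulr1 invr_ge0.
have /andP[h0 h1] := sqrt_bound_itv n.
have /= /andP[h2 h3] := sqrt_bound_itv n.+1.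
by rewrite ler_pM2l ?invr_gt0// lerD2l ler_sqr.
Qed.

Lemma sqrt_iter_le n x : nrm (sqrt_iter n x) <= sqrt_bound n * nrm x.
Proof.
elim: n x => [|n ih] x; first by rewrite /= nrm0 mul0r.
have /andP[h0 h1] := sqrt_bound_itv n.
rewrite /= -/(sqrt_iter n) nrmZ ger0_norm ?invr_ge0// -mulrA ler_pM2l ?invr_gt0//.
apply: le_trans (nrmD _ _) _; rewrite mulrDl mul1r lerD//.
by apply: le_trans (ih _) _; rewrite expr2 -mulrA ler_wpM2l.
Qed.

Lemma sqrt_iter_comm B n : GRing.comm Q B -> GRing.comm (sqrt_iter n) B.
Proof.
move=> QB; elim: n => [|n ih]; first by rewrite /GRing.comm mul0r mulr0.
rewrite /GRing.comm /= bop_scalerAl bop_scalerAr; congr (_ *: _).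
rewrite mulrDl mulrDr QB; congr (_ + _).
by rewrite expr2 mulrA -ih -!mulrA ih.
Qed.

Lemma sqrt_iter_sa n : sa (sqrt_iter n).
Proof.
elim: n => [|n ih]; first by apply/saP => x y; rewrite !bopE !ipE.
by apply: saZ; apply: saD => //; apply: saX.
Qed.

(** All iterates commute, so [Y1^2 - Y0^2 = (Y1 + Y0) (Y1 - Y0)]; the scalar iteration factors in
    the same way, and the bounds match factor by factor. *)
Lemma sqrt_iter_dist n x : nrm (sqrt_iter n.+1 x - sqrt_iter n x) <=
  (sqrt_bound n.+1 - sqrt_bound n) * nrm x.
Proof.
elim: n x => [|n ih] x.
  rewrite /= !subr0 !expr0n !addr0 mulr1 nrmZ ger0_norm ?invr_ge0//.
  by rewrite ler_pM2l ?invr_gt0.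
set Y1 := sqrt_iter n.+1 in ih *; set Y0 := sqrt_iter n in ih *.
set y1 := sqrt_bound n.+1 in ih *; set y0 := sqrt_bound n in ih *.
have cY : GRing.comm Y1 Y0.
  by apply: sqrt_iter_comm; apply/commr_sym/sqrt_iter_comm.
have -> : sqrt_iter n.+2 x - Y1 x = 2^-1 *: ((Y1 + Y0) ((Y1 - Y0) x)).
  rewrite -bopM -bopB -bopZ; congr (bfun _ x).
  rewrite /= -/(sqrt_iter n.+1) -/Y1 {2}/Y1 /= -/Y0 -scalerBr; congr (_ *: _).
  rewrite opprD addrACA subrr add0r mulrDl !mulrBr -!expr2 cY.
  by rewrite addrA subrK.
have -> : sqrt_bound n.+2 - y1 = 2^-1 * ((y1 + y0) * (y1 - y0)).
  by rewrite /= -/(sqrt_bound n.+1) -/y1 {2}/y1 /= -/y0; ring.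
rewrite nrmZ ger0_norm ?invr_ge0// -mulrA ler_pM2l ?invr_gt0// -mulrA.
set w := (Y1 - Y0) x; rewrite bopD.
apply: le_trans (nrmD _ _) _.
have /andP[a1 _] : 0 <= y1 <= 1 by exact: sqrt_bound_itv.
have /andP[a0 _] : 0 <= y0 <= 1 by exact: sqrt_bound_itv.
have := sqrt_iter_le n.+1 w; have := sqrt_iter_le n w; rewrite -/Y1 -/Y0 -/y1 -/y0.
have := ih x; rewrite -bopB -/w => h1 h2 h3.
have : (y1 + y0) * nrm w <= (y1 + y0) * ((y1 - y0) * nrm x).
  by rewrite ler_wpM2l// addr_ge0.
lra.
Qed.

Lemma sqrt_iter_limit : exists L : bop H,
  [/\ sa L, forall x, nrm (L x) <= nrm x, L = 2^-1 *: (Q + L ^+ 2)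
    & forall B, GRing.comm Q B -> GRing.comm L B].
Proof.
have le1 n x : nrm (sqrt_iter n x) <= 1 * nrm x.
  apply: le_trans (sqrt_iter_le n x) _; rewrite ler_wpM2r ?nrm_ge0//.
  by case/andP: (sqrt_bound_itv n).
have [L Llim L1] := bop_lim sqrt_bound_mono sqrt_bound_itv sqrt_iter_dist le1.
have shift x : (fun n => nrm (sqrt_iter n.+1 x - L x)) @ \oo --> (0 : R).
  by have := Llim x; rewrite -(cvg_shiftS (fun n => nrm (sqrt_iter n x - L x))).
exists L; split.
- apply/saP => x y; apply: (@cvgR_unique _ (fun n => ip (sqrt_iter n x) y)).
    exact: (@cvg_ipl _ _ (fun n => sqrt_iter n x)).
  under eq_fun do rewrite (sa_ip _ _ (sqrt_iter_sa _)) ipC.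
  rewrite ipC; exact: (@cvg_ipl _ _ (fun n => sqrt_iter n y)).
- by move=> x; rewrite -(mul1r (nrm x)).
- apply: bop_eq => x.
  apply: (@cvg_nrm_unique _ _ (fun n => sqrt_iter n.+1 x)) => //.
  apply: (cvgR_squeeze0 (v := fun n => nrm (sqrt_iter n (L x) - L (L x)) +
      nrm (sqrt_iter n x - L x))).
    exact: cvg0D.
  move=> n; rewrite nrm_ge0/= -scalerBr nrmZ ger0_norm ?invr_ge0//.
  rewrite opprD addrACA subrr add0r -/(sqrt_iter n).
  apply: le_trans (_ : nrm (sqrt_iter n (sqrt_iter n x) - L (L x)) <= _).
    by rewrite ler_piMl ?nrm_ge0//; lra.
  apply: le_trans (nrm_dist_tri (sqrt_iter n (L x)) _ _) _.
  rewrite -bopBr addrC lerD2l.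
  by apply: le_trans (le1 _ _) _; rewrite mul1r.
- move=> B QB; apply: bop_eq => x; rewrite !bopM.
  apply: (@cvg_nrm_unique _ _ (fun n => sqrt_iter n (B x))) => //.
  have [C C0 hC] := bop_bounded B.
  apply: (cvgR_squeeze0 (v := fun n => C * nrm (sqrt_iter n x - L x))).
    exact: cvg0Ml.
  move=> n; rewrite nrm_ge0/= -[sqrt_iter n (B x)]bopM (sqrt_iter_comm n QB) bopM.
  by rewrite -bopBr hC.
Qed.
End Iteration.

(** For [Q = 1 - P / c] the fixed point [L = (Q + L^2) / 2] satisfies [(1 - L)^2 = 1 - Q = P / c],
    so the root is [c^(1/2) (1 - L)]. Commutation with everything that commutes with [P] is
    inherited from the iterates. *)
Lemma pos_sqrt P : sa P -> ople 0 P -> exists S : bop H,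
  [/\ sa S, ople 0 S, S ^+ 2 = P & forall B, GRing.comm P B -> GRing.comm S B].
Proof.
move=> sP P0; have [c0 c00 hc] := bop_bounded P; pose c := c0 + 1.
have c_gt0 : 0 < c by rewrite /c; lra.
pose Q : bop H := 1 - c^-1 *: P.
have sQ : sa Q by apply: saB; [exact: sa1|exact: saZ].
have Q1 x : nrm (Q x) <= nrm x.
  rewrite -[leRHS]mul1r; apply: pos_nrm_le => // y; rewrite /Q !bopE !ipE.
    rewrite subr_ge0 ler_pdivrMl//.
    apply: le_trans (ip_le_nrm _ _) _; rewrite -nrm_sqr expr2 mulrA ler_wpM2r ?nrm_ge0//.
    by apply: le_trans (hc _) _; rewrite ler_wpM2r ?nrm_ge0// /c; lra.
  by rewrite mul1r lerBlDr lerDl mulr_ge0 ?invr_ge0 ?(ltW c_gt0)//; have := P0 y; rewrite ip0l.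
have [L [sL L1 LE LC]] := sqrt_iter_limit sQ Q1.
pose d := Num.sqrt c.
have dd : d * d = c by rewrite -expr2 sqr_sqrtr ?ltW.
have LQ : L ^+ 2 = 2 *: L - Q.
  by rewrite {2}LE scalerA divff ?pnatr_eq0// scale1r addrC addKr.
exists (d *: (1 - L)); split.
- by apply: saZ; apply: saB => //; exact: sa1.
- move=> x; rewrite !bopE !ipE mulr_ge0 ?sqrtr_ge0// subr_ge0.
  apply: le_trans (ip_le_nrm _ _) _.
  by rewrite -nrm_sqr expr2 ler_wpM2r ?nrm_ge0.
- rewrite expr2 bop_scalerAl bop_scalerAr scalerA dd -expr2 -sqrrN opprB sqrrB1 LQ.
  rewrite scaler_nat [L *+ 2 - Q - _]addrAC subrr sub0r addrC /Q opprB addrC subrK scalerA.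
  by rewrite divff ?scale1r// gt_eqF.
- move=> B PB; rewrite /GRing.comm bop_scalerAl bop_scalerAr mulrBl mulrBr mul1r mulr1.
  congr (_ *: (_ - _)); apply: LC.
  by rewrite /GRing.comm mulrBl mulrBr mul1r mulr1 bop_scalerAl bop_scalerAr PB.
Qed.
End SquareRoot.

(** * Inverses of coercive operators *)

Section Inverse.
Context {R : realType} {H : rhilbert R}.
Variables (S : bop H) (e : R).
Hypotheses (sS : sa S) (e0 : 0 < e) (eS : forall x, e * ip x x <= ip (S x) x).

Let s x y := ip (S x) y.

Fact coercive_form_gt0 x : x != 0 -> 0 < s x x.
Proof. by move=> x0; apply: lt_le_trans (eS x); rewrite mulr_gt0// ip_gt0. Qed.

Fact coercive_form_complete (u : nat -> H) :
  (forall d, 0 < d -> exists N, forall m n, (N <= m)%N -> (N <= n)%N ->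
     s (u m - u n) (u m - u n) < d) ->
  exists l, (fun n => s (u n - l) (u n - l)) @ \oo --> (0 : R).
Proof.
move=> h; have [|l hl] := @ip_complete _ H u.
  move=> d d0; have [|N hN] := h (e * d); first exact: mulr_gt0.
  exists N => m n hm hn; have := le_lt_trans (eS _) (hN _ _ hm hn).
  by rewrite ltr_pM2l.
have [C C0 hC] := bop_bounded S; exists l.
apply: (cvgR_squeeze0 (cvg0Ml C hl)) => n.
rewrite (le_trans _ (eS _)) ?mulr_ge0 ?ip_ge0 ?(ltW e0)//=.
apply: le_trans (ip_le_nrm _ _) _.
by rewrite -nrm_sqr expr2 mulrA ler_wpM2r ?nrm_ge0.
Qed.

(** The space [H] with the inner product [<S x, y>], equivalent to the original one. Representing
    [x |-> <v, x>] in it solves [S y = v], which reduces inversion to [riesz]. *)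
Definition coercive_rhilbert : rhilbert R := @RHilbert R H s
  (fun x y z => ltac:(by rewrite /s boprE ipE))
  (fun a x z => ltac:(by rewrite /s boprE ipE))
  (fun x y => ltac:(by rewrite /s (sa_ip _ _ sS) ipC))
  coercive_form_gt0 coercive_form_complete.

Lemma coercive_inverse : exists2 I : bop H, S * I = 1 & I * S = 1.
Proof.
have nle (y : H) : Num.sqrt e * nrm y <= nrm (y : coercive_rhilbert).
  rewrite /nrm -sqrtrM ?(ltW e0)//; apply: ler_wsqrtr; exact: eS.
have sq0 : 0 < Num.sqrt e by rewrite sqrtr_gt0.
have /choice[f hf] (v : H) : exists y, S y = v.
  have [y hy] := @riesz _ coercive_rhilbert (fun x => ip v x) (nrm v / Num.sqrt e)
    (fun x y => ipDr _ _ _) (fun a x => ipZr _ _ _) (fun x => ltac:(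
      by rewrite (le_trans (cauchy_schwarz _ _))// -mulrA ler_wpM2l ?nrm_ge0// ler_pdivlMl)).
  by exists y; apply: ip_inj => z; rewrite hy.
have Sinj x y : S x = S y -> x = y.
  move=> h; apply/subr0_eq/ip_eq0/le_anti; rewrite ip_ge0 andbT.
  by have := eS (x - y); rewrite bopBr h subrr ip0l pmulr_rle0.
have fB : blin f.
  split=> [x y|a x|]; try by apply: Sinj; rewrite !boprE !hf.
  exists e^-1 => [|x]; first by rewrite invr_ge0 ltW.
  rewrite ler_pdivlMl//.
  have [->|fx] := eqVneq (nrm (f x)) 0; first by rewrite mulr0 nrm_ge0.
  rewrite -(ler_pM2r (_ : 0 < nrm (f x))) ?lt_def ?fx ?nrm_ge0//.
  rewrite -mulrA -expr2 nrm_sqr; apply: le_trans (eS _) _; rewrite hf.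
  exact: ip_le_nrm.
exists (Bop fB); apply: bop_eq => x; rewrite bopM//=.
by apply: Sinj; rewrite hf.
Qed.
End Inverse.

(** The constants disappear under roots of order [2^m]. In place of roots, Bernoulli's inequality
    makes [(q / u)^(2^m)] outgrow [b / a] as soon as [q > u > 0]. *)
Lemma dyadic_power_le (R : realType) (q u a b : R) : 0 < a -> 0 <= u ->
  (forall m : nat, q ^+ (2 ^ m) * a <= u ^+ (2 ^ m) * b) -> q <= u.
Proof.
move=> a0 u0 h; rewrite leNgt; apply/negP => uq.
have q0 : 0 < q by exact: le_lt_trans uq.
have [u00|u_neq0] := eqVneq u 0.
  by have := h 0%N; rewrite u00 expn0 !expr1 mul0r; have := mulr_gt0 q0 a0; lra.
have up : 0 < u by rewrite lt_def u_neq0.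
pose d := q / u - 1.
have d0 : 0 < d by rewrite subr_gt0 ltr_pdivlMr// mul1r.
have bern m : 1 + m%:R * d <= (1 + d) ^+ m.
  elim: m => [|m ih]; first by rewrite mul0r addr0 expr0.
  rewrite exprS -natr1 mulrDl mul1r.
  have : 0 <= m%:R * d by rewrite mulr_ge0// ltW.
  by nra.
have h' m : (1 + d) ^+ (2 ^ m) * a <= b.
  rewrite /d addrC subrK expr_div_n mulrAC ler_pdivrMr ?exprn_gt0//.
  by rewrite (mulrC b).
pose m := Num.bound `|b / (a * d)|.
have hm : b / (a * d) < m%:R.
  exact: le_lt_trans (ler_norm _) (archi_boundP (normr_ge0 _)).
have : b < m%:R * (a * d) by rewrite -ltr_pdivrMr// mulr_gt0.
have hp : m%:R <= (2 ^ m)%:R :> R by rewrite ler_nat ltnW// ltn_expl.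
have := h' m; have := ler_wpM2r (ltW a0) (bern (2 ^ m)%N).
have : m%:R * (a * d) <= (2 ^ m)%:R * (a * d) by rewrite ler_wpM2r// mulr_ge0// ltW.
nra.
Qed.

(** * The operator geometric mean inequality *)

Section GeometricMean.
Context {R : realType} {H : rhilbert R}.
Implicit Types (A B D X S : bop H) (x y z : H).

Lemma inverse_sa S I : sa S -> S * I = 1 -> I * S = 1 -> sa I.
Proof.
move=> sS SI IS; have : adj I * S = 1 by rewrite -{1}sS -adjM SI adj1.
by move/(congr1 (fun A => A * I)); rewrite -mulrA SI mulr1 mul1r.
Qed.

Lemma inverse_expr S I n : S * I = 1 -> S ^+ n * I ^+ n = 1.
Proof.
move=> SI; elim: n => [|n ih]; first by rewrite !expr0 mulr1.
by rewrite exprSr exprS -mulrA (mulrA S) SI mul1r.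
Qed.

(* [Z = S^-(j+1) X] is symmetric for the form [<S^(j+1) ., .>], for which its
   numerical bound is controlled by its norm for the form [<S^j ., .>]. *)
Lemma ople_geometric_mean S X e c j : sa S -> 0 < e ->
  (forall x, e * ip x x <= ip (S x) x) -> sa X -> ople 0 X -> 0 <= c ->
  (forall x y, ip (X x) y ^+ 2 <=
     c ^+ 2 * ip ((S ^+ j) x) x * ip ((S ^+ j.+2) y) y) ->
  ople X (c *: S ^+ j.+1).
Proof.
move=> sS e0 eS sX X0 c0 hX x.
have S0 : ople 0 S.
  move=> y; rewrite ip0l; apply: le_trans (eS y).
  by rewrite mulr_ge0 ?ip_ge0 ?ltW.
have Sn0 n y : 0 <= ip ((S ^+ n) y) y.
  by have := pos_expr n sS S0 y; rewrite ip0l.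
have [I SI IS] := coercive_inverse sS e0 eS.
have sI := inverse_sa sS SI IS.
pose Z : bop H := I ^+ j.+1 * X.
have SZ y z : ip ((S ^+ j.+1) (Z y)) z = ip (X y) z.
  by rewrite -bopM /Z mulrA inverse_expr// mul1r.
have Zsym y z : ip ((S ^+ j.+1) (Z y)) z = ip ((S ^+ j.+1) y) (Z z).
  rewrite SZ (sa_ip _ _ sX) -[X z]bop1 -(inverse_expr j.+1 SI).
  by rewrite bopM -(sa_ip _ _ (saX _ sS)).
have Zc y : ip ((S ^+ j) (Z y)) (Z y) <= c ^+ 2 * ip ((S ^+ j) y) y.
  (* With [w = S^-1 Z y], both [<S^j Z y, Z y>] and [<S^(j+2) w, w>] equal [<X y, w>], so one factor
     cancels in [hX y w]. *)
  pose w : H := I (Z y).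
  have E1 : ip ((S ^+ j) (Z y)) (Z y) = ip (X y) w.
    have IJ : I * S ^+ j.+1 = S ^+ j by rewrite exprS mulrA IS mul1r.
    by rewrite -SZ /w -(sa_ip _ _ sI) -(bopM I) IJ.
  have E2 : ip ((S ^+ j.+2) w) w = ip (X y) w.
    by rewrite exprSr bopM /w -(bopM S I) SI bop1 SZ.
  have := hX y w; rewrite E2 -E1.
  set t := ip _ _; rewrite expr2.
  have [->|t0] := eqVneq t 0; first by rewrite mulr_ge0 ?sqr_ge0.
  by rewrite ler_pM2r// lt_def t0 Sn0.
pose a n := ip ((S ^+ j) ((Z ^+ n) x)) ((Z ^+ n) x).
have ac n : a n <= (c ^+ n) ^+ 2 * a 0%N.
  elim: n => [|n ih]; first by rewrite expr0 expr1n mul1r.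
  rewrite /a exprS bopM; apply: le_trans (Zc _) _.
  by rewrite (exprS c n) exprMn -[leRHS]mulrA ler_wpM2l ?sqr_ge0.
pose A := ip ((S ^+ j.+1) x) x.
pose q n := ip ((S ^+ j.+1) ((Z ^+ n) x)) x.
have Znsym n y z : ip ((S ^+ j.+1) ((Z ^+ n) y)) z = ip ((S ^+ j.+1) y) ((Z ^+ n) z).
  elim: n y z => [//|n ih] y z.
  have -> : (Z ^+ n.+1) y = Z ((Z ^+ n) y) by rewrite exprS.
  have -> : (Z ^+ n.+1) z = (Z ^+ n) (Z z) by rewrite exprSr.
  by rewrite Zsym ih.
have qE n : q (n + n)%N = ip ((S ^+ j.+1) ((Z ^+ n) x)) ((Z ^+ n) x).
  by rewrite /q exprD bopM Znsym.
have q_cs n : q n ^+ 2 <= q (n + n)%N * A.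
  rewrite qE; apply: pos_cauchy_schwarz; first exact: saX.
  exact: pos_expr.
have q1E : q 1%N = ip (X x) x by rewrite /q expr1 SZ.
have q_ge0 m : 0 <= q (2 ^ m)%N.
  case: m => [|m]; first by rewrite q1E; have := X0 x; rewrite ip0l.
  by rewrite expnS mul2n -addnn qE Sn0.
rewrite bopZ ipZl -q1E.
have [A0|A_neq0] := eqVneq A 0.
  have := q_cs 1%N; rewrite -/A A0 !mulr0 => h.
  by have := sqr_ge0 (q 1%N); nra.
have A_gt0 : 0 < A by rewrite lt_def A_neq0 Sn0.
(* Iterating [q n ^2 <= q (2 n) A] gives [(q 1 / A)^(2^m) <= q (2^m) / A]. A growth of [q n] like
   [c^n] therefore suffices for [q 1 <= c A]. *)
have dyadic m : q 1%N ^+ (2 ^ m) * A <= A ^+ (2 ^ m) * q (2 ^ m)%N.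
  elim: m => [|m ih]; first by rewrite !expr1 mulrC.
  have l0 : 0 <= q 1%N ^+ (2 ^ m) * A.
    by rewrite mulr_ge0 ?(ltW A_gt0)// exprn_ge0// (q_ge0 0%N).
  have : (q 1%N ^+ (2 ^ m) * A) ^+ 2 <= (A ^+ (2 ^ m)) ^+ 2 * (q (2 ^ m.+1)%N * A).
    apply: le_trans (_ : (A ^+ (2 ^ m) * q (2 ^ m)%N) ^+ 2 <= _).
      by rewrite ler_sqr ?nnegrE// mulr_ge0 ?q_ge0 ?exprn_ge0 ?(ltW A_gt0).
    rewrite exprMn ler_wpM2l ?sqr_ge0// expnS mul2n -addnn; exact: q_cs.
  rewrite exprMn -!exprM -!(mulnC 2%N) -expnS [A ^+ 2]expr2 !mulrA.
  by rewrite ler_pM2r.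
pose K := ip ((S ^+ j) (S x)) (S x).
have qN n : q n <= c ^+ n * Num.sqrt (a 0%N * K).
  have K0 : 0 <= K by exact: Sn0.
  have h : q n ^+ 2 <= (c ^+ n) ^+ 2 * (a 0%N * K).
    rewrite /q (exprS S) bopM (sa_ip _ _ sS).
    apply: le_trans (pos_cauchy_schwarz _ _ (saX _ sS) (pos_expr _ sS S0)) _.
    by rewrite mulrA; apply: ler_wpM2r; [exact: K0|exact: ac].
  apply: le_trans (ler_norm _) _; rewrite -sqrtr_sqr.
  by rewrite -[c ^+ n]ger0_norm ?exprn_ge0// -sqrtr_sqr -sqrtrM ?sqr_ge0// ler_wsqrtr.
apply: (dyadic_power_le (b := Num.sqrt (a 0%N * K)) A_gt0).
  by rewrite mulr_ge0// ltW.
move=> m; apply: le_trans (dyadic m) _.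
rewrite exprMn (mulrC (c ^+ _)) -[leRHS]mulrA; apply: ler_wpM2l; last exact: qN.
by rewrite exprn_ge0 ?ltW.
Qed.
End GeometricMean.

(** * Log-convex sequences of positive operators *)

Section MomentSequences.
Context {R : realType} {H : rhilbert R}.
Implicit Types (A B D : bop H) (x y z : H).
Variables (X : nat -> bop H) (S : bop H) (N : nat).
Hypotheses (sS : sa S) (S0 : ople 0 S).
Hypotheses (sX : forall j, sa (X j)) (X0 : forall j, ople 0 (X j)).
Hypothesis X_cs : forall j x y,
  ip ((X j.+1) x) y ^+ 2 <= ip ((X j) x) x * ip ((X j.+2) y) y.

Lemma pos_expr_ge0 n x : 0 <= ip ((S ^+ n) x) x.
Proof. by have := pos_expr n sS S0 x; rewrite ip0l. Qed.

Section Shift.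
Variable e : R.
Hypothesis e0 : 0 < e.
(** [S] may have a kernel, whereas [ople_geometric_mean] needs coercivity. The shift is removed in
    [moment_le] by letting [e] tend to 0. *)
Let T : bop H := S + e *: (1 : bop H).

Let comST n : GRing.comm (S ^+ n) T.
Proof.
apply/commr_sym/commrX; rewrite /GRing.comm /T mulrDl mulrDr.
by rewrite bop_scalerAl bop_scalerAr mul1r mulr1.
Qed.

(** Powers do not preserve the operator order in general. For [S] and its shift the comparisons come
    from expanding one factor [T] at a time in mixed products, hence the extra exponent [k] in the
    inductions. *)
Lemma shift_exprS_form k n x : ip ((S ^+ k * T ^+ n.+1) x) x =
  ip ((S ^+ k.+1 * T ^+ n) x) x + e * ip ((S ^+ k * T ^+ n) x) x.
Proof.
rewrite exprS mulrA comST -mulrA /T mulrDl bopD ipDl bop_scalerAl mul1r bopZ ipZl.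
by rewrite mulrA -exprS.
Qed.

Lemma shift_sa : sa T. Proof. by apply: saD => //; apply: saZ; exact: sa1. Qed.

Lemma shift_coercive x : e * ip x x <= ip (T x) x.
Proof.
by rewrite /T bopD bopZ bop1 !ipE lerDr; have := S0 x; rewrite ip0l.
Qed.

Lemma expr_le_shift n x : ip ((S ^+ n) x) x <= ip ((T ^+ n) x) x.
Proof.
suff h k : 0 <= ip ((S ^+ k * T ^+ n) x) x /\
    ip ((S ^+ (k + n)) x) x <= ip ((S ^+ k * T ^+ n) x) x.
  by have [_] := h 0%N; rewrite expr0 mul1r.
elim: n k => [|n ih] k; first by rewrite addn0 expr0 mulr1 pos_expr_ge0.
rewrite shift_exprS_form; have [h1 h2] := ih k; have [h3 h4] := ih k.+1.
rewrite addSnnS in h4; have := mulr_ge0 (ltW e0) h1.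
by split; [exact: addr_ge0|lra].
Qed.

Lemma scale_le_shift n x : e ^+ n * ip x x <= ip ((T ^+ n) x) x.
Proof.
suff h k : e ^+ n * ip ((S ^+ k) x) x <= ip ((S ^+ k * T ^+ n) x) x.
  by have := h 0%N; rewrite expr0 mul1r.
elim: n k => [|n ih] k; first by rewrite !expr0 mulr1 mul1r.
rewrite shift_exprS_form exprS -mulrA; have h1 := ih k; have h3 := ih k.+1.
have := ler_wpM2l (ltW e0) h1.
have : 0 <= e ^+ n * ip ((S ^+ k.+1) x) x.
  by rewrite mulr_ge0 ?pos_expr_ge0 ?exprn_ge0 ?ltW.
lra.
Qed.

Hypotheses (X_0 : ople (X 0) 1) (X_N : ople (X N) (S ^+ N)).

(* Concave weights: one application of [ople_geometric_mean] at every interior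
   index lowers the exponent [a_j] by one. *)
Let a (j : nat) : R := j%:R * (N%:R - j%:R).

Let bounded_by t := forall j x, (j <= N)%N ->
  ip ((X j) x) x <= expR (t * a j) * ip ((T ^+ j) x) x.

Let boundary t x : ip ((X 0) x) x <= expR (t * a 0) * ip ((T ^+ 0) x) x /\
  ip ((X N) x) x <= expR (t * a N) * ip ((T ^+ N) x) x.
Proof.
rewrite /a !(mul0r, subrr, mulr0) expR0 !mul1r; split; first exact: X_0.
by apply: le_trans (X_N _) _; exact: expr_le_shift.
Qed.

(** A crude start: at interior indices [a j >= 1], so [expR (t * a j) >= t], while [T^j >= e^j] and
    [X j <= C j]. A [t] above all ratios [C j / e^j] works; at the ends [a] vanishes and [boundary]
    applies. *)
Let bounded_init : exists2 t, 0 <= t & bounded_by t.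
Proof.
have /choice[C hC] j : exists C, 0 <= C /\ forall x, ip ((X j) x) x <= C * ip x x.
  have [C C0 hC] := bop_bounded (X j); exists C; split => // x.
  apply: le_trans (ip_le_nrm _ _) _.
  by rewrite -nrm_sqr expr2 mulrA ler_wpM2r ?nrm_ge0.
pose t := \sum_(j < N.+1) (C j / e ^+ j).
have Ct (j : 'I_N.+1) : C j / e ^+ j <= t.
  rewrite /t (bigD1 j)//= lerDl sumr_ge0// => i _.
  by apply: divr_ge0; [case: (hC i)|rewrite exprn_ge0 ?ltW].
have t0 : 0 <= t.
  apply: le_trans (Ct ord0).
  by apply: divr_ge0; [case: (hC 0%N)|rewrite exprn_ge0 ?ltW].
exists t => // j x jN.
have [->|j0] := eqVneq j 0%N; first by case: (boundary t x).
have [->|jN'] := eqVneq j N; first by case: (boundary t x).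
have a1 : 1 <= a j.
  have h1 : 1 <= j%:R :> R by rewrite ler1n lt0n.
  have h2 : j%:R + 1 <= N%:R :> R by rewrite natr1 ler_nat ltn_neqAle jN'.
  by rewrite /a; nra.
have [_ hCx] := hC j; apply: le_trans (hCx x) _.
have /= := Ct (@Ordinal N.+1 j jN); rewrite ler_pdivrMr ?exprn_gt0// => h.
apply: le_trans (_ : t * e ^+ j * ip x x <= _); first by rewrite ler_wpM2r ?ip_ge0.
rewrite -mulrA; apply: ler_pM => //; last exact: scale_le_shift.
  by rewrite mulr_ge0 ?ip_ge0 ?exprn_ge0 ?ltW.
have := expR_ge1Dx (t * a j); have : t * 1 <= t * a j by rewrite ler_wpM2l.
lra.
Qed.

(** As [a j <= (N + 1)^2], passing from [t * a j] to [t * (a j - 1)] gains at least the factor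
    [theta], uniformly in [j]. *)
Let theta : R := 1 - (N.+1%:R ^+ 2)^-1.

Let bounded_step t : 0 <= t -> bounded_by t -> bounded_by (theta * t).
Proof.
move=> t0 ht j x jN.
have [->|j0] := eqVneq j 0%N; first by case: (boundary (theta * t) x).
have [->|jN'] := eqVneq j N; first by case: (boundary (theta * t) x).
case: j j0 jN jN' => [//|j] _ jN jN'.
have jN2 : (j.+2 <= N)%N by rewrite ltn_neqAle jN'.
have step : ople (X j.+1) (expR (t * (a j.+1 - 1)) *: T ^+ j.+1).
  apply: (ople_geometric_mean shift_sa e0 shift_coercive) => //; rewrite ?expR_ge0//.
  move=> u v; apply: le_trans (X_cs _ _ _) _.
  have h1 := ht j u (ltnW (ltnW jN2)); have h2 := ht j.+2 v jN2.
  have Xp i w : 0 <= ip ((X i) w) w by have := X0 i w; rewrite ip0l.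
  apply: le_trans (ler_pM (Xp _ _) (Xp _ _) h1 h2) _.
  rewrite mulrACA -expRD -expRM_natl mulrA.
  (* The second difference of [a] is -2, and the square in [ople_geometric_mean] halves it. *)
  rewrite (_ : t * a j + t * a j.+2 = 2%:R * (t * (a j.+1 - 1)))//.
  by rewrite /a -(natr1 j.+1) -(natr1 j); ring.
have := step x; rewrite bopZ ipZl => h; apply: le_trans h _.
apply: ler_wpM2r; first exact: le_trans (pos_expr_ge0 _ _) (expr_le_shift _ _).
rewrite ler_expR (mulrC theta) -mulrA; apply: ler_wpM2l => //.
rewrite /theta mulrBl mul1r lerB// ler_pdivrMl ?exprn_gt0 ?ltr0n// mulr1.
rewrite /a; have h1 : 0 <= j.+1%:R :> R by [].
have h2 : j.+1%:R <= N%:R :> R by rewrite ler_nat.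
have h3 : N%:R + 1 = N.+1%:R :> R by rewrite natr1.
nra.
Qed.

(** Iterating [bounded_step] drives the exponent [theta^n * t * a j] to 0. *)
Lemma moment_le_shift j x : (j <= N)%N -> ip ((X j) x) x <= ip ((T ^+ j) x) x.
Proof.
move=> jN; have [t t0 ht] := bounded_init.
have N1 : 1 <= N.+1%:R ^+ 2 :> R by rewrite exprn_ege1// ler1n.
have th0 : 0 <= theta by rewrite subr_ge0 invf_le1// (lt_le_trans _ N1).
have th1 : theta < 1 by rewrite gtrBl invr_gt0 (lt_le_trans _ N1).
have hn n : bounded_by (theta ^+ n * t).
  elim: n => [|n ih]; first by rewrite expr0 mul1r.
  by rewrite exprS -mulrA; apply: bounded_step => //; rewrite mulr_ge0 ?exprn_ge0.
have lim0 : (fun n => theta ^+ n * (t * a j)) @ \oo --> (0 : R).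
  by apply: cvg0Mr; apply: cvg_expr; rewrite ger0_norm.
have limE : (fun n => expR (theta ^+ n * (t * a j)) * ip ((T ^+ j) x) x) @ \oo -->
    1 * ip ((T ^+ j) x) x.
  apply: cvgMr_tmp; rewrite -expR0.
  by apply: cvg_comp lim0 _; exact: continuous_expR.
rewrite -[leRHS]mul1r.
by apply: (cvgr_to_ge limE); apply: nearW => n; rewrite mulrA; exact: hn.
Qed.

End Shift.

Lemma shift_expr_le n k x : exists2 C, 0 <= C & forall e, 0 < e <= 1 ->
  ip ((S ^+ k * (S + e *: (1 : bop H)) ^+ n) x) x <= ip ((S ^+ (k + n)) x) x + e * C.
Proof.
elim: n k => [|n ih] k.
  by exists 0 => // e _; rewrite addn0 expr0 mulr1 mulr0 addr0.
have [C1 C10 h1] := ih k.+1; have [C2 C20 h2] := ih k.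
exists (C1 + (ip ((S ^+ (k + n)) x) x + C2)).
  by rewrite !addr_ge0 ?pos_expr_ge0.
move=> e /andP[e0 e1]; rewrite shift_exprS_form.
have {}h1 := h1 e (introT andP (conj e0 e1)).
have := ler_wpM2l (ltW e0) (h2 e (introT andP (conj e0 e1))).
have := ler_wpM2r C20 e1; rewrite mul1r => h3.
have := ler_wpM2l (ltW e0) h3.
by rewrite addSnnS in h1; lra.
Qed.

Lemma moment_le j : ople (X 0) 1 -> ople (X N) (S ^+ N) -> (j <= N)%N ->
  ople (X j) (S ^+ j).
Proof.
move=> hX0 hXN jN x; have [C C0 hC] := shift_expr_le j 0 x.
apply/ler_addgt0Pr => d d0.
pose e := Num.min 1 (d / (C + 1)).
have e0 : 0 < e by rewrite lt_min ltr01 divr_gt0//; lra.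
have e1 : e <= 1 by rewrite ge_min lexx.
have ed : e * C <= d.
  have : e * (C + 1) <= d by rewrite -ler_pdivlMr ?ge_min ?lexx ?orbT//; lra.
  by have := mulr_ge0 (ltW e0) C0; lra.
apply: le_trans (moment_le_shift e0 hX0 hXN x jN) _.
have := hC e (introT andP (conj e0 e1)); rewrite expr0 mul1r add0n => h.
by apply: le_trans h _; rewrite lerD2l.
Qed.

Lemma expr_form_shift i y : ip ((S ^+ i) (S y)) (S y) = ip ((S ^+ i.+2) y) y.
Proof. by rewrite -(sa_ip _ _ sS) -(bopM S) -(bopM _ S) -exprS -exprSr. Qed.

(** [B D B <= 0 <= D] forces [D B = 0], hence [B D = 0] by adjoints. Testing [D <= B] on the range
    of [D] then gives [D^2 = 0]; it is this bound that excludes a part of [D] living on the kernel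
    of [B]. *)
Lemma pos_compression_eq0 D B : sa D -> ople 0 D -> sa B -> ople D B ->
  (forall y, ip (D (B y)) (B y) <= 0) -> D = 0.
Proof.
move=> sD D0 sB DB h.
have Dp x : 0 <= ip (D x) x by have := D0 x; rewrite ip0l.
have hDB : D * B = 0.
  by apply: bop_eq => y; rewrite bopM; apply: pos_form_eq0 => //; apply: le_anti; rewrite h Dp.
have hBD : B * D = 0.
  by rewrite -[B * D]adjK adjM sB sD hDB; apply/esym/adj_uniq => x y; rewrite !bop0 !ipE.
apply: sa_sqr_eq0 => //; apply: bop_eq => x; rewrite bopM.
apply: pos_form_eq0 => //; apply: le_anti; rewrite Dp andbT.
by apply: le_trans (DB _) _; rewrite -bopM hBD bop0 ip0l.
Qed.

(* Equality at one interior index propagates in both directions. *)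
Lemma moment_eq k j : X 0 = 1 -> ople (X N) (S ^+ N) -> (0 < k < N)%N ->
  X k = S ^+ k -> (j <= N)%N -> X j = S ^+ j.
Proof.
move=> X_0 X_N /andP[k0 kN] X_k.
have sSn n : sa (S ^+ n) by exact: saX.
have le i : (i <= N)%N -> ople (X i) (S ^+ i).
  by apply: moment_le => //; rewrite X_0.
have Xp i w : 0 <= ip ((X i) w) w by have := X0 i w; rewrite ip0l.
have up i : (i.+2 <= N)%N -> X i.+1 = S ^+ i.+1 -> X i.+2 = S ^+ i.+2.
  move=> iN e; apply: ople_anti => //; first exact: le.
  (* The pair [(S y, y)] saturates Cauchy-Schwarz for pure powers of [S]: all three forms become
     [<S^(i+2) y, y>], and one factor cancels. *)
  move=> y; have := X_cs i (S y) y; rewrite e -(bopM _ S) -exprSr => h'.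
  have := le i (ltnW (ltnW iN)) (S y); rewrite expr_form_shift => h.
  have := le_trans h' (ler_wpM2r (Xp _ _) h); rewrite expr2.
  have [->|t0] := eqVneq (ip ((S ^+ i.+2) y) y) 0; first by rewrite Xp.
  by rewrite ler_pM2l// lt_def t0 pos_expr_ge0.
have down i : (i.+2 <= N)%N -> X i.+1 = S ^+ i.+1 -> X i = S ^+ i.
  (* Index 0 is settled by [X 0 = 1]. Elsewhere the pair [(S y, y)] yields [S^(i+1) <= X (i+1)] only
     on the range of [S]; as [S^(i+1)] dominates the difference, nothing is left on the kernel of
     [S]. *)
  case: i => [//|i] iN e.
  suff : S ^+ i.+1 - X i.+1 = 0 by move/subr0_eq.
  have pD : ople 0 (S ^+ i.+1 - X i.+1).
    by move=> x; rewrite ip0l bopB ipBl subr_ge0 le// ltnW// ltnW.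
  have comp y : ip ((S ^+ i.+1 - X i.+1) (S y)) (S y) <= 0.
    have := X_cs i.+1 (S y) y; rewrite e bopB ipBl subr_le0.
    rewrite expr_form_shift -(bopM _ S) -exprSr => h'; have := le i.+3 iN y.
    set t := ip _ y in h' *; set s := ip _ (S y) in h' * => h.
    have := le_trans h' (ler_wpM2l (Xp _ _) h); rewrite expr2.
    have [->|t0] := eqVneq t 0; first by rewrite Xp.
    by rewrite ler_pM2r// lt_def t0 pos_expr_ge0.
  apply: (@pos_compression_eq0 _ (S ^+ i.+1)) => //; first exact: saB.
    by move=> x; rewrite bopB ipBl lerBlDr lerDl.
  move=> y; have -> : (S ^+ i.+1) y = S ((S ^+ i) y) by rewrite exprS.
  exact: comp.
move=> jN.
have [kj|jk] := leqP k j.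
  rewrite -(subnKC kj) in jN *; elim: (j - k)%N jN => [|i ih]; first by rewrite addn0.
  rewrite addnS => iN; have := ih (ltnW iN).
  case E : (k + i)%N iN => [|m]; first by have := leq_addr i k; rewrite E leqNgt k0.
  exact: up.
have [d ->] : exists d, j = (k - d)%N by exists (k - j)%N; rewrite subKn// ltnW.
elim: d => [|d ih]; first by rewrite subn0.
rewrite subnS; move: ih.
case E : (k - d)%N => [|m] //; apply: down.
by rewrite (leq_trans _ kN)// ltnS -E leq_subr.
Qed.

End MomentSequences.

(** * Operator-valued functional calculus *)

(* [meas f] stands for measurability of [f] on [supp]; this is all of measure
   theory that the operator-theoretic argument sees. *)
Record mspace (R : realType) (X : Type) := MSpace {
  supp : set X;
  meas : (X -> R) -> Prop;
  meas_cst : forall c, meas (fun=> c);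
  measD : forall f g, meas f -> meas g -> meas (fun x => f x + g x);
  measM : forall f g, meas f -> meas g -> meas (fun x => f x * g x);
  meas_powR : forall p f, meas f -> meas (fun x => f x `^ p);
  meas_ge : forall c f, meas f -> meas (fun x => (c <= f x)%R%:R);
  meas_lim : forall (u : nat -> X -> R) f, (forall n, meas (u n)) ->
    (forall x, supp x -> (fun n => u n x) @ \oo --> (f x : R)) -> meas f
}.

Definition good (R : realType) (X : Type) (E : mspace R X) (f : X -> R) : Prop :=
  meas E f /\ exists M, forall x, supp E x -> `|f x| <= M.

(* A real functional calculus [f |-> Phi f = \int f dF] for functions that are
   measurable and bounded on [supp]. *)
Record calculus (R : realType) (H : rhilbert R) (X : Type) := Calculus {
  space :> mspace R X;
  Phi : (X -> R) -> bop H;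
  Phi1 : Phi (fun=> 1) = 1;
  PhiD : forall f g, good space f -> good space g ->
    Phi (fun x => f x + g x) = Phi f + Phi g;
  PhiZ : forall c f, good space f -> Phi (fun x => c * f x) = c *: Phi f;
  Phi_sa : forall f, sa (Phi f);
  Phi_ge0 : forall f, good space f -> (forall x, supp space x -> 0 <= f x) ->
    ople 0 (Phi f);
  Phi_lim : forall (u : nat -> X -> R) f M, (forall n, good space (u n)) ->
    (forall n x, supp space x -> `|u n x| <= M) ->
    (forall x, supp space x -> (fun n => u n x) @ \oo --> (f x : R)) ->
    forall h, (fun n => ip (Phi (u n) h) h) @ \oo --> (ip (Phi f h) h : R)
}.

Section GoodFunctions.
Context {R : realType} {X : Type} (E : mspace R X).
Notation S := (supp E).
Notation good := (good E).
Implicit Types (f g h i : X -> R) (c : R) (s : X).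

Lemma good_cst c : good (fun=> c).
Proof. by split; [exact: meas_cst|exists `|c|]. Qed.

Lemma goodD f g : good f -> good g -> good (fun s => f s + g s).
Proof.
move=> [mf [a ha]] [mg [b hb]]; split; first exact: measD.
exists (a + b) => s Ss; apply: le_trans (ler_normD _ _) _.
by rewrite lerD ?ha ?hb.
Qed.

Lemma goodM f g : good f -> good g -> good (fun s => f s * g s).
Proof.
move=> [mf [a ha]] [mg [b hb]]; split; first exact: measM.
by exists (a * b) => s Ss; rewrite normrM ler_pM ?ha ?hb.
Qed.

Lemma goodZ c f : good f -> good (fun s => c * f s).
Proof. by move=> gf; apply: goodM => //; exact: good_cst. Qed.

Lemma goodB f g : good f -> good g -> good (fun s => f s - g s).
Proof.
move=> gf gg; under [X in good X]eq_fun do rewrite -mulN1r.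
by apply: goodD => //; exact: goodZ.
Qed.

Lemma goodX f n : good f -> good (fun s => f s ^+ n).
Proof.
move=> gf; elim: n => [|n ih]; first exact: good_cst.
by under [X in good X]eq_fun do rewrite exprS; exact: goodM.
Qed.

Lemma good_ge c f : good f -> good (fun s => (c <= f s)%R%:R).
Proof.
move=> [mf _]; split; first exact: meas_ge.
by exists 1 => s _; case: (c <= f s); rewrite ?normr1 ?normr0.
Qed.

Lemma good_lim (u : nat -> X -> R) f M : (forall n, good (u n)) ->
  (forall n s, S s -> `|u n s| <= M) ->
  (forall s, S s -> (fun n => u n s) @ \oo --> (f s : R)) -> good f.
Proof.
move=> gu ub uf; split; first by apply: meas_lim uf => n; case: (gu n).
exists M => s Ss; apply: (@cvgR_le _ (fun n => `|u n s|)) => [|n]; last exact: ub.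
by apply: cvg_norm; exact: uf.
Qed.

(* Staircase approximation from below reduces to constants and gluing along
   measurable sets. *)
Lemma good_ind (P : (X -> R) -> Prop) :
  (forall c, P (fun=> c)) ->
  (forall i f g, good i -> (forall s, i s = 0 \/ i s = 1) -> good f -> good g ->
     P f -> P g -> P (fun s => i s * f s + (1 - i s) * g s)) ->
  (forall (u : nat -> X -> R) f M, (forall n, good (u n)) -> good f ->
     (forall n, P (u n)) -> (forall n s, S s -> `|u n s| <= M) ->
     (forall s, S s -> (fun n => u n s) @ \oo --> (f s : R)) -> P f) ->
  forall f, good f -> P f.
Proof.
move=> Pcst Pglue Plim f gf; have [_ [M hM]] := gf.
pose t (n k : nat) : R := - M + k%:R * n.+1%:R^-1.
pose st n := fix st k : X -> R :=
  if k is l.+1 then fun s => (t n l.+1 <= f s)%R%:R * t n l.+1 +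
                             (1 - (t n l.+1 <= f s)%R%:R) * st l s
  else fun=> - M.
have gst n k : good (st n k) /\ P (st n k).
  elim: k => [|k [ih1 ih2]] /=; first by split; [exact: good_cst|exact: Pcst].
  have gi := good_ge (t n k.+1) gf; have gt := good_cst (t n k.+1).
  split; last first.
    by apply: Pglue => // s; case: (t n k.+1 <= f s); [right|left].
  apply: goodD; first exact: goodM.
  by apply: goodM => //; apply: goodB => //; exact: good_cst.
have stP n k s : S s -> - M <= st n k s <= f s /\
    (f s < st n k s + n.+1%:R^-1 \/ st n k s = t n k).
  move=> Ss; have := hM s Ss; rewrite ler_norml => /andP[h1 h2].
  elim: k => [|k [/andP[ih1 ih2] ih3]] /=.
    by rewrite lexx h1 /t mul0r addr0; split => //; right.
  have tS : t n k.+1 = t n k + n.+1%:R^-1 by rewrite /t -natr1; ring.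
  have [h|h] := leP (t n k.+1) (f s).
    rewrite mul1r subrr mul0r addr0 h; split; last by right.
    by rewrite /t lerDl mulr_ge0.
  rewrite mul0r subr0 mul1r add0r ih1 ih2; split => //; left.
  by case: ih3 => [//|->]; rewrite -tS.
(* This many steps of height [1 / (n + 1)] climb from [- M] past [M]. *)
pose k n := Num.bound `|2 * M * n.+1%:R|.
pose u n := st n (k n).
have uP n s : S s -> - M <= u n s <= f s /\ f s < u n s + n.+1%:R^-1.
  move=> Ss; have [h1 [h2|h2]] := stP n (k n) s Ss; split => //.
  rewrite /u h2; have := hM s Ss; rewrite ler_norml => /andP[_ h3].
  apply: le_lt_trans h3 _; rewrite /t.
  have d0 : 0 < n.+1%:R^-1 :> R by rewrite invr_gt0 ltr0n.
  have := le_lt_trans (ler_norm _) (archi_boundP (normr_ge0 (2 * M * n.+1%:R))).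
  rewrite -/(k n) -(ltr_pM2r d0) mulfK ?pnatr_eq0//; move: d0.
  by set d := _^-1; set kd := _ * d => d0; lra.
apply: (Plim u f M) => // [n|n|n s Ss|s Ss].
- by case: (gst n (k n)).
- by case: (gst n (k n)).
- have [/andP[h1 h2] _] := uP n s Ss; have := hM s Ss.
  by rewrite !ler_norml => /andP[_ h3]; rewrite h1 (le_trans h2).
- apply/subr_cvg0/norm_cvg0P.
  apply: (cvgR_squeeze0 (@cvg_harmonic R)) => n; rewrite normr_ge0/=.
  have [/andP[h1 h2] h3] := uP n s Ss.
  by rewrite distrC ger0_norm ?subr_ge0// lerBlDl ltW.
Qed.
End GoodFunctions.

Section Calculus.
Context {R : realType} {H : rhilbert R} {X : Type} (K : calculus H X).
Notation S := (supp K).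
Notation Phi := (@Phi _ _ _ K).
Notation good := (good K).
Implicit Types (f g h e i : X -> R) (x y z : H) (c d : R) (s : X).

Lemma PhiB f g : good f -> good g -> Phi (fun s => f s - g s) = Phi f - Phi g.
Proof.
move=> gf gg; under [X in Phi X]eq_fun do rewrite -mulN1r.
by rewrite PhiD ?PhiZ ?scaleN1r//; exact: goodZ.
Qed.

Lemma Phi_cst c : Phi (fun=> c) = c *: (1 : bop H).
Proof.
rewrite -(Phi1 K) -PhiZ; last exact: good_cst.
by congr Phi; apply/funext => s; rewrite mulr1.
Qed.

Lemma Phi_le f g : good f -> good g -> (forall s, S s -> f s <= g s) ->
  ople (Phi f) (Phi g).
Proof.
move=> gf gg fg; have := @Phi_ge0 _ _ _ K (fun s => g s - f s) (goodB gg gf).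
rewrite PhiB// => h x; have := h (fun s Ss => _ (fg s Ss)) x.
by rewrite bop0 ip0l bopB ipBl subr_ge0; apply => *; rewrite subr_ge0.
Qed.

Lemma eq_Phi f g : good f -> good g -> (forall s, S s -> f s = g s) ->
  Phi f = Phi g.
Proof.
move=> gf gg fg; apply: ople_anti; try exact: Phi_sa.
  by apply: Phi_le => // s /fg ->.
by apply: Phi_le => // s /fg ->.
Qed.

Lemma Phi_lim_ip (u : nat -> X -> R) f M : (forall n, good (u n)) ->
  (forall n s, S s -> `|u n s| <= M) ->
  (forall s, S s -> (fun n => u n s) @ \oo --> (f s : R)) ->
  forall x y, (fun n => ip (Phi (u n) x) y) @ \oo --> (ip (Phi f x) y : R).
Proof.
move=> gu ub uf x y.
have P A : sa A -> ip (A x) y = (ip (A (x + y)) (x + y) - ip (A (x - y)) (x - y)) / 4 :> R.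
  by move=> sA; rewrite !boprE !ipE (sa_ip y x sA) (ipC y (A x)); lra.
rewrite P; last exact: Phi_sa.
under eq_fun do rewrite (P _ (Phi_sa _ _)).
apply: cvgMr_tmp; apply: cvgB; apply: (@Phi_lim _ _ _ K u f M) => // n; by case: (gu n).
Qed.

End Calculus.

(** * Complete positivity *)

Section CompletePositivity.
Context {R : realType} {H : rhilbert R} {X : Type} (K : calculus H X).
Notation S := (supp K).
Notation Phi := (@Phi _ _ _ K).
Notation good := (good K).
Implicit Types (f g h e i : X -> R) (x y z : H) (c d : R) (s : X).

Lemma Phi_flip f x y : ip (Phi f x) y = ip (Phi f y) x.
Proof. by rewrite (sa_ip _ _ (Phi_sa K f)) ipC. Qed.

(** The factor [e], an indicator, localizes the form: gluing [f] along [i] splits it into the forms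
    for [e i] and [e (1 - i)], which makes positivity stable under [good_ind]. Three functions are
    enough: two and the constant 1 for the multiplicative domain, a weight with a real and an
    imaginary part for [polar_positive]. *)
Let form e f g h x y z : R :=
  ip (Phi (fun s => e s * (f s * f s)) x) x +
  ip (Phi (fun s => e s * (g s * g s)) y) y +
  ip (Phi (fun s => e s * (h s * h s)) z) z +
  2 * (ip (Phi (fun s => e s * (f s * g s)) x) y +
       ip (Phi (fun s => e s * (f s * h s)) x) z +
       ip (Phi (fun s => e s * (g s * h s)) y) z).

Let positive f g h := forall e x y z, good e -> (forall s, e s = 0 \/ e s = 1) ->
  0 <= form e f g h x y z.

Let positive_swap12 f g h : positive f g h -> positive g f h.
Proof.
move=> p e x y z ge e01; have := p e y x z ge e01; rewrite /form.
under [fun s => _ * (f s * g s)]eq_fun do rewrite (mulrC (f _)).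
by rewrite (Phi_flip _ y x); lra.
Qed.

Let positive_swap13 f g h : positive f g h -> positive h g f.
Proof.
move=> p e x y z ge e01; have := p e z y x ge e01; rewrite /form.
under [fun s => _ * (f s * g s)]eq_fun do rewrite (mulrC (f _)).
under [fun s => _ * (f s * h s)]eq_fun do rewrite (mulrC (f _)).
under [fun s => _ * (g s * h s)]eq_fun do rewrite (mulrC (g _)).
by rewrite (Phi_flip _ z x) (Phi_flip _ z y) (Phi_flip _ y x); lra.
Qed.

Let positive_ext g h : good g -> good h -> (forall c, positive (fun=> c) g h) ->
  forall f, good f -> positive f g h.
Proof.
move=> gg gh pc f gf; apply: (good_ind (E := K) (P := fun f => positive f g h)) gf => //.
- move=> i f1 f2 gi i01 gf1 gf2 p1 p2 e x y z ge e01.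
  have gei : good (fun s => e s * i s) by exact: goodM.
  have gei' : good (fun s => e s * (1 - i s)).
    by apply: goodM => //; apply: goodB => //; exact: good_cst.
  have := p1 _ x y z gei; have := p2 _ x y z gei'.
  have h1 s : e s * i s = 0 \/ e s * i s = 1.
    by case: (e01 s) => ->; case: (i01 s) => ->; rewrite ?mul0r ?mulr1 ?mulr0; auto.
  have h2 s : e s * (1 - i s) = 0 \/ e s * (1 - i s) = 1.
    by case: (e01 s) => ->; case: (i01 s) => ->; rewrite ?mul0r ?subrr ?subr0 ?mulr1 ?mulr0; auto.
  move=> /(_ h2) q2 /(_ h1) q1.
  suff -> : form e (fun s => i s * f1 s + (1 - i s) * f2 s) g h x y z =
    form (fun s => e s * i s) f1 g h x y z +
    form (fun s => e s * (1 - i s)) f2 g h x y z by exact: addr_ge0.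
  have split2 (k1 k2 k : X -> R) u v : good k1 -> good k2 ->
      (forall s, k s = i s * k1 s + (1 - i s) * k2 s) ->
      ip (Phi (fun s => e s * k s) u) v = ip (Phi (fun s => e s * i s * k1 s) u) v +
        ip (Phi (fun s => e s * (1 - i s) * k2 s) u) v.
    move=> gk1 gk2 kE; rewrite -ipDl -bopD -PhiD; [|exact: goodM|exact: goodM].
    by congr (ip (bfun (Phi _) _) _); apply/funext => s; rewrite kE mulrDr !mulrA.
  rewrite /form.
  rewrite (split2 (fun s => f1 s * f1 s) (fun s => f2 s * f2 s)); try exact: goodM; last first.
    by move=> s; case: (i01 s) => ->; ring.
  rewrite (split2 (fun s => g s * g s) (fun s => g s * g s)); try exact: goodM; last first.
    by move=> s; ring.
  rewrite (split2 (fun s => h s * h s) (fun s => h s * h s)); try exact: goodM; last first.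
    by move=> s; ring.
  rewrite (split2 (fun s => f1 s * g s) (fun s => f2 s * g s)); try exact: goodM; last first.
    by move=> s; ring.
  rewrite (split2 (fun s => f1 s * h s) (fun s => f2 s * h s)); try exact: goodM; last first.
    by move=> s; ring.
  rewrite (split2 (fun s => g s * h s) (fun s => g s * h s)); try exact: goodM; last first.
    by move=> s; ring.
  ring.
- move=> u f1 M gu gf1 pu uM uf e x y z ge e01.
  have [_ [Mg hMg]] := gg; have [_ [Mh hMh]] := gh; have [_ [Me hMe]] := ge.
  have lim (v : nat -> X -> R) (k : X -> R) Mv w1 w2 : (forall n, good (v n)) ->
      (forall n s, S s -> `|v n s| <= Mv) ->
      (forall s, S s -> (fun n => v n s) @ \oo --> (k s : R)) ->
      (fun n => ip (Phi (fun s => e s * v n s) w1) w2) @ \oo -->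
      (ip (Phi (fun s => e s * k s) w1) w2 : R).
    move=> gv vM vk; apply: (Phi_lim_ip (M := Me * Mv)) => [n|n s Ss|s Ss].
    - exact: goodM.
    - by rewrite normrM ler_pM ?hMe ?vM.
    - by apply: cvgMl_tmp; exact: vk.
  have l1 := lim (fun n s => u n s * u n s) (fun s => f1 s * f1 s) (M * M) x x
    (fun n => goodM (gu n) (gu n)) (fun n s Ss => ltac:(by rewrite normrM ler_pM ?uM))
    (fun s Ss => cvgM (uf s Ss) (uf s Ss)).
  have l2 := lim (fun n s => u n s * g s) (fun s => f1 s * g s) (M * Mg) x y
    (fun n => goodM (gu n) gg) (fun n s Ss => ltac:(by rewrite normrM ler_pM ?uM ?hMg))
    (fun s Ss => cvgMr_tmp (uf s Ss)).
  have l3 := lim (fun n s => u n s * h s) (fun s => f1 s * h s) (M * Mh) x z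
    (fun n => goodM (gu n) gh) (fun n s Ss => ltac:(by rewrite normrM ler_pM ?uM ?hMh))
    (fun s Ss => cvgMr_tmp (uf s Ss)).
  apply: (@cvgR_ge _ (fun n => form e (u n) g h x y z)); last by move=> n; exact: pu.
  apply: cvgD; first (apply: cvgD; first (apply: cvgD; first exact: l1)).
  all: try (apply: cvg_cst).
  apply: cvgMl_tmp; apply: cvgD; first (apply: cvgD; [exact: l2|exact: l3]).
  exact: cvg_cst.
Qed.

(* Integration of [|f x + g y + h z|^2 >= 0]. *)
Lemma Phi_positive3 f g h x y z : good f -> good g -> good h ->
  0 <= ip (Phi (fun s => f s * f s) x) x + ip (Phi (fun s => g s * g s) y) y +
       ip (Phi (fun s => h s * h s) z) z +
       2 * (ip (Phi (fun s => f s * g s) x) y + ip (Phi (fun s => f s * h s) x) z +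
            ip (Phi (fun s => g s * h s) y) z).
Proof.
move=> gf gg gh.
suff pos : positive f g h.
  have := pos (fun=> 1) x y z (good_cst K 1) (fun=> or_intror erefl).
  by rewrite /form; do 6![under [fun s => 1 * _]eq_fun do rewrite mul1r].
(* Each function is moved to the front in turn and reduced to a constant; for constants the form is
   [<Phi e w, w>] with [w = c x' + a y' + b z']. *)
apply: positive_ext => // a; apply: positive_swap12; apply: positive_ext => //.
  exact: good_cst.
move=> b; apply: positive_swap13; apply: positive_ext => //; try exact: good_cst.
move=> c e x' y' z' ge e01; rewrite /form.
have E (k : R) u v : ip (Phi (fun s => e s * k) u) v = k * ip (Phi e u) v.
  under [fun s => _]eq_fun do rewrite mulrC.
  by rewrite PhiZ// bopZ ipZl.
rewrite !E.
have := @Phi_ge0 _ _ _ K e ge _ (c *: x' + a *: y' + b *: z').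
rewrite bop0 ip0l !boprE !ipE => h0.
have := h0 (fun s _ => ltac:(by case: (e01 s) => ->)).
by rewrite (Phi_flip _ z' x') (Phi_flip _ z' y') (Phi_flip _ y' x'); lra.
Qed.
End CompletePositivity.

(** * The multiplicative domain *)

Section MultiplicativeDomain.
Context {R : realType} {H : rhilbert R} {X : Type} (K : calculus H X).
Notation S := (supp K).
Notation Phi := (@Phi _ _ _ K).
Notation good := (good K).
Implicit Types (f g h e i : X -> R) (x y z : H) (c d : R) (s : X).

(** A Schur complement: in the form of [f], [g] and 1, the vector [z = - (Phi f x + Phi g y)]
    minimizes over the third slot. *)
Lemma Phi_schwarz_pair f g x y : good f -> good g ->
  0 <= ip ((Phi (fun s => f s * f s) - Phi f * Phi f) x) x +
       2 * ip ((Phi (fun s => f s * g s) - Phi g * Phi f) x) y +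
       ip ((Phi (fun s => g s * g s) - Phi g * Phi g) y) y.
Proof.
move=> gf gg; pose z := - (Phi f x + Phi g y).
have := @Phi_positive3 _ _ _ K f g (fun=> 1) x y z gf gg (good_cst K 1).
under [fun s => f s * 1]eq_fun do rewrite mulr1.
under [fun s => g s * 1]eq_fun do rewrite mulr1.
under [fun s => 1 * 1]eq_fun do rewrite mulr1.
rewrite Phi1 bop1 /z !bopB !bopM !ipE.
rewrite (sa_ip (Phi f x) x (Phi_sa K f)) (sa_ip (Phi g y) y (Phi_sa K g)).
rewrite (sa_ip (Phi f x) y (Phi_sa K g)) (ipC (Phi g y) (Phi f x)).
lra.
Qed.

Lemma Phi_schwarz f x : good f ->
  ip (Phi f x) (Phi f x) <= ip (Phi (fun s => f s * f s) x) x.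
Proof.
move=> gf; have := Phi_schwarz_pair x 0 gf gf.
rewrite bop0r !ip0r mulr0 !addr0 bopB bopM ipBl (sa_ip _ x (Phi_sa K f)).
by rewrite subr_ge0.
Qed.

(** The equality case of Kadison's inequality [Phi_schwarz]: the real-valued part of Choi's
    multiplicative domain. *)
Definition mdom f := good f /\ Phi (fun s => f s * f s) = Phi f * Phi f.

Lemma mdom_good f : mdom f -> good f. Proof. by case. Qed.

(** A positive 2 x 2 form with a vanishing diagonal entry has no off-diagonal entry; here that entry
    is the defect of multiplicativity of [f] against [g]. *)
Lemma mdomPl f g : mdom f -> good g -> Phi (fun s => f s * g s) = Phi g * Phi f.
Proof.
move=> [gf Ef] gg; apply/subr0_eq; apply: bop_inj => x y; rewrite bop0 ip0l.
set D := _ - _; pose c := ip ((Phi (fun s => g s * g s) - Phi g * Phi g) y) y.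
have h t : 0 <= c + 2 * t * ip (D x) y + t ^+ 2 * 0.
  have := Phi_schwarz_pair (t *: x) y gf gg.
  by rewrite Ef subrr bop0 ip0l bopZr ipZl -/D -/c; lra.
have := discriminant_le h; rewrite mul0r => h0.
by apply/eqP; rewrite -sqrf_eq0 eq_le h0 sqr_ge0.
Qed.

Lemma mdomPr f g : mdom f -> good g -> Phi (fun s => g s * f s) = Phi g * Phi f.
Proof. by move=> mf gg; under [fun s => _]eq_fun do rewrite mulrC; exact: mdomPl. Qed.

Lemma mdom_comm f g : mdom f -> good g -> GRing.comm (Phi f) (Phi g).
Proof.
move=> mf gg; have := congr1 (@adj _ H) (mdomPl mf gg).
by rewrite /GRing.comm adjM !(Phi_sa K) => <-; exact: mdomPl.
Qed.

Lemma mdom_cst c : mdom (fun=> c).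
Proof.
split; first exact: good_cst.
by rewrite !Phi_cst bop_scalerAl mul1r scalerA.
Qed.

Lemma mdomD f g : mdom f -> mdom g -> mdom (fun s => f s + g s).
Proof.
move=> mf mg; have gf := mdom_good mf; have gg := mdom_good mg.
split; first exact: goodD.
rewrite PhiD// mulrDl !mulrDr -(mdomPl mf gf) -(mdomPl mg gg) -(mdomPl mf gg) -(mdomPl mg gf).
rewrite -!PhiD; try (do ?apply: goodD; exact: goodM).
by congr Phi; apply/funext => s; ring.
Qed.

Lemma mdomM f g : mdom f -> mdom g -> mdom (fun s => f s * g s).
Proof.
move=> mf mg; have gf := mdom_good mf; have gg := mdom_good mg.
split; first exact: goodM.
have -> : (fun s => f s * g s * (f s * g s)) = (fun s => f s * (f s * (g s * g s))).
  by apply/funext => s; ring.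
rewrite (mdomPl mf); last by do 2!apply: goodM => //.
rewrite (mdomPl mf); last exact: goodM.
rewrite (mdomPl mg gg) (mdomPl mf gg) -!mulrA; congr (_ * _).
by rewrite !mulrA (mdom_comm mf gg).
Qed.

Lemma mdomZ c f : mdom f -> mdom (fun s => c * f s).
Proof. by move=> mf; apply: mdomM => //; exact: mdom_cst. Qed.

Lemma mdomB f g : mdom f -> mdom g -> mdom (fun s => f s - g s).
Proof.
move=> mf mg; under [X in mdom X]eq_fun do rewrite -mulN1r.
by apply: mdomD => //; exact: mdomZ.
Qed.

Lemma eq_mdom f g : good g -> (forall s, S s -> f s = g s) -> mdom f -> mdom g.
Proof.
move=> gg fg [gf Ef]; split => //.
rewrite -(eq_Phi gf gg fg) -Ef; apply: eq_Phi; [exact: goodM|exact: goodM|].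
by move=> s Ss; rewrite fg.
Qed.

(** [Phi_lim] is weak convergence, which does not pass to products. Kadison's inequality for
    [u n - f] upgrades it to strong convergence of [Phi (u n)], and then the squares converge as
    forms. *)
Lemma mdom_lim (u : nat -> X -> R) f M : (forall n, mdom (u n)) ->
  (forall n s, S s -> `|u n s| <= M) ->
  (forall s, S s -> (fun n => u n s) @ \oo --> (f s : R)) -> mdom f.
Proof.
move=> mu uM uf; have gu n := mdom_good (mu n).
have gf : good f by exact: good_lim uM uf.
have fM s : S s -> `|f s| <= M.
  move=> Ss; apply: (@cvgR_le _ (fun n => `|u n s|)) => [|n]; last exact: uM.
  by apply: cvg_norm; exact: uf.
split => //; apply: sa_form_eq; first exact: Phi_sa.
  by apply: saM => //; exact: Phi_sa.
move=> x; pose v n s := u n s * u n s.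
apply: (@cvgR_unique _ (fun n => ip (Phi (v n) x) x)).
  apply: (Phi_lim_ip (M := M * M)) => [n|n s Ss|s Ss].
  - exact: goodM.
  - by rewrite normrM ler_pM ?uM.
  - by apply: cvgM; exact: uf.
have E n : ip (Phi (v n) x) x = ip (Phi (u n) x) (Phi (u n) x).
  by rewrite /v (mu n).2 bopM (sa_ip _ _ (Phi_sa K _)).
rewrite bopM (sa_ip _ _ (Phi_sa K _)); under eq_fun do rewrite E.
pose d n s := u n s - f s.
have gd n : good (d n) by exact: goodB.
have dn : (fun n => nrm (Phi (u n) x - Phi f x)) @ \oo --> (0 : R).
  have d2 : (fun n => ip (Phi (fun s => d n s * d n s) x) x) @ \oo --> (0 : R).
    have <- : ip (Phi (fun=> 0) x) x = 0 by rewrite Phi_cst scale0r bop0 ip0l.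
    apply: (Phi_lim_ip (M := (M + M) * (M + M))) => [n|n s Ss|s Ss].
    - exact: goodM.
    - have h : `|d n s| <= M + M.
        by apply: le_trans (ler_normB _ _) _; rewrite lerD ?uM ?fM.
      by rewrite normrM ler_pM.
    - have h : (fun n => d n s) @ \oo --> (0 : R).
        by rewrite -(subrr (f s)); apply: cvgB; [exact: uf|exact: cvg_cst].
      by rewrite -(mulr0 0); exact: (cvgM h h).
  have sq : (fun n => Num.sqrt (ip (Phi (fun s => d n s * d n s) x) x)) @ \oo --> (0 : R).
    by rewrite -sqrtr0; apply: cvg_comp d2 _; exact: sqrt_continuous.
  apply: (cvgR_squeeze0 sq) => n; rewrite nrm_ge0/= ler_wsqrtr// -bopB -PhiB//.
  exact: (Phi_schwarz x (gd n)).
have nrmE n : ip (Phi (u n) x) (Phi (u n) x) = nrm (Phi (u n) x - 0) ^+ 2.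
  by rewrite subr0 nrm_sqr.
under eq_fun do rewrite nrmE.
have -> : ip (Phi f x) (Phi f x) = nrm (Phi f x - 0) ^+ 2 by rewrite subr0 nrm_sqr.
have h := @nrm_sub_cvg _ _ (fun n => Phi (u n) x) _ 0 dn.
by rewrite expr2; under eq_fun do rewrite expr2; exact: (cvgM h h).
Qed.

(** The Newton-Schulz step for the sign function: odd, with fixed points -1, 0 and 1, preserving
    [[-1, 1]]. Being a polynomial, it preserves [mdom]. *)
Let p (t : R) : R := (3 * t - t ^+ 3) / 2.

Let p_itv t : 0 <= t <= 1 -> t <= p t <= 1.
Proof.
move=> /andP[t0 t1]; apply/andP; rewrite -subr_ge0 -[_ <= 1]subr_ge0.
have -> : p t - t = t * (1 - t) * (1 + t) / 2 by rewrite /p; field.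
have -> : 1 - p t = (1 - t) ^+ 2 * (2 + t) / 2 by rewrite /p; field.
by rewrite !mulr_ge0 ?sqr_ge0 ?subr_ge0 ?addr_ge0 ?invr_ge0.
Qed.

Let p_odd t : p (- t) = - p t. Proof. by rewrite /p; ring. Qed.

Let p_iter_cvg t : 0 < t <= 1 -> (fun n => iter n p t) @ \oo --> (1 : R).
Proof.
move=> /andP[t0 t1].
(* One step multiplies [1 - w] by [(1 - w) (2 + w) / 2 <= 1 - w / 2], and the iterates never fall
   below [t]. *)
have h n : t <= iter n p t <= 1 /\ 1 - iter n p t <= (1 - t / 2) ^+ n.
  elim: n => [|n [/andP[ih1 ih2] ih3]].
    by rewrite /= lexx t1 expr0; split => //; lra.
  have /andP[p1 p2] : iter n p t <= iter n.+1 p t <= 1.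
    by apply: p_itv; rewrite ih2 (le_trans (ltW t0)).
  rewrite p2 (le_trans ih1 p1); split => //; rewrite exprS.
  apply: le_trans (_ : (1 - t / 2) * (1 - iter n p t) <= _).
    rewrite iterS /p; set w := iter n p t in ih1 ih2 *.
    have -> : 1 - (3 * w - w ^+ 3) / 2 = (1 - w) * ((1 - w) * (2 + w) / 2) by field.
    by rewrite mulrC ler_wpM2r ?subr_ge0//; nra.
  by rewrite ler_wpM2l//; lra.
apply/subr_cvg0/norm_cvg0P.
have g : (fun n => (1 - t / 2) ^+ n) @ \oo --> (0 : R).
  by apply: cvg_expr; rewrite ger0_norm; lra.
apply: (cvgR_squeeze0 g) => n; have [/andP[h1 h2] h3] := h n.
by rewrite normr_ge0/= distrC ger0_norm ?subr_ge0.
Qed.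

(* Iterating [t |-> (3 t - t^3) / 2] turns [t] into its sign, which yields the
   level sets of [f]. *)
Lemma mdom_gt f c : mdom f -> mdom (fun s => (c < f s)%R%:R).
Proof.
move=> mf; have [_ [M hM]] := mdom_good mf.
pose L := `|M| + `|c| + 1.
have L0 : 0 < L by rewrite /L; have := normr_ge0 M; have := normr_ge0 c; lra.
pose g s := L^-1 * (f s - c).
have mg : mdom g by apply: mdomZ; apply: mdomB => //; exact: mdom_cst.
have g1 s : S s -> `|g s| <= 1.
  move=> Ss; rewrite /g normrM ger0_norm ?invr_ge0 ?(ltW L0)// ler_pdivrMl// mulr1.
  apply: le_trans (ler_normB _ _) _; have := hM s Ss; have := ler_norm M.
  by rewrite /L; lra.
pose u n s := iter n p (g s).
have mu n : mdom (u n).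
  elim: n => [//|n ih]; rewrite /u.
  have -> : (fun s => iter n.+1 p (g s)) =
      (fun s => 2^-1 * (3 * u n s - u n s * (u n s * u n s))).
    by apply/funext => s; rewrite iterS /p -/(u n s); ring.
  by do ![exact: ih|apply: mdomZ|apply: mdomB|apply: mdomM].
have u1 n s : S s -> `|u n s| <= 1.
  move=> Ss; elim: n => [|n]; first exact: g1.
  rewrite /u iterS -/(u n s) => h.
  have [h0|h0] := leP 0 (u n s).
    have /andP[h1 h2] : u n s <= p (u n s) <= 1.
      by apply: p_itv; rewrite h0 (le_trans (ler_norm _) h).
    by rewrite ger0_norm// (le_trans h0).
  have /andP[h1 h2] : - u n s <= p (- u n s) <= 1.
    by apply: p_itv; rewrite -ltr0_norm// h normr_ge0.
  by rewrite -normrN -p_odd ger0_norm// (le_trans _ h1)// oppr_ge0 ltW.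
have sgn s : S s -> (fun n => u n s) @ \oo --> (Num.sg (f s - c) : R).
  move=> Ss; have Linv : 0 < L^-1 by rewrite invr_gt0.
  have [h|h|h] := ltrgtP (f s) c.
  - have gneg : g s < 0 by rewrite /g pmulr_rlt0// subr_lt0.
    rewrite ltr0_sg ?subr_lt0//.
    have E n : u n s = - iter n p (- g s).
      rewrite /u; elim: n => [|n ih]; first by rewrite opprK.
      by rewrite !iterS ih p_odd.
    under eq_fun do rewrite E.
    by apply: cvgN; apply: p_iter_cvg; rewrite oppr_gt0 gneg -ltr0_norm// g1.
  - have gpos : 0 < g s by rewrite /g pmulr_rgt0// subr_gt0.
    rewrite gtr0_sg ?subr_gt0//; apply: p_iter_cvg.
    by rewrite gpos (le_trans (ler_norm _))// g1.
  - rewrite h subrr sgr0.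
    have E n : u n s = 0.
      rewrite /u /g h subrr mulr0; elim: n => [//|n ih].
      by rewrite iterS ih /p; ring.
    by under eq_fun do rewrite E; exact: cvg_cst.
have msgn : mdom (fun s => Num.sg (f s - c)) by exact: mdom_lim u1 sgn.
have -> : (fun s => (c < f s)%R%:R) =
    (fun s => 2^-1 * (Num.sg (f s - c) * Num.sg (f s - c) + Num.sg (f s - c))) :> (X -> R).
  apply/funext => s; rewrite -subr_gt0; case: sgrP => _; rewrite ?ltxx /=; lra.
by apply: mdomZ; apply: mdomD => //; exact: mdomM.
Qed.

End MultiplicativeDomain.

(** * Moments of a semispectral measure and of a normal operator *)

Section ComplexParts.
Context {R : realType}.
Implicit Types z w : R[i].

Lemma complex_eqP z w : complex.Re z = complex.Re w -> complex.Im z = complex.Im w -> z = w.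
Proof. by case: z w => [a b] [c d] /= -> ->. Qed.
Lemma cReD z w : complex.Re (z + w) = complex.Re z + complex.Re w.
Proof. by case: z w => [a b] [c d]. Qed.
Lemma cReM z w : complex.Re (z * w) =
  complex.Re z * complex.Re w - complex.Im z * complex.Im w.
Proof. by case: z w => [a b] [c d]. Qed.
Lemma cImM z w : complex.Im (z * w) =
  complex.Re z * complex.Im w + complex.Im z * complex.Re w.
Proof. by case: z w => [a b] [c d]. Qed.
Lemma cRe_conj z : complex.Re (Num.conj z) = complex.Re z.
Proof. by case: z. Qed.
Lemma cIm_conj z : complex.Im (Num.conj z) = - complex.Im z.
Proof. by case: z. Qed.

Definition sqmod z : R := complex.Re z ^+ 2 + complex.Im z ^+ 2.

Lemma sqmod_ge0 z : 0 <= sqmod z.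
Proof. by rewrite addr_ge0 ?sqr_ge0. Qed.
Lemma sqmodM z w : sqmod (z * w) = sqmod z * sqmod w.
Proof. by rewrite /sqmod cReM cImM; ring. Qed.
Lemma sqmod_conj z : sqmod (Num.conj z) = sqmod z.
Proof. by rewrite /sqmod cRe_conj cIm_conj sqrrN. Qed.
Lemma sqmod1 : sqmod 1 = 1.
Proof. by rewrite /sqmod /= expr1n expr0n addr0. Qed.
Lemma sqmodX z n : sqmod (z ^+ n) = sqmod z ^+ n.
Proof. by elim: n => [|n ih]; rewrite ?sqmod1// !exprS sqmodM ih. Qed.
Lemma cRe_conjM z : complex.Re (Num.conj z * z) = sqmod z.
Proof. by rewrite cReM cRe_conj cIm_conj /sqmod; ring. Qed.
Lemma cIm_conjM z : complex.Im (Num.conj z * z) = 0.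
Proof. by rewrite cImM cRe_conj cIm_conj; ring. Qed.
Lemma sqmod_eq0 z : sqmod z = 0 -> z = 0.
Proof.
move=> /eqP; rewrite paddr_eq0 ?sqr_ge0// !sqrf_eq0 => /andP[/eqP a /eqP b].
exact: complex_eqP.
Qed.
Lemma conjM_expr z n : Num.conj z ^+ n * z ^+ n = (sqmod z ^+ n)%:C%C.
Proof.
rewrite -exprMn rmorphXn/=; congr (_ ^+ _); apply: complex_eqP; first exact: cRe_conjM.
exact: cIm_conjM.
Qed.
End ComplexParts.

Section ComplexCalculus.
Context {R : realType} {H : rhilbert R} (K : calculus H R[i]) (J : bop H).
Notation Phi := (@Phi _ _ _ K).
Notation good := (good K).
Notation mdom := (mdom K).
Hypotheses (JJ : J * J = -1) (adjJ : adj J = - J).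
Hypothesis PhiJ : forall f, Phi f * J = J * Phi f.
Implicit Types (f g : R[i] -> R[i]) (x y : H) (z : R[i]).

Let re f z := complex.Re (f z).
Let im f z := complex.Im (f z).

Definition Psi f : bop H := Phi (re f) + J * Phi (im f).
Definition cgood f := good (re f) /\ good (im f).
Definition cdom f := mdom (re f) /\ mdom (im f).

Lemma cdom_good f : cdom f -> cgood f.
Proof. by case=> /mdom_good ? /mdom_good. Qed.

Let reM f g : re (fun z => f z * g z) = (fun z => re f z * re g z - im f z * im g z).
Proof. by apply/funext => z; rewrite /re cReM. Qed.
Let imM f g : im (fun z => f z * g z) = (fun z => re f z * im g z + im f z * re g z).
Proof. by apply/funext => z; rewrite /im cImM. Qed.
Let re_conj f : re (fun z => Num.conj (f z)) = re f.
Proof. by apply/funext => z; rewrite /re cRe_conj. Qed.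
Let im_conj f : im (fun z => Num.conj (f z)) = (fun z => -1 * im f z).
Proof. by apply/funext => z; rewrite /im cIm_conj mulN1r. Qed.

Lemma cgoodM f g : cgood f -> cgood g -> cgood (fun z => f z * g z).
Proof.
move=> [f1 f2] [g1 g2]; rewrite /cgood reM imM.
by split; [apply: goodB|apply: goodD]; apply: goodM.
Qed.
Lemma cgood_conj f : cgood f -> cgood (fun z => Num.conj (f z)).
Proof. by move=> [f1 f2]; rewrite /cgood re_conj im_conj; split=> //; exact: goodZ. Qed.
Lemma cgood1 : cgood (fun=> 1).
Proof. by split; exact: good_cst. Qed.
Lemma cgoodX f n : cgood f -> cgood (fun z => f z ^+ n).
Proof.
move=> gf; elim: n => [|n ih]; first exact: cgood1.
by under [X in cgood X]eq_fun do rewrite exprS; exact: cgoodM.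
Qed.

Lemma cdomM f g : cdom f -> cdom g -> cdom (fun z => f z * g z).
Proof.
move=> [f1 f2] [g1 g2]; rewrite /cdom reM imM.
by split; [apply: mdomB|apply: mdomD]; apply: mdomM.
Qed.
Lemma cdom_conj f : cdom f -> cdom (fun z => Num.conj (f z)).
Proof. by move=> [f1 f2]; rewrite /cdom re_conj im_conj; split=> //; exact: mdomZ. Qed.
Lemma cdom1 : cdom (fun=> 1).
Proof. by split; exact: mdom_cst. Qed.

Lemma Psi1 : Psi (fun=> 1) = 1.
Proof.
rewrite /Psi (_ : re _ = fun=> 1)// (_ : im _ = fun=> 0)//.
by rewrite Phi1 Phi_cst scale0r mulr0 addr0.
Qed.

Lemma adj_Psi f : cgood f -> adj (Psi f) = Psi (fun z => Num.conj (f z)).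
Proof.
move=> [f1 f2]; rewrite /Psi re_conj im_conj PhiZ// scaleN1r mulrN.
by rewrite adjD adjM adjJ !(Phi_sa K) mulrN PhiJ.
Qed.

Lemma PsiM f g : cdom f -> cgood g -> Psi (fun z => f z * g z) = Psi g * Psi f.
Proof.
move=> [f1 f2] [g1 g2]; rewrite /Psi reM imM PhiB ?PhiD; try (apply: goodM => //; exact: mdom_good).
rewrite !mdomPl//.
set a := Phi (re f); set b := Phi (re g); set c := Phi (im f); set d := Phi (im g).
have e1 : b * (J * c) = J * (b * c) by rewrite mulrA PhiJ mulrA.
have e2 : J * d * (J * c) = - (d * c).
  by rewrite -mulrA (mulrA d) PhiJ -!mulrA (mulrA J J) JJ mulN1r.
rewrite mulrDl !mulrDr e1 e2 -!addrA; congr (_ + _); rewrite !mulrA.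
by rewrite addrC -addrA addrCA.
Qed.

Lemma Psi_comm f g : cdom f -> cgood g -> GRing.comm (Psi f) (Psi g).
Proof.
move=> [f1 f2] [g1 g2].
have cJ h : GRing.comm J (Phi h) by rewrite /GRing.comm PhiJ.
have cP h k : mdom h -> good k -> GRing.comm (Phi k) (Phi h).
  by move=> mh gk; apply/commr_sym/mdom_comm.
apply: commrD; apply: commr_sym; apply: commrD.
- exact: cP.
- by apply: commrM; [exact/commr_sym/cJ|exact: cP].
- by apply: commr_sym; apply: commrM; [exact/commr_sym/cJ|exact/commr_sym/cP].
- apply: commrM; apply: commr_sym; first by apply: commrM; [|exact: cJ].
  by apply: commrM; [exact/commr_sym/cJ|exact/commr_sym/cP].
Qed.
End ComplexCalculus.

Section PowersOfCalculus.
Context {R : realType} {H : rhilbert R} {X : Type} (K : calculus H X).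
Notation S := (supp K).
Notation Phi := (@Phi _ _ _ K).
Notation good := (good K).
Implicit Types (f g : X -> R) (x y : H).

Lemma Phi_cauchy_schwarz f g x y : good f -> good g ->
  ip (Phi (fun s => f s * g s) x) y ^+ 2 <=
  ip (Phi (fun s => f s * f s) x) x * ip (Phi (fun s => g s * g s) y) y.
Proof.
move=> gf gg; rewrite mulrC; apply: discriminant_le => t.
have := @Phi_positive3 _ _ _ K f g (fun=> 0) x (t *: y) 0 gf gg (good_cst K 0).
by rewrite !boprE !ipE; lra.
Qed.

Lemma mdomX f n : mdom K f ->
  mdom K (fun s => f s ^+ n) /\ Phi (fun s => f s ^+ n) = Phi f ^+ n.
Proof.
move=> mf; elim: n => [|n [ih1 ih2]].
  by split; [exact: mdom_cst|rewrite Phi1].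
under [X in mdom _ X /\ _]eq_fun do rewrite exprS.
under [X in Phi X = _]eq_fun do rewrite exprS.
split; first exact: mdomM.
by rewrite (mdomPr ih1 (mdom_good mf)) ih2 exprS.
Qed.

Lemma mdom_geom f n : mdom K f -> mdom K (fun s => \sum_(i < n) f s ^+ i).
Proof.
move=> mf; elim: n => [|n ih].
  by under [X in mdom _ X]eq_fun do rewrite big_ord0; exact: mdom_cst.
under [X in mdom _ X]eq_fun do rewrite big_ord_recr /=.
by apply: mdomD => //; case: (mdomX n mf).
Qed.

(* [g = lim g (1 - (1 - f / L)^n)^b], and the approximants are multiples of [g f^b]. *)
Lemma mdom_cancel f g b : mdom K f -> (forall s, S s -> 0 <= f s) -> good g ->
  (forall s, f s = 0 -> g s = 0) -> mdom K (fun s => g s * f s ^+ b) -> mdom K g.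
Proof.
move=> mf f0 gg gf0 mgf; have [_ [M hM]] := mdom_good mf.
have [_ [Mg hMg]] := gg.
pose L := `|M| + 1.
have L0 : 0 < L by rewrite ltr_wpDl.
pose q s := 1 - L^-1 * f s.
have mq : mdom K q by apply: mdomB; [exact: mdom_cst|exact: mdomZ].
have q01 s : S s -> 0 <= q s <= 1.
  move=> Ss; rewrite subr_ge0 gerBl mulr_ge0 ?invr_ge0 ?(ltW L0) ?f0// andbT.
  rewrite ler_pdivrMl// mulr1; apply: le_trans (ler_norm _) _.
  by apply: le_trans (hM s Ss) _; apply: le_trans (ler_norm _) _; rewrite lerDl.
pose u n s := g s * f s ^+ b * (L^-1 * \sum_(i < n) q s ^+ i) ^+ b.
have uE n s : u n s = g s * (1 - q s ^+ n) ^+ b.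
  rewrite /u -mulrA -exprMn; congr (_ * _ ^+ _).
  have -> : f s * (L^-1 * \sum_(i < n) q s ^+ i) = (1 - q s) * \sum_(i < n) q s ^+ i.
    by rewrite /q subKr mulrA (mulrC (f s)).
  by rewrite -opprB mulNr -subrX1 opprB.
apply: (mdom_lim (M := Mg) (u := u)).
- move=> n; apply: mdomM => //; have [//] := @mdomX _ b (mdomZ L^-1 (mdom_geom n mq)).
- move=> n s Ss; have /andP[h0 h1] := q01 s Ss.
  rewrite uE normrM; apply: le_trans (hMg s Ss); rewrite ler_piMr//.
  have h2 : 0 <= q s ^+ n <= 1 by rewrite exprn_ge0// exprn_ile1.
  case/andP: h2 => h2 h3.
  by rewrite ger0_norm ?exprn_ge0 ?subr_ge0// exprn_ile1 ?subr_ge0// gerBl.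
- move=> s Ss; under eq_fun do rewrite uE.
  have [fs|fs] := eqVneq (f s) 0.
    by rewrite gf0//; under eq_fun do rewrite mul0r; exact: cvg_cst.
  have /andP[h0 h1] := q01 s Ss.
  have q1 : q s < 1 by rewrite gtrBl mulr_gt0 ?invr_gt0// lt_def fs f0.
  have h : (fun n => 1 - q s ^+ n) @ \oo --> (1 : R).
    have h' : (fun n => 1 - q s ^+ n) @ \oo --> (1 - 0 : R).
      by apply: cvgB; [exact: cvg_cst|apply: cvg_expr; rewrite ger0_norm].
    by rewrite subr0 in h'.
  have hb k : (fun n => (1 - q s ^+ n) ^+ k) @ \oo --> (1 : R).
    elim: k => [|k ih]; first exact: cvg_cst.
    under eq_fun do rewrite exprS.
    have h3 : (fun n => (1 - q s ^+ n) * (1 - q s ^+ n) ^+ k) @ \oo --> (1 * 1 : R).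
      exact: (cvgM h ih).
    by rewrite mulr1 in h3.
  have h2 : (fun n => g s * (1 - q s ^+ n) ^+ b) @ \oo --> (g s * 1 : R).
    by apply: cvgMl_tmp; exact: hb.
  by rewrite mulr1 in h2.
Qed.
End PowersOfCalculus.

(** The least positive element of a nonzero subgroup divides all others, so it is a common divisor
    and must be 1. If [D] contained only 0, then 2 would be a common divisor. *)
Lemma int_subgroup_gen (D : int -> Prop) :
  D 0 -> (forall a b, D a -> D b -> D (a + b)) -> (forall a, D a -> D (- a)) ->
  (forall d : nat, (forall j, D j -> (d%:Z %| j)%Z) -> (d <= 1)%N) -> D 1.
Proof.
move=> D0 DD DN hd.
have DB a b : D a -> D b -> D (a - b) by move=> ha hb; apply: DD => //; exact: DN.
have Dm (n : nat) a : D a -> D (n%:Z * a).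
  move=> ha; elim: n => [|n ih]; first by rewrite mul0r.
  by rewrite -addn1 PoszD mulrDl mul1r; exact: DD.
have Dmz (m : int) a : D a -> D (m * a).
  move=> ha; case: m => n; first exact: Dm.
  by rewrite NegzE mulNr; apply: DN; exact: Dm.
have [[j [Dj j0]]|no] := pselect (exists j, D j /\ j != 0); last first.
  suff : (2 <= 1)%N by [].
  apply: hd => j Dj; have [->|jn0] := eqVneq j 0; first exact: dvdz0.
  by case: no; exists j.
have ex : exists n : nat, (0 < n)%N && `[< D n%:Z >].
  exists `|j|%N; rewrite absz_gt0 j0/=; apply/asboolP.
  by have [h|h] := leP 0 j; [rewrite gez0_abs|rewrite ltz0_abs//; exact: DN].
case: (ex_minnP ex) => n /andP[n0 /asboolP Dn] nmin.
have n0' : n%:Z != 0 by rewrite -lt0n in n0 *.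
have dvd j' : D j' -> (n%:Z %| j')%Z.
  move=> Dj'; apply/dvdz_mod0P; apply: contrapT => r0.
  have r_ge0 := modz_ge0 j' n0'.
  have r_lt : ((j' %% n)%Z < n%:Z) by apply: ltz_pmod.
  have Dr : D (j' %% n)%Z.
    have -> : (j' %% n)%Z = j' - (j' %/ n)%Z * n by rewrite {2}(divz_eq j' n) addrAC subrr add0r.
    by apply: DB => //; exact: Dmz.
  have : (0 < `|(j' %% n)%Z|)%N && `[< D `|(j' %% n)%Z|%N%:Z >].
    rewrite gez0_abs// absz_gt0; apply/andP; split; [exact/eqP|exact/asboolP].
  by move/nmin; rewrite -lez_nat gez0_abs// leNgt r_lt.
by have := hd n dvd; case: n n0 Dn {ex nmin n0' dvd} => [|[|]].
Qed.

Section NormalMonomials.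
Context {R : realType} {H : rhilbert R} (T : bop H).
Hypothesis Tn : T * adj T = adj T * T.

Definition opmon m n : bop H := adj T ^+ m * T ^+ n.

Lemma opmonM m n m' n' : opmon m n * opmon m' n' = opmon (m + m') (n + n').
Proof.
rewrite /opmon !exprD -!mulrA; congr (_ * _); rewrite !mulrA; congr (_ * _).
by apply: commrX; apply: commr_sym; apply: commrX.
Qed.

Lemma adj_opmon m n : adj (opmon m n) = opmon n m.
Proof. by rewrite /opmon adjM !adjX adjK. Qed.

Lemma opmon_diag n : opmon n n = (adj T * T) ^+ n.
Proof. by rewrite /opmon exprMn_comm. Qed.

End NormalMonomials.

(** * Absolute moments of the calculus *)

Section Core.
Context {R : realType} {H : rhilbert R} (K : calculus H R[i]) (J : bop H).
Notation S := (supp K).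
Notation Phi := (@Phi _ _ _ K).
Notation Psi := (Psi K J).
Notation good := (good K).
Notation mdom := (mdom K).
Hypotheses (JJ : J * J = -1) (adjJ : adj J = - J).
Hypothesis PhiJ : forall f, Phi f * J = J * Phi f.
Hypotheses (gRe : good (@complex.Re R)) (gIm : good (@complex.Im R)).
Implicit Types (x y : H) (z : R[i]) (m n j k : nat).

Definition mon m n z : R[i] := Num.conj z ^+ m * z ^+ n.

Lemma monM m n m' n' z : mon m n z * mon m' n' z = mon (m + m') (n + n') z.
Proof. by rewrite /mon !exprD mulrACA. Qed.

Lemma conj_mon m n z : Num.conj (mon m n z) = mon n m z.
Proof. by rewrite /mon rmorphM !rmorphXn/= conjCK mulrC. Qed.

Lemma sqmod_mon m n z : sqmod (mon m n z) = sqmod z ^+ (m + n).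
Proof. by rewrite /mon sqmodM !sqmodX sqmod_conj exprD. Qed.

Lemma cgood_id : cgood K id. Proof. by []. Qed.

Lemma cgood_mon m n : cgood K (mon m n).
Proof. by apply: cgoodM; apply: cgoodX => //; exact: cgood_conj cgood_id. Qed.

Lemma good_sqmod : good (@sqmod R).
Proof. by apply: goodD; apply: goodX. Qed.

Let s4 z : R := sqmod z `^ 4^-1.
Let t4 z : R := sqmod z `^ (- 4^-1).

Let s4_ge0 z : 0 <= s4 z. Proof. exact: powR_ge0. Qed.

Let s4E z : s4 z ^+ 4 = sqmod z.
Proof.
rewrite /s4 -powR_mulrn ?powR_ge0// -powRrM mulVf ?pnatr_eq0// powRr1//.
exact: sqmod_ge0.
Qed.

Let s4t4 z : sqmod z != 0 -> s4 z * t4 z = 1.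
Proof.
move=> h; rewrite /s4 /t4 -powRD; first by rewrite subrr powRr0.
by rewrite h implybT.
Qed.

Let good_s4 : good s4.
Proof.
have [ms [M hM]] := good_sqmod; split; first exact: meas_powR.
exists (`|M| `^ 4^-1) => z Sz; rewrite ger0_norm// /s4.
apply: ge0_ler_powR => //; rewrite ?nnegrE ?invr_ge0 ?sqmod_ge0//.
by apply: le_trans (ler_norm _) _; apply: le_trans (hM z Sz) (ler_norm _).
Qed.

Let good_s4X j : good (fun z => s4 z ^+ j). Proof. exact: goodX. Qed.

(* [s4 z = |z|^(1/2)], so [mod_op j] is the integral of [|z|^j]; half-integer
   powers are what the Cauchy-Schwarz inequality between neighbours needs. *)
Definition mod_op j : bop H := Phi (fun z => s4 z ^+ j.*2).

Lemma mod_op_sa j : sa (mod_op j). Proof. exact: Phi_sa. Qed.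

Lemma mod_op_ge0 j : ople 0 (mod_op j).
Proof. by apply: Phi_ge0 => // z _; rewrite exprn_ge0. Qed.

Lemma mod_op_cs j x y :
  ip ((mod_op j.+1) x) y ^+ 2 <= ip ((mod_op j) x) x * ip ((mod_op j.+2) y) y.
Proof.
have := Phi_cauchy_schwarz x y (good_s4X j) (good_s4X j.+2).
congr (_ ^+ 2 <= _ * _); congr ip; congr (bfun (Phi _) _);
  apply/funext => z; rewrite -exprD; congr (_ ^+ _); lia.
Qed.

Lemma mod_op0 : mod_op 0 = 1.
Proof. by rewrite /mod_op /= -(Phi1 K); congr Phi. Qed.

Lemma Psi_diag n : Psi (mon n n) = Phi (fun z => sqmod z ^+ n).
Proof.
rewrite /Psi (_ : (fun z => complex.Im (mon n n z)) = fun=> 0); last first.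
  by apply/funext => z; rewrite /mon conjM_expr.
rewrite Phi_cst scale0r mulr0 addr0; congr Phi.
by apply/funext => z; rewrite /mon conjM_expr.
Qed.

Lemma mod_op_diag n : mod_op n.*2 = Psi (mon n n).
Proof.
rewrite Psi_diag; congr Phi; apply/funext => z.
by rewrite -s4E -exprM; congr (_ ^+ _); lia.
Qed.

(* The operator matrix [[|z|^k, w], [w^*, |z|^k]] with [w = \bar z^m z^n] and
   [k = m + n] is positive, since [|w| = |z|^k]. *)
Lemma polar_positive m n x y : (0 < m + n)%N ->
  0 <= ip ((mod_op (m + n)) x) x + ip ((mod_op (m + n)) y) y
       + 2 * ip x (Psi (mon m n) y).
Proof.
set k := (m + n)%N => k0.
pose u z := complex.Re (mon m n z); pose v z := complex.Im (mon m n z).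
have [gu gv] : good u /\ good v := cgood_mon m n.
(* [c + i d = w |z|^(-k/2)], so that [c^2 + d^2 = |z|^k] and [s4^k (c + i d) = w]: the matrix
   becomes a rank-one product. At [z = 0] the factors [u] and [v] vanish because [k > 0]. *)
pose c z := u z * t4 z ^+ k; pose d z := v z * t4 z ^+ k.
have uv z : u z ^+ 2 + v z ^+ 2 = s4 z ^+ (4 * k).
  by rewrite -[LHS]/(sqmod (mon m n z)) sqmod_mon exprM s4E.
have s40 z : sqmod z = 0 -> s4 z = 0.
  by move=> h; rewrite /s4 h powR0// invr_neq0.
have uv0 z : sqmod z = 0 -> u z = 0 /\ v z = 0.
  move=> h; have : mon m n z = 0 by apply: sqmod_eq0; rewrite sqmod_mon h expr0n gtn_eqF.
  by rewrite /u /v => ->.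
have cd z : c z * c z + d z * d z = s4 z ^+ k.*2.
  rewrite /c /d; have [h|h] := eqVneq (sqmod z) 0.
    have [-> ->] := uv0 z h; rewrite !mul0r addr0 s40// expr0n.
    by rewrite double_eq0 gtn_eqF.
  have -> : u z * t4 z ^+ k * (u z * t4 z ^+ k) + v z * t4 z ^+ k * (v z * t4 z ^+ k) =
    (u z ^+ 2 + v z ^+ 2) * (t4 z ^+ k * t4 z ^+ k) by ring.
  rewrite uv -exprD addnn (_ : (4 * k = k.*2 + k.*2)%N); last by lia.
  by rewrite exprD -mulrA -exprMn s4t4// expr1n mulr1.
have st z a : (sqmod z = 0 -> a = 0) -> s4 z ^+ k * (a * t4 z ^+ k) = a.
  move=> h; have [/h ->|h'] := eqVneq (sqmod z) 0; first by rewrite mul0r mulr0.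
  by rewrite mulrCA -exprMn s4t4// expr1n mulr1.
have [ms [M hM]] := good_s4X k.*2.
have mt : meas K t4 by apply: meas_powR; case: good_sqmod.
have mtk : meas K (fun z => t4 z ^+ k).
  elim: k {k0 c d uv cd st ms M hM uv0} => [|k ih]; first exact: meas_cst.
  by under [X in meas _ X]eq_fun do rewrite exprS; exact: measM.
(* [t4] is in general unbounded near 0; [c] and [d] are bounded because [c^2 + d^2 = |z|^k] is. *)
have bnd a b : a * a + b * b <= M -> `|a| <= 1 + M.
  by move=> h; rewrite ler_norml; apply/andP; split; nra.
have gc : good c.
  split; first by apply: measM => //; case: gu.
  exists (1 + M) => z Sz; apply: (bnd _ (d z)); rewrite cd.
  exact: le_trans (ler_norm _) (hM z Sz).
have gd : good d.
  split; first by apply: measM => //; case: gv.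
  exists (1 + M) => z Sz; apply: (bnd _ (c z)); rewrite addrC cd.
  exact: le_trans (ler_norm _) (hM z Sz).
have := @Phi_positive3 _ _ _ K _ c d x y (J y) (good_s4X k) gc gd.
have -> : (fun z => s4 z ^+ k * s4 z ^+ k) = (fun z => s4 z ^+ k.*2).
  by apply/funext => z; rewrite -exprD addnn.
have -> : (fun z => s4 z ^+ k * c z) = u.
  by apply/funext => z; apply: st => /uv0[].
have -> : (fun z => s4 z ^+ k * d z) = v.
  by apply/funext => z; apply: st => /uv0[].
have PJ f w : Phi f (J w) = J (Phi f w) by rewrite -!bopM PhiJ.
have JA w w' : ip (J w) w' = - ip w (J w').
  by rewrite -adjr adjJ bopN ipNr.
have J1 w w' : ip (J w) (J w') = ip w w'.
  by rewrite JA -(bopM J J) JJ bopN bop1 ipNr opprK.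
rewrite PJ J1.
(* The third vector [J y] carries the imaginary part of [w]. The mixed term drops out: a
   self-adjoint [B] commuting with the skew [J] has [<B y, J y> = 0]. *)
have -> : ip (Phi (fun z => c z * d z) y) (J y) = 0.
  have : ip (Phi (fun z => c z * d z) y) (J y) = - ip (Phi (fun z => c z * d z) y) (J y).
    by rewrite {1}(sa_ip _ _ (Phi_sa K _)) PJ ipC JA ipC (ipC _ (Phi _ _)).
  lra.
have -> : ip (mod_op k y) y = ip (Phi (fun z => c z * c z) y) y + ip (Phi (fun z => d z * d z) y) y.
  rewrite -ipDl -bopD -PhiD; [|exact: goodM|exact: goodM].
  by rewrite /mod_op; congr (ip (bfun (Phi _) _) _); apply/funext => z; rewrite cd.
have -> : ip x (Psi (mon m n) y) = ip (Phi u x) y + ip (Phi v x) (J y).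
  rewrite /Psi bopD bopM ipDr !(sa_ip x _ (Phi_sa K _)) PJ.
  by [].
rewrite -/(mod_op k); lra.
Qed.
Lemma modulus_calculus : exists r : R[i] -> R,
  [/\ good r, forall z, r z ^+ 2 = sqmod z, Phi r = mod_op 1
    & Phi (fun z => r z * r z) = mod_op 2].
Proof.
exists (fun z => s4 z ^+ 2); split=> // [z|].
  by rewrite -exprM s4E.
by rewrite /mod_op; congr Phi; apply/funext => z; rewrite -exprD.
Qed.
End Core.

(** With [x = a] and [y = J b] this reads [N N^* + N^* N = 2 (a^2 + b^2)] for [N = a + J b], without
    [a] and [b] having to commute. *)
Lemma mul_add_sub_sym (A : pzRingType) (x y : A) :
  (x + y) * (x - y) + (x - y) * (x + y) = (x * x - y * y) *+ 2.
Proof.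
rewrite mulrDl mulrBl !mulrBr !mulrDr opprD addrACA [_ - _ + (_ + _)]addrACA addNr addr0.
by rewrite [_ - _ + (_ - _)]addrACA subrr add0r addrACA mulr2n.
Qed.

Lemma bop_mulr2n_inj (R : realType) (H : rhilbert R) (A B : bop H) :
  A *+ 2 = B *+ 2 -> A = B.
Proof.
rewrite -(scaler_nat 2 A) -(scaler_nat 2 B) => /(congr1 (fun C : bop H => 2^-1 *: C)).
by rewrite !scalerA mulVf ?pnatr_eq0// !scale1r.
Qed.

(** * From the moments on [Xi] to the operator *)

Section MomentsDetermine.
Context {R : realType} {H : rhilbert R} (K : calculus H R[i]) (J T : bop H).
Notation S := (supp K).
Notation Phi := (@Phi _ _ _ K).
Notation Psi := (Psi K J).
Notation good := (good K).
Notation mdom := (mdom K).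
Hypotheses (JJ : J * J = -1) (adjJ : adj J = - J).
Hypothesis PhiJ : forall f, Phi f * J = J * Phi f.
Hypotheses (gRe : good (@complex.Re R)) (gIm : good (@complex.Im R)).
Hypothesis Tn : T * adj T = adj T * T.
Implicit Types (x y : H) (z : R[i]) (m n j k : nat).

Notation P := (adj T * T).

Lemma mod_op_eq p q r : p <> q -> (p + q < 2 * r)%N ->
  Psi (mon p q) = opmon T p q -> Psi (mon r r) = opmon T r r ->
  exists A : bop H, [/\ A ^+ 2 = P & forall j, (j <= 2 * r)%N -> mod_op K j = A ^+ j].
Proof.
move=> pq pqr Epq Er.
have sP : sa P by rewrite /sa adjM adjK.
have P0 : ople 0 P by move=> x; rewrite bop0 ip0l bopM adjl ip_ge0.
have cPT : GRing.comm P T by rewrite /GRing.comm [RHS]mulrA Tn.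
have cPTa : GRing.comm P (adj T) by rewrite /GRing.comm -mulrA Tn.
have [A [sA A0 A2 Acomm]] := pos_sqrt sP P0.
exists A; split => //.
set k := (p + q)%N in pqr.
have k0 : (0 < k)%N by rewrite /k; move: pq; case: p {Epq k pqr}; case: q.
have mod0 := mod_op0 K.
have modN : mod_op K (2 * r) = A ^+ (2 * r).
  by rewrite exprM A2 -opmon_diag// -Er -mod_op_diag; congr (mod_op K _); lia.
have modN' : ople (mod_op K (2 * r)) (A ^+ (2 * r)) by rewrite modN => x.
have mod_le j : (j <= 2 * r)%N -> ople (mod_op K j) (A ^+ j).
  apply: (moment_le sA A0 (mod_op_sa K) (mod_op_ge0 gRe gIm) (mod_op_cs gRe gIm)) => //.
  by rewrite mod0.
have modk : mod_op K k = A ^+ k.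
  apply/esym/subr0_eq.
  have sAk : sa (A ^+ k) by exact: saX.
  apply: (@pos_compression_eq0 _ _ _ (A ^+ k)) => //.
  - by apply: saB => //; exact: mod_op_sa.
  - by move=> x; rewrite bop0 ip0l bopB ipBl subr_ge0 mod_le// ltnW.
  - by move=> x; rewrite bopB ipBl gerBl; have := mod_op_ge0 gRe gIm k x; rewrite ip0l.
  move=> y; rewrite bopB ipBl subr_le0.
  pose C := opmon T p q; pose v := - adj C y.
  have := polar_positive JJ adjJ PhiJ gRe gIm ((A ^+ k) y) v k0.
  rewrite Epq -/k -/C /v !boprE !ipE opprK.
  have A2k : A ^+ k * A ^+ k = C * adj C.
    rewrite -exprD addnn -mul2n exprM A2 -opmon_diag// /C adj_opmon opmonM//.
    by rewrite (addnC q).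
  have cAC : GRing.comm (A ^+ k) C.
    apply: commr_sym; apply: commrX; apply: commr_sym.
    by apply: commrM; apply: commrX; apply: Acomm.
  (* The upper bound [X_k <= A^k] controls the second diagonal term by [<A^(3k) y, y>]. The cross
     term is [- 2 <A^(3k) y, y>], so [<A^(3k) y, y>] is left as a lower bound for the first diagonal
     term. *)
  have le1 : ip (mod_op K k (adj C y)) (adj C y) <= ip ((A ^+ k) ((A ^+ k) y)) ((A ^+ k) y).
    apply: le_trans (mod_le k (ltnW pqr) (adj C y)) _.
    rewrite adjr -(bopM C) -cAC bopM -(bopM C) -A2k bopM.
    by rewrite (sa_ip _ y sAk).
  have -> : ip ((A ^+ k) y) (C (adj C y)) = ip ((A ^+ k) ((A ^+ k) y)) ((A ^+ k) y).
    by rewrite -(bopM C) -A2k bopM ipC.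
  lra.
move=> j jN.
apply: (moment_eq sA A0 (mod_op_sa K) (mod_op_ge0 gRe gIm) (mod_op_cs gRe gIm)
  mod0 modN' (k := k)) => //.
by rewrite k0.
Qed.
Lemma moments_determine (Xi : set (nat * nat)) :
  (forall d : nat, (forall m n, Xi (m, n) -> (d%:Z %| m%:Z - n%:Z)%Z) -> (d <= 1)%N) ->
  (exists p q r : nat,
    [/\ p <> q, (p + q < 2 * r)%N, Xi (p, q) & Xi (r, r)]) ->
  (forall m n, Xi (m, n) -> Psi (mon m n) = opmon T m n) ->
  cdom K id /\ Psi id = T.
Proof.
move=> hgcd [p [q [r [pq pqr Xpq Xr]]]] hXi.
have [A [A2 modA]] := mod_op_eq pq pqr (hXi _ _ Xpq) (hXi _ _ Xr).
have [rho [grho rho2 Phirho Phirho2]] := modulus_calculus gRe gIm.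
have mrho : mdom rho.
  by split=> //; rewrite Phirho2 Phirho !modA ?expr2 ?expr1//; lia.
have [msq Psq] : mdom (@sqmod R) /\ Phi (@sqmod R) = P.
  have [h1 h2] := mdomX 2 mrho; rewrite Phirho modA ?expr1 in h2; last by lia.
  have E : (fun z => rho z ^+ 2) = @sqmod R by apply/funext => z; exact: rho2.
  by rewrite E in h1 h2; rewrite h2 A2.
have sqX n : mdom (fun z => sqmod z ^+ n) /\ Phi (fun z => sqmod z ^+ n) = P ^+ n.
  by rewrite -Psq; exact: mdomX.
have Psi_mon_diag n : Psi (mon n n) = P ^+ n by rewrite Psi_diag; case: (sqX n).
have cdomXi m n : Xi (m, n) -> cdom K (mon m n).
  move=> Xmn; have [gu gv] := cgood_mon gRe gIm m n.
  set u := fun z => complex.Re _ in gu; set v := fun z => complex.Im _ in gv.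
  (* Kadison gives [a^2 <= Phi (u^2)] and [b^2 <= Phi (v^2)], where [T^*^m T^n = a + J b]. By
     normality both sides add up to [P^(m+n)], so both inequalities are equalities. *)
  have E1 : Phi (fun z => u z * u z) + Phi (fun z => v z * v z) = P ^+ (m + n).
    have [_ <-] := sqX (m + n)%N; rewrite -PhiD; [|exact: goodM|exact: goodM].
    by congr Phi; apply/funext => z; rewrite -sqmod_mon.
  pose a := Phi u; pose b := Phi v.
  have EA : opmon T m n = a + J * b by rewrite -hXi.
  have EA' : opmon T n m = a - J * b.
    by rewrite -adj_opmon EA adjD adjM adjJ !(Phi_sa K) mulrN PhiJ.
  have Ja : a * J = J * a by exact: PhiJ.
  have Jb : b * J = J * b by exact: PhiJ.
  have E2 : a * a + b * b = P ^+ (m + n).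
    have h1 : opmon T m n * opmon T n m = P ^+ (m + n).
      by rewrite opmonM// addnC opmon_diag.
    have h2 : opmon T n m * opmon T m n = P ^+ (m + n).
      by rewrite opmonM// addnC opmon_diag// addnC.
    have JbJb : J * b * (J * b) = - (b * b).
      by rewrite -mulrA (mulrA b) Jb -!mulrA (mulrA J J) JJ mulN1r.
    have := mul_add_sub_sym a (J * b).
    by rewrite -EA -EA' h1 h2 JbJb opprK -[LHS]mulr2n => /bop_mulr2n_inj.
  have D1 : ople (a * a) (Phi (fun z => u z * u z)).
    by move=> x; rewrite bopM (sa_ip _ _ (Phi_sa K u)); exact: Phi_schwarz.
  have D2 : ople (b * b) (Phi (fun z => v z * v z)).
    by move=> x; rewrite bopM (sa_ip _ _ (Phi_sa K v)); exact: Phi_schwarz.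
  have E12 x : ip (Phi (fun z => u z * u z) x) x + ip (Phi (fun z => v z * v z) x) x =
      ip ((a * a) x) x + ip ((b * b) x) x.
    by rewrite -!ipDl -!bopD E1 E2.
  have saa : sa (a * a) by apply: saM => //; exact: Phi_sa.
  have sbb : sa (b * b) by apply: saM => //; exact: Phi_sa.
  split; (split=> //; apply: sa_form_eq => [||x]; try (exact: Phi_sa); try by []);
    by have := E12 x; have := D1 x; have := D2 x; rewrite -/a -/b; lra.
(* A monomial enters [D] only with its moment identity, so that both survive products. Sums come
   from products and negatives from adjoints, which makes [D] a subgroup. *)
pose D d := exists a b : nat,
  [/\ cdom K (mon a b), Psi (mon a b) = opmon T a b & a%:Z - b%:Z = d].
have mon00 : mon 0 0 = (fun=> 1 : R[i]) by apply/funext => z; rewrite /mon !expr0 mulr1.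
(* The difference -1 means [b = a + 1], that is, the monomial [z |z|^(2a)]; the difference 1 would
   give its conjugate. *)
have [a [b [cab Eab ab]]] : D (- 1).
  have DN d : D d -> D (- d).
    move=> [a [b [cab Eab <-]]]; exists b, a.
    have E : mon b a = (fun z => Num.conj (mon a b z)).
      by apply/funext => z; rewrite conj_mon.
    split; [by rewrite E; exact: cdom_conj| |by rewrite opprB].
    by rewrite E -(adj_Psi adjJ PhiJ (cdom_good cab)) Eab adj_opmon.
  apply: (DN); apply: (int_subgroup_gen (D := D)) => //.
  - exists 0%N, 0%N; rewrite mon00; split=> //; first exact: cdom1.
    by rewrite Psi1 /opmon !expr0 mulr1.
  - move=> d d' [a [b [cab Eab <-]]] [a' [b' [cab' Eab' <-]]].
    exists (a' + a)%N, (b' + b)%N.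
    have E : mon (a' + a) (b' + b) = (fun z => mon a b z * mon a' b' z).
      by apply/funext => z; rewrite monM (addnC a) (addnC b).
    split; [by rewrite E; exact: cdomM| |by rewrite !PoszD; ring].
    by rewrite E (PsiM JJ PhiJ cab (cdom_good cab')) Eab Eab' opmonM.
  - move=> d hd; apply: hgcd => m n Xmn; apply: hd.
    by exists m, n; split; [exact: cdomXi|exact: hXi|].
have {}ab : b = a.+1 by lia.
rewrite {b}ab in cab Eab.
have monE z : mon a a.+1 z = z * (sqmod z ^+ a)%:C%C.
  by rewrite /mon exprSr mulrA conjM_expr mulrC.
have cid : cdom K id.
  have [c1 c2] := cab; split.
    apply: (@mdom_cancel _ _ _ _ (@sqmod R) _ a) => //.
    - by move=> z _; exact: sqmod_ge0.
    - by move=> z /sqmod_eq0 ->.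
    - congr (mdom _): c1; apply/funext => z; rewrite monE cReM /=; ring.
  apply: (@mdom_cancel _ _ _ _ (@sqmod R) _ a) => //.
  - by move=> z _; exact: sqmod_ge0.
  - by move=> z /sqmod_eq0 ->.
  - congr (mdom _): c2; apply/funext => z; rewrite monE cImM /=; ring.
split=> //; pose N := Psi id; rewrite -/N.
have NN : adj N * N = P.
  rewrite (adj_Psi adjJ PhiJ (cgood_id gRe gIm)) -(PsiM JJ PhiJ cid); last first.
    exact: cgood_conj (cgood_id gRe gIm).
  have -> : (fun z => id z * (id z)^*) = mon 1 1 :> (R[i] -> R[i]).
    by apply/funext => z; rewrite /mon !expr1 mulrC.
  by rewrite Psi_mon_diag expr1.
have NN' : N * adj N = P.
  rewrite -NN (adj_Psi adjJ PhiJ (cgood_id gRe gIm)).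
  by apply: (Psi_comm PhiJ cid); exact: cgood_conj (cgood_id gRe gIm).
pose X := N - T.
have PX : P ^+ a * X = 0.
  have e1 : P ^+ a * N = opmon T a a.+1.
    rewrite -Psi_mon_diag -(PsiM JJ PhiJ cid (cgood_mon gRe gIm a a)) -Eab.
    congr Psi; apply/funext => z; by rewrite monE /mon conjM_expr.
  by rewrite mulrBr e1 -opmon_diag// /opmon -mulrA -exprSr subrr.
have PX0 : P * X = 0.
  case: a {cab Eab monE} PX => [|a] PX; last first.
    by apply: sa_expr_mul_eq0 PX; rewrite /sa adjM adjK.
  by move: PX; rewrite expr0 mul1r => ->; rewrite mulr0.
(* [Y = B^* X] satisfies [Y^* Y = X^* P X = 0]. Applied to [B = N] and [B = T], this leaves nothing
   of [X^* X = N^* X - T^* X]. *)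
have kill B : B * adj B = P -> adj B * X = 0.
  by move=> BB; apply: adj_mul_eq0; rewrite adjM adjK -mulrA (mulrA B) BB PX0 mulr0.
apply/subr0_eq/adj_mul_eq0; rewrite -/X adjB mulrBl.
by rewrite (kill N)// (kill T)// subr0.
Qed.
End MomentsDetermine.

(** * Complex Hilbert spaces as real ones *)

(** A separate name for [V], so that its module structure over [R] does not compete with the one
    over [R[i]]. *)
Definition realify (R : realType) (V : completeNormedModType R[i]) : Type := V.

Section Realification.
Context {R : realType} {V : completeNormedModType R[i]}.
HB.instance Definition _ := GRing.Zmodule.on (realify V).

Let rscale (a : R) (x : realify V) : realify V := (a%:C%C *: (x : V)).

Fact rscaleA a b x : rscale a (rscale b x) = rscale (a * b) x.
Proof. by rewrite /rscale scalerA -rmorphM. Qed.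
Fact rscale1 : left_id 1 rscale.
Proof. by move=> x; rewrite /rscale scale1r. Qed.
Fact rscaleDr : right_distributive rscale +%R.
Proof. by move=> a x y; rewrite /rscale scalerDr. Qed.
Fact rscaleDl x : {morph rscale^~ x : a b / a + b}.
Proof. by move=> a b; rewrite /rscale rmorphD scalerDl. Qed.

HB.instance Definition _ := GRing.Zmodule_isLmodule.Build R (realify V)
  rscaleA rscale1 rscaleDr rscaleDl.

Lemma realify_scaleE (a : R) (x : realify V) : a *: x = (a%:C%C *: (x : V)).
Proof. by []. Qed.

Variable dot : {dot V for Num.conj}.
Hypothesis hV : hilbert_norm dot.

Definition rip (x y : realify V) : R := complex.Re (dot x y).

Lemma dotDl x y z : dot (x + y) z = dot x z + dot y z.
Proof. exact: linearDl. Qed.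
Lemma dotZl a x z : dot (a *: x) z = a * dot x z.
Proof. exact: linearZl_LR. Qed.
Lemma dotZr a x z : dot z (a *: x) = Num.conj a * dot z x.
Proof. exact: linearZr_LR. Qed.
Lemma dotC x y : dot x y = Num.conj (dot y x).
Proof. by rewrite hermC expr0 mul1r. Qed.

Fact ripDl x y z : rip (x + y) z = rip x z + rip y z.
Proof. by rewrite /rip dotDl cReD. Qed.
Fact ripZl a x z : rip (a *: x) z = a * rip x z.
Proof. by rewrite /rip realify_scaleE dotZl cReM /= mul0r subr0. Qed.
Fact ripC x y : rip x y = rip y x.
Proof. by rewrite /rip dotC cRe_conj. Qed.
Lemma dot_real x : dot x x = (rip x x)%:C%C.
Proof.
have h : complex.Im (dot x x) = 0 by apply/ger0_Im/dnorm_ge0.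
exact: complex_eqP.
Qed.
Fact rip_gt0 x : x != 0 -> 0 < rip x x.
Proof. by move=> x0; rewrite -ltcR -dot_real; exact: neq0_dnorm_gt0. Qed.
Fact rip_ge0 x : 0 <= rip x x.
Proof. by rewrite -lecR -dot_real; exact: dnorm_ge0. Qed.

Lemma norm_rip (x : V) : `|x| = (Num.sqrt (rip x x))%:C%C.
Proof.
have h : `|x| ^+ 2 = ((Num.sqrt (rip x x))%:C%C) ^+ 2.
  by rewrite hV dot_real -rmorphXn /= sqr_sqrtr ?rip_ge0.
by apply/eqP; rewrite -(@eqrXn2 _ 2)//; [exact/eqP|rewrite lecR sqrtr_ge0].
Qed.

Lemma norm_lt (x : V) (e : R) : 0 < e -> (`|x| < e%:C%C) = (rip x x < e ^+ 2).
Proof.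
move=> e0; rewrite norm_rip ltcR -{1}(ger0_norm (ltW e0)) -sqrtr_sqr ltr_sqrt//.
by rewrite exprn_gt0.
Qed.

Fact rip_complete (u : nat -> realify V) :
  (forall e, 0 < e -> exists N, forall m n, (N <= m)%N -> (N <= n)%N ->
     rip (u m - u n) (u m - u n) < e) ->
  exists l, (fun n => rip (u n - l) (u n - l)) @ \oo --> (0 : R).
Proof.
move=> h.
have : cvg ((u : nat -> V) @ \oo).
  apply: cauchy_cvg; apply: cauchy_exP => e e0.
  have [d0 ->] : 0 < complex.Re e /\ e = (complex.Re e)%:C%C.
    by move: e0; rewrite ltcE /=; case: e => a b /= /andP[/eqP -> ->].
  have [|N hN] := h (complex.Re e ^+ 2); first by rewrite exprn_gt0.
  exists (u N : V); exists N => // n /= Nn; rewrite -ball_normE /=.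
  by rewrite norm_lt//; exact: hN.
move=> /cvg_ex[l hl]; exists (l : realify V).
apply/cvgrPdist_lt => e e0.
have e0' : 0 < (Num.sqrt e)%:C%C by rewrite ltcR sqrtr_gt0.
have /cvgrPdist_lt/(_ _ e0')[N _ hN] := hl.
exists N => // n /= /hN /=; rewrite norm_lt ?sqrtr_gt0// sqr_sqrtr ?(ltW e0)// => h1.
rewrite sub0r normrN ger0_norm ?rip_ge0//.
by rewrite /rip -(opprB l (u n)) hnormN.
Qed.

Definition real_hilbert : rhilbert R :=
  @RHilbert R (realify V) rip ripDl ripZl ripC rip_gt0 rip_complete.

End Realification.

Section ComplexOperators.
Context {R : realType} {V : completeNormedModType R[i]}.
Variable dot : {dot V for Num.conj}.
Hypothesis hV : hilbert_norm dot.
Local Notation H := (real_hilbert hV).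
Implicit Types (S : V -> V) (A B : bop H) (x y : V).

Lemma nrmE x : `|x| = (nrm (x : H))%:C%C.
Proof. exact: norm_rip. Qed.

(** The form is conjugate-linear on the right, so [<x, i y> = - i <x, y>], whose real part is
    [Im <x, y>]. *)
Lemma dotE x y : dot x y = Complex (ip (x : H) y) (ip (x : H) ('i%C *: y : V)).
Proof.
apply: complex_eqP => //=; rewrite /rip dotZr cReM /=.
by rewrite mul0r sub0r mulN1r opprK.
Qed.

Fact blin_imaginary : blin ((fun x : V => 'i%C *: x) : H -> H).
Proof.
split=> [x y|a x|]; first exact: (scalerDr 'i%C (x : V) (y : V)).
  by rewrite !realify_scaleE !scalerA mulrC.
exists 1 => // x; rewrite mul1r -lecR -!nrmE normrZ.
by rewrite normc_def /= expr0n expr1n add0r sqrtr1 mul1r.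
Qed.

Definition Jop : bop H := Bop blin_imaginary.

Lemma JopE x : Jop x = 'i%C *: x :> V. Proof. by []. Qed.

Lemma Jop_sqr : Jop * Jop = -1.
Proof.
apply: bop_eq => x; rewrite bopM bopN bop1 !JopE scalerA -expr2 sqr_i.
by rewrite scaleN1r.
Qed.

Lemma adj_Jop : adj Jop = - Jop.
Proof.
apply/esym/adj_uniq => x y; rewrite bopN.
have e u v : complex.Im (dot u v) = ip (u : H) (Jop v) by rewrite dotE.
by rewrite ipNl ipC -!e (dotC dot y x) cIm_conj opprK.
Qed.

Lemma clinear_comm A : (forall (a : R[i]) x, A (a *: x : V) = a *: (A x : V) :> V) <->
  Jop * A = A * Jop.
Proof.
split=> [h|h a x].
  by apply: bop_eq => x; rewrite !bopM !JopE h.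
have hi y : A ('i%C *: y : V) = 'i%C *: (A y : V) :> V.
  by rewrite -!JopE -(bopM A) -h bopM.
have e (y : V) : a *: y = ((complex.Re a) *: (y : H) : V) + 'i%C *: ((complex.Im a) *: (y : H) : V).
  by rewrite !realify_scaleE scalerA -scalerDl -complexE.
by rewrite !e bopDr hi !bopZr.
Qed.

Lemma bounded_operatorP S : bounded_operator S <->
  exists2 A : bop H, Jop * A = A * Jop & forall x, A x = S x.
Proof.
split=> [[linS bS]|[A AJ AS]].
  pose Sl : {linear V -> V} := HB.pack S (GRing.isLinear.Build _ _ _ _ S linS).
  have /linear_boundedP/pinfty_ex_gt0[r r0 hr] : bounded_near Sl (nbhs (0 : V)) by [].
  have bS' : blin (S : H -> H).
    split=> [x y|a x|]; first exact: (linearD Sl).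
      exact: (linearZ_LR Sl a%:C%C (x : V)).
    have [d0 rE] : 0 < complex.Re r /\ r = (complex.Re r)%:C%C.
      by move: r0; rewrite ltcE /=; case: r {hr} => a b /= /andP[/eqP -> ->].
    exists (complex.Re r); first exact: ltW.
    by move=> x; have := hr x; rewrite /= !nrmE rE -rmorphM lecR.
  exists (Bop bS') => //; apply/clinear_comm => a x /=.
  exact: (linearZ_LR Sl).
have /clinear_comm AZ := AJ.
have linS : linear S by move=> a x y; rewrite -!AS bopDr AZ.
split => //.
pose Sl : {linear V -> V} := HB.pack S (GRing.isLinear.Build _ _ _ _ S linS).
have [C C0 hC] := bop_bounded A.
suff : bounded_near Sl (nbhs (0 : V)) by [].
apply/linear_boundedP; near=> r => x.
have : C%:C%C <= r by near: r; apply: nbhs_pinfty_ge; rewrite complex_real.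
move=> Cr; apply: le_trans (_ : C%:C%C * `|x| <= _); last by rewrite ler_wpM2r.
by rewrite /= -AS !nrmE -rmorphM lecR.
Unshelve. all: by end_near.
Qed.

Lemma adj_comm_Jop A : Jop * A = A * Jop -> Jop * adj A = adj A * Jop.
Proof.
move=> h; have := congr1 (@adj _ H) h; rewrite !adjM adj_Jop mulrN mulNr.
by move/oppr_inj => ->.
Qed.

Lemma adjoint_adj S A : Jop * A = A * Jop -> (forall x, A x = S x) ->
  adjoint dot S = adj A.
Proof.
move=> AJ AS; apply: xget_unique => [|S' [_ hS']].
  split; first by apply/bounded_operatorP; exists (adj A) => //; exact: adj_comm_Jop.
  move=> x y; rewrite !dotE -AS; congr Complex; first by rewrite adjr.
  by rewrite -!JopE -(bopM Jop) (adj_comm_Jop AJ) bopM adjr.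
apply/funext => y; apply: (@ip_inj _ H) => z; rewrite ipC [RHS]ipC adjr.
by have := congr1 (@complex.Re R) (hS' z y); rewrite !dotE /= -AS => <-.
Qed.

(** Complex polarization, which needs no self-adjointness: the first form at [x + y] gives
    [<A x, y> + <A y, x> = 0], the second at [x - i y] gives [<A x, y> - <A y, x> = 0]. *)
Lemma complex_form_eq0 A : Jop * A = A * Jop ->
  (forall x, ip (A x) x = 0) -> (forall x, ip (A x) (Jop x) = 0) -> A = 0.
Proof.
move=> AJ h1 h2; apply: bop_inj => x y; rewrite bop0 ip0l.
have JJ w : Jop (Jop w) = - w by rewrite -(bopM Jop) Jop_sqr bopN bop1.
have e : ip (A (Jop y)) (Jop x) = ip (A y) x.
  rewrite -(bopM A) -AJ bopM -[ip (Jop _) _]adjr adj_Jop bopN JJ opprK.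
  by [].
have e0 : ip (A (Jop y)) y = 0.
  by rewrite -(bopM A) -AJ bopM ipC -adjl adj_Jop bopN ipNl ipC h2 oppr0.
have := h1 (x + y); have := h2 (x - Jop y).
rewrite [Jop (_ - _)]bopBr JJ opprK !bopBr !bopDr !ipE e e0 !h1 !h2.
lra.
Qed.

Lemma complex_form_inj A B : Jop * A = A * Jop -> Jop * B = B * Jop ->
  (forall x, dot (A x) x = dot (B x) x) -> A = B.
Proof.
move=> AJ BJ h; apply/subr0_eq/complex_form_eq0 => [|x|x].
- by rewrite mulrBr mulrBl AJ BJ.
- rewrite bopB ipBl; have -> : ip (A x) x = ip (B x) x; last by rewrite subrr.
  by have := congr1 (@complex.Re R) (h x).
- rewrite bopB ipBl; have -> : ip (A x) (Jop x) = ip (B x) (Jop x); last by rewrite subrr.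
  by have := congr1 (@complex.Im R) (h x); rewrite !dotE.
Qed.

Lemma op_integralE F f A : Jop * A = A * Jop ->
  (forall h, dot (A h) h = integralC (diag_measure dot F h) f) ->
  op_integral dot F f = A.
Proof.
move=> AJ hA; apply: xget_unique => [|S [/bounded_operatorP[B BJ BS] hS]].
  by split=> //; apply/bounded_operatorP; exists A.
apply/funext => x; rewrite -BS.
suff -> : B = A by [].
by apply: complex_form_inj => // h; rewrite hA -hS BS.
Qed.
End ComplexOperators.

(** * The calculus of a semispectral measure *)

Section MeasurableFunctions.
Context d (T : measurableType d) (R : realType) (D : set T).
Hypothesis mD : measurable D.

Fact measurable_powR_comp (p : R) (f : T -> R) :
  measurable_fun D f -> measurable_fun D (fun x => f x `^ p).
Proof. by move=> mf; apply: (measurableT_comp (measurable_powR p)). Qed.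

Fact measurable_ge_indic (c : R) (f : T -> R) :
  measurable_fun D f -> measurable_fun D (fun x => (c <= f x)%R%:R : R).
Proof.
move=> mf; have -> : (fun x => (c <= f x)%R%:R) = (fun x => if c <= f x then 1 else 0) :> (T -> R).
  by apply/funext => x; case: (c <= f x).
apply: measurable_fun_if => //; try exact: measurable_cst.
by apply: measurable_fun_ler => //; exact: measurable_cst.
Qed.

Definition measurable_mspace : mspace R T := @MSpace R T D
  (fun f => measurable_fun D f)
  (fun c => measurable_cst c)
  (fun f g mf mg => measurable_funD mf mg)
  (fun f g mf mg => measurable_funM mf mg)
  measurable_powR_comp measurable_ge_indic
  (fun u f mu uf => measurable_fun_cvg mu uf).

Notation good := (good measurable_mspace).

Lemma good_indic A : measurable A -> good (\1_A : T -> R).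
Proof.
move=> mA; split; first exact: measurable_indic.
by exists 1 => x _; rewrite indicE; case: (x \in A); rewrite ?normr1 ?normr0.
Qed.

Variable mu : {measure set T -> \bar R}.
Hypothesis muD : (mu D < +oo)%E.
Notation I := (fun f => \int[mu]_(x in D) f x)%R.

Lemma good_integrable f : good f -> mu.-integrable D (EFin \o f).
Proof.
move=> [mf [M hM]]; apply: measurable_bounded_integrable => //.
exists M; split; first exact: num_real.
by move=> r Mr x Dx; apply: le_trans (hM x Dx) (ltW Mr).
Qed.

Lemma good_integralD f g : good f -> good g -> I (fun x => f x + g x) = I f + I g.
Proof. by move=> gf gg; apply: RintegralD => //; exact: good_integrable. Qed.

Lemma good_integralZ c f : good f -> I (fun x => c * f x) = c * I f.
Proof. by move=> gf; apply: RintegralZl => //; exact: good_integrable. Qed.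

Lemma good_integral_lim (u : nat -> T -> R) f M : (forall n, good (u n)) ->
  (forall n x, D x -> `|u n x| <= M) ->
  (forall x, D x -> (fun n => u n x) @ \oo --> (f x : R)) ->
  (fun n => I (u n)) @ \oo --> (I f : R).
Proof.
move=> gu uM uf; have gf : good f by exact: (good_lim gu uM uf).
have [|||||_ _] := @dominated_convergence _ _ _ mu D mD
    (fun n => EFin \o u n) (EFin \o f) (EFin \o cst M).
- by move=> n; apply/measurable_EFinP; case: (gu n).
- by apply/measurable_EFinP; case: gf.
- by apply: aeW => x Dx; apply/cvg_EFin; [exact: nearW|exact: uf].
- by apply: good_integrable; exact: good_cst.
- by apply: aeW => x n Dx; rewrite /= lee_fin uM.
move=> h; apply: fine_cvg; rewrite fineK//.
by apply: integrable_fin_num => //; exact: good_integrable.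
Qed.

Lemma good_integral_indic A : measurable A -> A `<=` D ->
  I (\1_A : T -> R) = fine (mu A).
Proof. by move=> mA AD; rewrite /Rintegral integral_indic// setIidl. Qed.

Lemma eq_good_integral f g : (forall x, D x -> f x = g x) -> I f = I g.
Proof. by move=> fg; apply: eq_Rintegral => x; rewrite inE => /fg. Qed.

End MeasurableFunctions.

Section LinearRelations.
Context d (T : measurableType d) (R : realType) (D : set T) (mD : measurable D).
Context (I : Type) (mu : I -> {measure set T -> \bar R}).
Hypothesis muD : forall i, (mu i D < +oo)%E.
Notation good := (good (measurable_mspace R mD)).

(** Linear relations between finitely many measures pass to integrals. As in [form], an indicator
    [e] is carried along so that [good_ind] can glue. *)
Lemma integral_relation (s : seq (R * I)) :
  (forall A, measurable A -> \sum_(p <- s) p.1 * fine (mu p.2 A) = 0) ->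
  forall f, good f -> \sum_(p <- s) p.1 * \int[mu p.2]_(x in D) f x = 0.
Proof.
move=> rel f gf.
pose P f := forall e : T -> R, good e -> (forall x, e x = 0 \/ e x = 1) ->
  \sum_(p <- s) p.1 * \int[mu p.2]_(x in D) (e x * f x) = 0.
suff : P f.
  move=> /(_ (fun=> 1) (good_cst _ 1) (fun=> or_intror erefl)) h.
  by rewrite -[RHS]h; apply: eq_bigr => p _; under [in RHS]eq_fun do rewrite mul1r.
apply: (good_ind (E := measurable_mspace R mD)) gf.
- move=> c e ge e01.
  pose A := D `&` e @^-1` [set 1].
  have mA : measurable A by case: ge => me _; apply: me.
  have intA (p : R * I) : \int[mu p.2]_(x in D) (e x * c) = c * fine (mu p.2 A).
    rewrite -(good_integral_indic mD (mu p.2) mA); last by move=> x [].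
    rewrite -(good_integralZ (muD p.2)); last exact: good_indic.
    apply: eq_good_integral => x Dx; rewrite mulrC; congr (_ * _).
    rewrite indicE; case: (e01 x) => ex; rewrite ex.
      by rewrite memNset// => -[_ /=]; rewrite ex => /esym/eqP; rewrite oner_eq0.
    by rewrite mem_set.
  under eq_bigr => p _ do rewrite intA mulrCA.
  by rewrite -mulr_sumr rel ?mulr0.
- move=> i f1 f2 gi i01 gf1 gf2 p1 p2 e ge e01.
  have gei : good (fun s => e s * i s) by exact: goodM.
  have gei' : good (fun s => e s * (1 - i s)).
    by apply: goodM => //; apply: goodB => //; exact: good_cst.
  have h1 x : e x * i x = 0 \/ e x * i x = 1.
    by case: (e01 x) => ->; case: (i01 x) => ->; rewrite ?mul0r ?mulr1 ?mulr0; auto.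
  have h2 x : e x * (1 - i x) = 0 \/ e x * (1 - i x) = 1.
    by case: (e01 x) => ->; case: (i01 x) => ->; rewrite ?mul0r ?subrr ?subr0 ?mulr1 ?mulr0; auto.
  rewrite -[RHS](addr0 0) -[X in _ = X + _](p1 _ gei h1) -[X in _ = _ + X](p2 _ gei' h2).
  rewrite -big_split/=; apply: eq_bigr => p _; rewrite -mulrDr; congr (_ * _).
  rewrite -(good_integralD (muD p.2)); [|exact: goodM|exact: goodM].
  by apply: eq_good_integral => x _; ring.
- move=> u f1 M gu gf1 pu uM uf e ge e01.
  apply: (@cvgR_unique _ (fun n => \sum_(p <- s) p.1 * \int[mu p.2]_(x in D) (e x * u n x))).
    apply: cvg_big => [|p _]; first exact: add_continuous.
    apply: cvgMl_tmp; apply: (good_integral_lim (muD p.2) (M := M)) => [n|n x Dx|x Dx].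
    - exact: goodM.
    - by case: (e01 x) => ->; rewrite ?mul0r ?mul1r ?uM// normr0 (le_trans _ (uM n x Dx)).
    - by apply: cvgMl_tmp; exact: uf.
  under eq_fun do rewrite (pu _ e ge e01); exact: cvg_cst.
Qed.
End LinearRelations.

Lemma open_measurableC (R : realType) (U : set R[i]^o) :
  open U -> measurable (U : set (borelC R)).
Proof. by move=> oU; apply: sub_sigma_algebra. Qed.

Lemma closed_measurableC (R : realType) (U : set R[i]^o) :
  closed U -> measurable (U : set (borelC R)).
Proof.
move=> cU; rewrite -(setCK (U : set (borelC R))); apply: measurableC.
by apply: open_measurableC; exact: closed_openC.
Qed.

Local Arguments ip : simpl never.
Local Arguments bfun : simpl never.

Section SemispectralCalculus.
Context {R : realType} {V : completeNormedModType R[i]}.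
Variable dot : {dot V for Num.conj}.
Hypothesis hV : hilbert_norm dot.
Local Notation H := (real_hilbert hV).
Variable F : set (borelC R) -> V -> V.
Hypothesis hF : semispectral dot F.
Variable S : set R[i]^o.
Hypotheses (cS : closed S) (FS : F (~` S) = (fun=> 0)).
Implicit Types (A : set (borelC R)) (x y h : H).

Let mS : measurable (S : set (borelC R)).
Proof. exact: closed_measurableC. Qed.

(** Positivity contains the reality of [<F(A) h, h>], which on a complex space already forces
    self-adjointness. *)
Lemma semispectral_op A : measurable A -> exists B : bop H,
  [/\ Jop hV * B = B * Jop hV, forall x, B x = F A x & sa B].
Proof.
move=> mA; have [Fb Fp _] := hF.
have [B BJ BF] := (bounded_operatorP hV _).1 (Fb A mA).
exists B; split => //.
have Bim x : ip (B x) (Jop hV x) = 0.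
  have [_ Fp' _] := Fp x; have := ger0_Im (Fp' A mA).
  by rewrite -BF (dotE hV).
have aBJ := adj_comm_Jop BJ.
suff /subr0_eq : adj B - B = 0 by [].
apply: (complex_form_eq0 (hV := hV)) => [|x|x].
- by rewrite mulrBr mulrBl aBJ BJ.
- by rewrite bopB ipBl adjl ipC subrr.
- by rewrite bopB ipBl adjl Bim subr0 -(bopM B) -BJ bopM -adjl adj_Jop bopN ipNl ipC Bim oppr0.
Qed.

(** A measure structure requires nonnegativity on every set, whereas [F] is constrained on Borel
    sets only; the default 0 covers the rest. *)
Definition diag_total h A : \bar R :=
  if pselect (measurable A) then diag_measure dot F h A else 0%E.

Lemma diag_totalE h A : measurable A -> diag_total h A = diag_measure dot F h A.
Proof. by move=> mA; rewrite /diag_total; case: pselect. Qed.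

Let diag_total0 h : diag_total h set0 = 0%E.
Proof. by rewrite diag_totalE//; case: hF => _ /(_ h)[]. Qed.

Let diag_total_ge0 h A : (0 <= diag_total h A)%E.
Proof.
rewrite /diag_total; case: pselect => // mA; rewrite lee_fin.
have [_ /(_ h)[_ /(_ A mA) p _] _] := hF.
by move: p; rewrite lecE => /andP[].
Qed.

Let diag_total_sigma_additive h : semi_sigma_additive (diag_total h).
Proof.
move=> G mG tG mU; rewrite diag_totalE//.
under eq_fun do under eq_bigr do rewrite diag_totalE//.
by have [_ /(_ h)[_ _ add] _] := hF; exact: (add G mG tG mU).
Qed.

Definition diag_mu h : {measure set (borelC R) -> \bar R} :=
  HB.pack (diag_total h) (isMeasure.Build _ _ _ (diag_total h)
    (diag_total0 h) (diag_total_ge0 h) (@diag_total_sigma_additive h)).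

Lemma diag_muE h A : measurable A -> diag_mu h A = (complex.Re (dot (F A h) h))%:E.
Proof. exact: diag_totalE. Qed.

Lemma diag_mu_op h A (B : bop H) : measurable A -> (forall x, B x = F A x) ->
  fine (diag_mu h A) = ip (B h) h.
Proof. by move=> mA BF; rewrite diag_muE//= -BF. Qed.

Let diag_mu_fin h A : measurable A -> (diag_mu h A < +oo)%E.
Proof. by move=> mA; rewrite diag_muE// ltry. Qed.

Let muS h : (diag_mu h S < +oo)%E. Proof. exact: diag_mu_fin. Qed.

Lemma diag_muC h : diag_mu h (~` S) = 0%E.
Proof.
rewrite diag_muE; last exact: measurableC.
by rewrite FS; have := dotZl dot 0 (h : V) h; rewrite !scale0r mul0r => ->.
Qed.

Definition borel_space : mspace R R[i] := measurable_mspace R mS.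

Definition diag_integral h (f : R[i] -> R) : R := \int[diag_mu h]_(z in S) f z.

(** An identity between quadratic forms of all self-adjoint operators holds for each [F A], hence
    for the integrals. Bilinearity of the polarized integral thus reduces to [ring]. *)
Lemma diag_integral_relation (s : seq (R * H)) f : good borel_space f ->
  (forall B : bop H, sa B -> \sum_(p <- s) p.1 * ip (B p.2) p.2 = 0) ->
  \sum_(p <- s) p.1 * diag_integral p.2 f = 0.
Proof.
move=> gf hs; apply: (integral_relation (mu := diag_mu) muS) gf => A mA.
have [B [_ BF sB]] := semispectral_op mA.
by rewrite -[RHS](hs B sB); apply: eq_bigr => p _; rewrite (diag_mu_op _ mA BF).
Qed.

Lemma diag_integral_cst1 h : diag_integral h (fun=> 1) = ip h h.
Proof.
have -> : diag_integral h (fun=> 1) = diag_integral h (\1_S : R[i] -> R).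
  by apply: eq_good_integral => z Sz; rewrite indicE mem_set.
rewrite /diag_integral (good_integral_indic mS)//.
have e : (diag_mu h S + diag_mu h (~` S) = diag_mu h setT)%E.
  rewrite -measureU//; [by rewrite setUCr|exact: measurableC|exact: setICr].
have e0 : diag_mu h (~` S) = 0%E := diag_muC h.
move: e; rewrite e0 adde0 => ->.
by rewrite diag_muE//; case: hF => _ _ ->.
Qed.
Let good f := good borel_space f.

Let J := diag_integral.

Lemma diag_integralD h f g : good f -> good g ->
  J h (fun z => f z + g z) = J h f + J h g.
Proof. by move=> gf gg; exact: (good_integralD (muS h)). Qed.

Lemma diag_integralZ h c f : good f -> J h (fun z => c * f z) = c * J h f.
Proof. by move=> gf; exact: (good_integralZ (muS h)). Qed.

Lemma diag_integral_ge0 h f : (forall z, S z -> 0 <= f z) -> 0 <= J h f.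
Proof. by move=> f0; exact: Rintegral_ge0. Qed.

Lemma diag_integral_le h f M : good f -> (forall z, S z -> `|f z| <= M) ->
  `|J h f| <= M * ip h h.
Proof.
move=> gf fM; rewrite -diag_integral_cst1 -diag_integralZ; last exact: good_cst.
have gM : good (fun=> M * 1) by exact: good_cst.
have gN : good (fun z => -1 * f z) by exact: goodZ.
have h1 : 0 <= J h (fun z => M * 1 + f z).
  apply: diag_integral_ge0 => z Sz; have := fM z Sz.
  by rewrite ler_norml mulr1 => /andP[]; lra.
have h2 : 0 <= J h (fun z => M * 1 + -1 * f z).
  apply: diag_integral_ge0 => z Sz; have := fM z Sz.
  by rewrite ler_norml mulr1 => /andP[]; lra.
rewrite diag_integralD// in h1; rewrite diag_integralD// (diag_integralZ h (-1) gf) in h2.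
by rewrite ler_norml; apply/andP; split; lra.
Qed.

Definition polar_form f x y : R := (J (x + y) f - J (x - y) f) / 4.

Section PolarForm.
Variable f : R[i] -> R.
Hypothesis gf : good f.

Lemma polar_formC x y : polar_form f x y = polar_form f y x.
Proof.
pose s : seq (R * H) := [:: (1, x + y); (-1, x - y); (-1, y + x); (1, y - x)].
have rel (B : bop H) : sa B -> \sum_(p <- s) p.1 * ip (B p.2) p.2 = 0.
  by move=> _; rewrite !big_cons big_nil /= !boprE !ipE; ring.
by have := diag_integral_relation gf rel; rewrite !big_cons big_nil /polar_form /J /=; lra.
Qed.

Lemma polar_formDl x x' y : polar_form f (x + x') y = polar_form f x y + polar_form f x' y.
Proof.
pose s : seq (R * H) := [:: (1, x + x' + y); (-1, x + x' - y); (-1, x + y);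
  (1, x - y); (-1, x' + y); (1, x' - y)].
have rel (B : bop H) : sa B -> \sum_(p <- s) p.1 * ip (B p.2) p.2 = 0.
  by move=> _; rewrite !big_cons big_nil /= !boprE !ipE; ring.
by have := diag_integral_relation gf rel; rewrite !big_cons big_nil /polar_form /J /=; lra.
Qed.

Lemma polar_formZl a x y : polar_form f (a *: x) y = a * polar_form f x y.
Proof.
pose s : seq (R * H) := [:: (1, a *: x + y); (-1, a *: x - y); (- a, x + y);
  (a, x - y)].
have rel (B : bop H) : sa B -> \sum_(p <- s) p.1 * ip (B p.2) p.2 = 0.
  by move=> _; rewrite !big_cons big_nil /= !boprE !ipE; ring.
by have := diag_integral_relation gf rel; rewrite !big_cons big_nil /polar_form /J /=; lra.
Qed.

Lemma polar_form_diag h : polar_form f h h = J h f.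
Proof.
pose s : seq (R * H) := [:: (1, h + h); (-1, h - h); (-4, h)].
have rel (B : bop H) : sa B -> \sum_(p <- s) p.1 * ip (B p.2) p.2 = 0.
  by move=> _; rewrite !big_cons big_nil /= !boprE !ipE; ring.
by have := diag_integral_relation gf rel; rewrite !big_cons big_nil /polar_form /J /=; lra.
Qed.

(** The polarized form is not positive, but after adding [M <x, y>] it lies between 0 and
    [2 M <x, x>] on the diagonal. Cauchy-Schwarz there and subtraction give [3 M]. *)
Lemma polar_form_bounded : exists2 C, 0 <= C &
  forall x y, `|polar_form f x y| <= C * nrm x * nrm y.
Proof.
have [_ [M0 hM0]] := gf; pose M := `|M0|.
have hM z : S z -> `|f z| <= M.
  by move=> Sz; apply: le_trans (hM0 z Sz) (ler_norm _).
have M_ge0 : 0 <= M by exact: normr_ge0.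
exists (3 * M) => [|x y]; first by rewrite mulr_ge0.
pose s x y := M * ip x y + polar_form f x y.
have sp x' : 0 <= s x' x' <= 2 * M * ip x' x'.
  rewrite /s polar_form_diag; have := diag_integral_le x' gf hM.
  by rewrite ler_norml => /andP[h1 h2]; apply/andP; split; lra.
have cs : s x y ^+ 2 <= s x x * s y y.
  apply: form_cauchy_schwarz => [x' y' z|a x' z|x' y'|x'].
  - by rewrite /s ipDl polar_formDl; ring.
  - by rewrite /s ipZl polar_formZl; ring.
  - by rewrite /s ipC polar_formC.
  - by case/andP: (sp x').
have /andP[a1 a2] := sp x; have /andP[b1 b2] := sp y.
have nx := nrm_ge0 x; have ny := nrm_ge0 y.
have hs : `|s x y| <= 2 * M * nrm x * nrm y.
  rewrite -[leRHS]ger0_norm ?mulr_ge0// -ler_sqr ?nnegrE ?normr_ge0// !real_normK ?num_real//.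
  apply: le_trans cs _; apply: le_trans (ler_pM a1 b1 a2 b2) _.
  by rewrite -!nrm_sqr le_eqVlt; apply/orP; left; apply/eqP; ring.
have hi : `|M * ip x y| <= M * nrm x * nrm y.
  by rewrite normrM ger0_norm// -mulrA ler_wpM2l// cauchy_schwarz.
have -> : polar_form f x y = s x y - M * ip x y by rewrite /s; ring.
by apply: le_trans (ler_normB _ _) _; lra.
Qed.

Lemma integral_op_exists : exists A : bop H, forall x y, ip (A x) y = polar_form f x y.
Proof.
have [C C0 hC] := polar_form_bounded.
apply: (form_op C0) => //.
- exact: polar_formDl.
- exact: polar_formZl.
- by move=> x y z; rewrite polar_formC polar_formDl !(polar_formC _ z).
- by move=> a x z; rewrite polar_formC polar_formZl (polar_formC x).
Qed.
End PolarForm.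

(** The value 0 for other functions keeps self-adjointness and commutation with [Jop] unconditional,
    as the calculus demands. *)
Definition integral_op f : bop H :=
  if pselect (good f) is left gf then projT1 (cid (integral_op_exists gf)) else 0.

Lemma integral_opE f x y : good f -> ip (integral_op f x) y = polar_form f x y.
Proof. by move=> gf; rewrite /integral_op; case: pselect => // ?; case: cid. Qed.

Lemma integral_op_diag f h : good f -> ip (integral_op f h) h = J h f.
Proof. by move=> gf; rewrite integral_opE// polar_form_diag. Qed.

Lemma integral_op_sa f : sa (integral_op f).
Proof.
have [gf|ngf] := pselect (good f).
  by apply/saP => x y; rewrite [RHS]ipC !integral_opE// polar_formC.
rewrite /integral_op; case: pselect => // _.
by apply/saP => x y; rewrite !bop0 !ipE.
Qed.

Fact integral_op1 : integral_op (fun=> 1) = 1.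
Proof.
apply: sa_form_eq => [||h]; [exact: integral_op_sa|exact: sa1|].
rewrite integral_op_diag; last exact: good_cst.
by rewrite bop1; exact: diag_integral_cst1.
Qed.

Fact integral_opD f g : good f -> good g ->
  integral_op (fun z => f z + g z) = integral_op f + integral_op g.
Proof.
move=> gf gg; apply: sa_form_eq => [||h]; first exact: integral_op_sa.
  by apply: saD; exact: integral_op_sa.
rewrite bopD ipDl !integral_op_diag//; last exact: goodD.
exact: diag_integralD.
Qed.

Fact integral_opZ c f : good f -> integral_op (fun z => c * f z) = c *: integral_op f.
Proof.
move=> gf; apply: sa_form_eq => [||h]; first exact: integral_op_sa.
  by apply: saZ; exact: integral_op_sa.
rewrite bopZ ipZl !integral_op_diag//; last exact: goodZ.
exact: diag_integralZ.
Qed.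

Fact integral_op_ge0 f : good f -> (forall z, S z -> 0 <= f z) -> ople 0 (integral_op f).
Proof.
by move=> gf f0 h; rewrite bop0 ip0l integral_op_diag//; exact: diag_integral_ge0.
Qed.

Fact integral_op_lim (u : nat -> R[i] -> R) f M : (forall n, good (u n)) ->
  (forall n z, S z -> `|u n z| <= M) ->
  (forall z, S z -> (fun n => u n z) @ \oo --> (f z : R)) ->
  forall h, (fun n => ip (integral_op (u n) h) h) @ \oo --> (ip (integral_op f h) h : R).
Proof.
move=> gu uM uf h; have gf : good f by exact: (good_lim gu uM uf).
rewrite integral_op_diag//; under eq_fun do rewrite integral_op_diag//.
exact: (good_integral_lim (muS h) gu uM uf).
Qed.

Definition semispectral_calculus : calculus H R[i] :=
  @Calculus R H R[i] borel_space integral_op integral_op1 integral_opD integral_opZ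
    integral_op_sa integral_op_ge0 integral_op_lim.

(** Each [F A] commutes with the isometry [Jop], so [h] and [Jop h] have the same diagonal measure,
    and the polarized integral is invariant under [Jop]. *)
Lemma integral_op_Jop f : integral_op f * Jop hV = Jop hV * integral_op f.
Proof.
have JJ x y : ip (Jop hV x) (Jop hV y) = ip x y.
  by rewrite -adjl adj_Jop -(bopM _ (Jop hV)) mulNr Jop_sqr opprK.
have [gf|ngf] := pselect (good f); last first.
  rewrite /integral_op; case: pselect => // _; rewrite mul0r mulr0 //.
have e x y : ip (integral_op f (Jop hV x)) (Jop hV y) = ip (integral_op f x) y.
  rewrite !integral_opE// /polar_form -!bopDr -!bopBr.
  have JI h : J (Jop hV h) f = J h f.
    have rel A : measurable A ->
        \sum_(p <- [:: (1, Jop hV h); (-1, h)]) p.1 * fine (diag_mu p.2 A) = 0.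
      move=> mA; have [B [BJ BF _]] := semispectral_op mA.
      rewrite !big_cons big_nil /= !(diag_mu_op _ mA BF) -(bopM B) -BJ bopM JJ; ring.
    have := integral_relation (mu := diag_mu) muS rel gf.
    by rewrite !big_cons big_nil /= /J /diag_integral; lra.
  by rewrite !JI.
apply: bop_inj => x y; rewrite !bopM.
have -> : y = Jop hV (- Jop hV y) by rewrite bopNr -(bopM _ (Jop hV)) Jop_sqr bopN bop1 opprK.
by rewrite e JJ.
Qed.
End SemispectralCalculus.

(** * Topology and Borel structure of the plane *)

Section ComplexTopology.
Context {R : realType}.
Implicit Types z w : R[i].

Lemma normc_Re_le z : `|complex.Re z|%:C%C <= `|z|.
Proof. exact: normc_ge_Re. Qed.

Lemma normc_Im_le z : `|complex.Im z|%:C%C <= `|z|.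
Proof.
have := normc_ge_Re (z * 'i%C); rewrite ReiNIm normrN normrM (normc_def 'i%C) /=.
by rewrite expr0n expr1n add0r sqrtr1 mulr1.
Qed.

Lemma ball_complex (z w : R[i]^o) (e : R) : `|z - w| < e%:C%C ->
  `|complex.Re z - complex.Re w| < e /\ `|complex.Im z - complex.Im w| < e.
Proof.
move=> h; rewrite -!ltcR.
have -> : complex.Re z - complex.Re w = complex.Re (z - w) by case: (z) (w) => [a b] [c d].
have -> : complex.Im z - complex.Im w = complex.Im (z - w) by case: (z) (w) => [a b] [c d].
by split; apply: le_lt_trans h; [exact: normc_Re_le|exact: normc_Im_le].
Qed.

Lemma continuous_Re : continuous (@complex.Re R : R[i]^o -> R^o).
Proof.
move=> z A /nbhs_ballP[e /= e0 eA]; apply/nbhs_ballP; exists e%:C%C => /=.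
  by rewrite ltcR.
move=> w; rewrite -ball_normE /= => /ball_complex[h1 h2]; apply: eA.
by rewrite -ball_normE.
Qed.

Lemma continuous_Im : continuous (@complex.Im R : R[i]^o -> R^o).
Proof.
move=> z A /nbhs_ballP[e /= e0 eA]; apply/nbhs_ballP; exists e%:C%C => /=.
  by rewrite ltcR.
move=> w; rewrite -ball_normE /= => /ball_complex[h1 h2]; apply: eA.
by rewrite -ball_normE.
Qed.

Lemma continuous_measurableC (f : R[i]^o -> R^o) : continuous f ->
  measurable_fun setT (f : borelC R -> R).
Proof.
move=> /continuousP cf; apply: (measurability _ (RGenOpens.measurableE R)).
move=> _ [_ [a [b ->] <-]]; rewrite setTI; apply: open_measurableC.
exact/cf/interval_open.
Qed.

Lemma continuous_bounded_on (f : R[i]^o -> R^o) (S : set R[i]^o) : continuous f ->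
  compact S -> exists M, forall z, S z -> `|f z| <= M.
Proof.
move=> cf cS.
have /compact_bounded[M [_ hM]] : compact (f @` S).
  by apply: continuous_compact => //; exact: continuous_subspaceT.
exists (M + 1) => z Sz; apply: (hM (M + 1)); first by rewrite ltrDl.
by exists z.
Qed.

(** A countable base made of intersections of half-planes, the sets that [mdom_gt] reaches from [Re]
    and [Im]. *)
Definition rat_box (q : rat * rat * rat * rat) : set R[i] :=
  let: (a, b, c, d) := q in
  [set z | ratr a < complex.Re z < ratr b /\ ratr c < complex.Im z < ratr d].

Lemma open_rat_box (U : set R[i]^o) (z : R[i]^o) : open U -> U z ->
  exists q, rat_box q z /\ rat_box q `<=` U.
Proof.
move=> oU Uz; have /nbhs_ballP[e /= e0 eU] : nbhs z U by exact: open_nbhs_nbhs.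
have [d0 eE] : 0 < complex.Re e /\ e = (complex.Re e)%:C%C.
  by move: e0 {eU}; rewrite ltcE /=; case: e => a b /= /andP[/eqP -> ->].
set r := complex.Re e in d0 eE.
have close (x : R) : exists a b : rat, ratr a < x < ratr b /\ ratr b - ratr a < r / 2.
  have [|a] := @rat_in_itvoo R (x - r / 4) x; first by lra.
  rewrite in_itv /= => /andP[a1 a2].
  have [|b] := @rat_in_itvoo R x (x + r / 4); first by lra.
  rewrite in_itv /= => /andP[b1 b2].
  by exists a, b; rewrite a2 b1; split => //; lra.
have [a [b [/andP[a1 a2] ab]]] := close (complex.Re z).
have [c [d [/andP[c1 c2] cd]]] := close (complex.Im z).
exists (a, b, c, d); split; first by rewrite /= a1 a2 c1 c2.
move=> w [/andP[a3 a4] /andP[c3 c4]]; apply: eU; rewrite -ball_normE /= normc_def eE ltcR.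
have -> : complex.Re (z - w) = complex.Re z - complex.Re w by case: (z) (w) => [? ?] [? ?].
have -> : complex.Im (z - w) = complex.Im z - complex.Im w by case: (z) (w) => [? ?] [? ?].
rewrite -[ltRHS]ger0_norm ?(ltW d0)// -sqrtr_sqr ltr_sqrt ?exprn_gt0//.
have sq (x : R) : - (r / 2) < x < r / 2 -> x ^+ 2 < (r / 2) ^+ 2.
  by move=> /andP[x1 x2]; rewrite -subr_gt0 subr_sqr mulr_gt0//; lra.
have h1 : (complex.Re z - complex.Re w) ^+ 2 < (r / 2) ^+ 2.
  by apply: sq; apply/andP; split; lra.
have h2 : (complex.Im z - complex.Im w) ^+ 2 < (r / 2) ^+ 2.
  by apply: sq; apply/andP; split; lra.
have := sqr_ge0 r; lra.
Qed.
End ComplexTopology.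

(** * Spectral measures *)

Section RawIntegral.
Import HBNNSimple.

(* [m1] and [m2] are bare set functions, not measures. *)
Lemma eq_raw_integral d (T : measurableType d) (R : realType)
    (m1 m2 : set T -> \bar R) (D : set T) (f : T -> \bar R) :
  (forall A, measurable A -> m1 A = m2 A) ->
  (\int[m1]_(x in D) f x = \int[m2]_(x in D) f x)%E.
Proof.
move=> m12; have e (h : {nnsfun T >-> R}) : sintegral m1 h = sintegral m2 h.
  by rewrite /sintegral; apply: eq_fsbigr => x _; rewrite m12.
rewrite /integral; congr (_ - _)%E; congr ereal_sup; apply/seteqP.
  by split => _ [h hf <-]; exists h.
by split => _ [h hf <-]; exists h.
Qed.

End RawIntegral.

Lemma cvgR_shift0 (R : realType) (u : nat -> R) (N : nat) :
  (forall n, (N <= n)%N -> u n = 0) -> u @ \oo --> (0 : R).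
Proof.
move=> h; apply/cvgrPdist_lt => e e0.
by exists N => // n /= /h ->; rewrite subrr normr0.
Qed.

Section SpectralTheorem.
Context {R : realType} {V : completeNormedModType R[i]}.
Variable dot : {dot V for Num.conj}.
Hypothesis hV : hilbert_norm dot.
Local Notation H := (real_hilbert hV).
Local Notation J := (Jop hV).
Variable F : set (borelC R) -> V -> V.
Hypothesis hF : semispectral dot F.
Variable S : set R[i]^o.
Hypotheses (cS : closed S) (FS : F (~` S) = (fun=> 0)) (kS : compact S).

Let mS : measurable (S : set (borelC R)).
Proof. exact: closed_measurableC. Qed.

Definition F_calculus : calculus H R[i] := semispectral_calculus hV hF cS FS.
Local Notation Phi := (@Phi _ _ _ F_calculus).
Local Notation Psi := (Psi F_calculus J).
Local Notation good := (good F_calculus).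
Local Notation mdom := (mdom F_calculus).

Lemma good_Re : good (@complex.Re R).
Proof.
split; last exact: continuous_bounded_on continuous_Re kS.
by apply: measurable_funTS; apply: continuous_measurableC; exact: continuous_Re.
Qed.

Lemma good_Im : good (@complex.Im R).
Proof.
split; last exact: continuous_bounded_on continuous_Im kS.
by apply: measurable_funTS; apply: continuous_measurableC; exact: continuous_Im.
Qed.

Lemma Phi_Jop f : Phi f * J = J * Phi f.
Proof. exact: integral_op_Jop. Qed.

Lemma PsiJ f : J * Psi f = Psi f * J.
Proof. by rewrite /Psi mulrDl mulrDr Phi_Jop -mulrA Phi_Jop. Qed.

(** Bridges the integral of the definitions, over the whole plane against a bare set function, to
    the one over [S] against a genuine measure; the complement of [S] is a null set. *)
Lemma diag_integralT (h : H) (f : borelC R -> R) : measurable_fun setT f ->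
  fine (\int[diag_measure dot F h]_(z in setT) (f z)%:E)%E = diag_integral hF S h f.
Proof.
move=> mf; rewrite /diag_integral /Rintegral.
rewrite (@eq_raw_integral _ _ _ _ (diag_mu hF h)); last first.
  by move=> A mA; rewrite diag_muE.
congr fine; rewrite [RHS]integral_mkcond; apply: ae_eq_integral => //.
- exact/measurable_EFinP.
- apply/(measurable_restrictT _ mS); apply/measurable_EFinP; exact: measurable_funTS.
exists (~` S); split; [exact: measurableC|exact: diag_muC|].
move=> z /= nz Sz; apply: nz => _; by rewrite patchE mem_set.
Qed.

Lemma op_integral_Psi (f : R[i] -> R[i]) : cgood F_calculus f ->
  measurable_fun setT (fun z : borelC R => complex.Re (f z)) ->
  measurable_fun setT (fun z : borelC R => complex.Im (f z)) ->
  op_integral dot F f = Psi f.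
Proof.
move=> [gu gv] mu mv; apply: op_integralE; first exact: PsiJ.
move=> h; rewrite (dotE hV) /integralC.
rewrite (diag_integralT h mu) (diag_integralT h mv).
have JJ x y : ip (J x) (J y) = ip x y.
  by rewrite -adjl adj_Jop -(bopM _ J) mulNr Jop_sqr opprK.
(* Cross terms vanish, so the real and imaginary parts of [<Psi f h, h>] are the integrals of [Re f]
   and [Im f] separately. *)
have J0 (A : bop H) : sa A -> J * A = A * J -> ip (A h) (J h) = 0.
  move=> sA AJ; have : ip (A h) (J h) = - ip (A h) (J h).
    by rewrite {1}(sa_ip _ _ sA) -(bopM A) -AJ bopM -adjl adj_Jop bopN ipNl ipC.
  lra.
have J0' f' : ip (Phi f' h) (J h) = 0 by apply: J0; [exact: Phi_sa|rewrite Phi_Jop].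
have J1 f' : ip (J (Phi f' h)) h = 0.
  by rewrite ipC -adjl adj_Jop bopN ipNl ipC J0' oppr0.
congr Complex.
  by rewrite /Psi bopD bopM ipDl J1 addr0; exact: integral_op_diag.
rewrite -(JopE hV) /Psi bopD bopM ipDl J0' add0r JJ.
exact: integral_op_diag.
Qed.
Lemma good_indicC (A : set (borelC R)) : measurable A -> good (\1_A : R[i] -> R).
Proof. by move=> mA; exact: (good_indic R mS mA). Qed.

Lemma Phi_indic (A : set (borelC R)) : measurable A ->
  forall x, Phi (\1_A : R[i] -> R) x = F A x.
Proof.
move=> mA; have [B [_ BF sB]] := semispectral_op hV hF mA.
suff -> : Phi (\1_A : R[i] -> R) = B by [].
apply: sa_form_eq => // [|h]; first exact: Phi_sa.
rewrite [LHS](integral_op_diag _ _ _ (good_indicC mA)).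
rewrite -(diag_integralT h (measurable_indic mA)).
rewrite (@eq_raw_integral _ _ _ _ (diag_mu hF h)); last first.
  by move=> A' mA'; rewrite diag_muE.
by rewrite integral_indic// setIT (diag_mu_op hF h mA BF).
Qed.

Lemma mdom_of_indic : (forall A : set (borelC R), measurable A -> mdom (\1_A : R[i] -> R)) ->
  forall f, good f -> mdom f.
Proof.
move=> mA; apply: (good_ind (E := F_calculus)).
- by move=> c; exact: mdom_cst.
- move=> i f g gi i01 gf gg mf mg.
  have mi : mdom i.
    pose A := S `&` i @^-1` [set 1].
    have mA' : measurable (A : set (borelC R)) by case: gi => mi _; apply: mi.
    apply: eq_mdom (mA _ mA') => // z Sz; rewrite indicE.
    case: (i01 z) => iz; rewrite iz.
      by rewrite memNset// => -[_ /=]; rewrite iz => /esym/eqP; rewrite oner_eq0.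
    by rewrite mem_set.
  apply: mdomD; first exact: mdomM.
  by apply: mdomM => //; apply: mdomB => //; exact: mdom_cst.
- by move=> u f M _ _ mu uM uf; exact: mdom_lim uM uf.
Qed.

(** The sets with indicator in [mdom] form a sigma-algebra, as [mdom] is an algebra closed under
    bounded limits. It contains the half-planes by [mdom_gt], hence the rational boxes and all open
    sets. *)
Lemma indic_of_cdom : cdom F_calculus id ->
  forall A : set (borelC R), measurable A -> mdom (\1_A : R[i] -> R).
Proof.
move=> [mRe mIm].
pose Q (A : set R[i]) := mdom (\1_A : R[i] -> R).
have QC A : Q A -> Q (~` A).
  rewrite /Q => QA; have -> : \1_(~` A) = (fun z => 1 - \1_A z) :> (R[i] -> R).
    by apply/funext => z; rewrite !indicE in_setC; case: (z \in A); rewrite /= ?subrr ?subr0.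
  by apply: mdomB => //; exact: mdom_cst.
have QI A B : Q A -> Q B -> Q (A `&` B).
  rewrite /Q => QA QB; have -> : \1_(A `&` B) = (fun z => \1_A z * \1_B z) :> (R[i] -> R).
    by apply/funext => z; rewrite !indicE in_setI; case: (z \in A); rewrite ?mul1r ?mul0r.
  exact: mdomM.
have QU (A : nat -> set R[i]) : (forall n, Q (A n)) -> Q (\bigcup_n A n).
  (* These products decrease pointwise to the indicator of the complement of the union. *)
  move=> QA; pose D n z : R := \prod_(i < n) \1_(~` A i) z.
  have mD n : mdom (D n).
    elim: n => [|n ih].
      have -> : D 0%N = fun=> 1 by apply/funext => z; rewrite /D big_ord0.
      exact: mdom_cst.
    have -> : D n.+1 = fun z => D n z * \1_(~` A n) z.
      by apply/funext => z; rewrite /D big_ord_recr.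
    by apply: mdomM => //; exact: QC.
  have D01 n z : 0 <= D n z <= 1.
    rewrite /D; elim: n => [|n /andP[h0 h1]]; first by rewrite big_ord0 ler01 lexx.
    rewrite big_ord_recr /= [\1_(~` A n) z]indicE.
    by case: (z \in _); rewrite ?mulr1 ?mulr0 ?h0 ?lexx ?ler01.
  rewrite -(setCK (\bigcup_n A n)); apply: QC.
  apply: (mdom_lim (u := D) (M := 1)) => // [n z _|z _].
    by have /andP[h0 h1] := D01 n z; rewrite ger0_norm.
  rewrite indicE; case: (boolP (z \in ~` \bigcup_n A n)).
    rewrite inE => zA; have -> : (fun n => D n z) = fun=> 1; last exact: cvg_cst.
    apply/funext => n; rewrite /D big1// => i _; rewrite indicE mem_set//.
    by move=> Az; apply: zA; exists i.
  rewrite notin_setE => /contrapT[k _ Akz].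
  apply: (cvgR_shift0 (N := k.+1)) => n kn; rewrite /D.
  rewrite (bigD1 (Ordinal kn)) //= indicE memNset ?mul0r// => nA; exact: nA.
have box q : Q (rat_box q).
  have gt (f : R[i] -> R) (a : R) : mdom f -> Q [set z | a < f z].
    rewrite /Q => mf; have -> : \1_([set z | a < f z]) = (fun z => (a < f z)%R%:R) :> (R[i] -> R).
      apply/funext => z; rewrite indicE; have [h|h] := boolP (a < f z).
        by rewrite mem_set.
      by rewrite memNset//; exact/negP.
    exact: mdom_gt.
  have lt (f : R[i] -> R) (a : R) : mdom f -> Q [set z | f z < a].
    move=> mf; have -> : [set z | f z < a] = [set z | - a < -1 * f z].
      by apply/seteqP; split => z /=; rewrite mulN1r ltrN2.
    by apply: gt; exact: mdomZ.
  case: q => [[[a b] c] d].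
  have -> : rat_box (a, b, c, d) =
      [set z : R[i] | ratr a < complex.Re z] `&` [set z | complex.Re z < ratr b] `&`
      ([set z | ratr c < complex.Im z] `&` [set z | complex.Im z < ratr d]).
    by apply/seteqP; split => z /= [] => [/andP[? ?] /andP[? ?]|[-> ->] [-> ->]].
  by apply: (QI); apply: (QI); [exact: gt|exact: lt|exact: gt|exact: lt].
have Qopen (U : set R[i]^o) : open U -> Q U.
  move=> oU.
  (* An enumeration of all rational boxes in which those not contained in [U] are replaced by the
     empty set. *)
  pose B n : set R[i] := if unpickle n is Some q then
    (if `[< rat_box q `<=` U >] then rat_box q else set0) else set0.
  have Q0 : Q set0.
    rewrite /Q; have -> : \1_set0 = (fun=> 0) :> (R[i] -> R).
      by apply/funext => z; rewrite indicE in_set0.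
    exact: mdom_cst.
  have -> : (U : set R[i]) = \bigcup_n B n.
    apply/seteqP; split => [z Uz|z [n _]].
      have [q [qz qU]] := @open_rat_box R U z oU Uz.
      exists (pickle q); first exact: I.
      rewrite /B pickleK; case: asboolP => h; first exact: qz.
      by case: (h qU).
    by rewrite /B; case: unpickle => // q; case: asboolP => // qU qz; exact: qU.
  by apply: QU => n; rewrite /B; case: unpickle => // q; case: asboolP.
suff : (@measurable _ (borelC R)) `<=` Q by apply.
apply: smallest_sub; last exact: Qopen.
split; [exact: (Qopen _ open0)|by move=> A QA; rewrite setTD; exact: QC|exact: QU].
Qed.
Lemma measurable_mon m n :
  measurable_fun setT (fun z : borelC R => complex.Re (mon m n z)) /\
  measurable_fun setT (fun z : borelC R => complex.Im (mon m n z)).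
Proof.
pose mC (f : borelC R -> R[i]) := measurable_fun setT (fun z => complex.Re (f z)) /\
  measurable_fun setT (fun z => complex.Im (f z)).
have mM f g : mC f -> mC g -> mC (fun z => f z * g z).
  move=> [f1 f2] [g1 g2]; split.
    under eq_fun do rewrite cReM.
    by apply: measurable_funB; exact: measurable_funM.
  under eq_fun do rewrite cImM.
  by apply: measurable_funD; exact: measurable_funM.
have m1 : mC (fun=> 1) by split; exact: measurable_cst.
have mid : mC id.
  split; apply: continuous_measurableC; [exact: continuous_Re|exact: continuous_Im].
have mconj : mC (fun z => Num.conj z).
  case: mid => h1 h2; split; first by under eq_fun do rewrite cRe_conj.
  under eq_fun do rewrite cIm_conj.
  exact: measurable_funN.
have mX f k : mC f -> mC (fun z => f z ^+ k).
  move=> mf; elim: k => [|k ih]; first exact: m1.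
  by under [X in mC X]eq_fun do rewrite exprS; exact: mM.
by apply: (mM (fun z => Num.conj z ^+ m) (fun z => z ^+ n)); exact: mX.
Qed.

Lemma op_integral_mon m n :
  op_integral dot F (fun z => Num.conj z ^+ m * z ^+ n) = Psi (mon m n).
Proof.
have [h1 h2] := measurable_mon m n.
by apply: op_integral_Psi => //; apply: cgood_mon; [exact: good_Re|exact: good_Im].
Qed.

Lemma op_integral_id : op_integral dot F id = Psi id.
Proof.
apply: op_integral_Psi; first by split; [exact: good_Re|exact: good_Im].
  by apply: continuous_measurableC; exact: continuous_Re.
by apply: continuous_measurableC; exact: continuous_Im.
Qed.

Lemma spectral_of_cdom : cdom F_calculus id -> spectral dot F.
Proof.
move=> /indic_of_cdom mF; split=> // A mA.
have [gA EA] := mF A mA.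
have FE x : Phi (\1_A : R[i] -> R) x = F A x by exact: Phi_indic.
have idem : Phi (\1_A : R[i] -> R) * Phi (\1_A : R[i] -> R) = Phi (\1_A : R[i] -> R).
  by rewrite -EA; congr Phi; apply/funext => z; rewrite indicE; case: (z \in A);
    rewrite ?mulr1 ?mulr0.
split.
- by case: hF => h _ _; exact: h.
- by apply/funext => x; rewrite /= -!FE -bopM idem.
- rewrite (adjoint_adj (esym (Phi_Jop _)) FE) Phi_sa.
  by apply/funext => x; exact: FE.
Qed.

(** An indicator equals its square, so idempotence of [F A] is membership of the indicator of [A] in
    [mdom]; staircase approximation does the rest. *)
Lemma cdom_of_spectral : spectral dot F -> cdom F_calculus id.
Proof.
move=> [_ proj].
have mF f : good f -> mdom f.
  apply: mdom_of_indic => A mA; split; first exact: good_indicC.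
  have -> : (fun z => (\1_A : R[i] -> R) z * (\1_A : R[i] -> R) z) = (\1_A : R[i] -> R).
    by apply/funext => z; rewrite indicE; case: (z \in A); rewrite ?mulr1 ?mulr0.
  have [_ idem _] := proj A mA.
  by apply: bop_eq => x; rewrite bopM !Phi_indic// -[in LHS]idem.
by split; apply: mF; [exact: good_Re|exact: good_Im].
Qed.

Lemma Psi_mon_spectral m n : cdom F_calculus id -> Psi (mon m n) = opmon (Psi id) m n.
Proof.
move=> cid.
have gid : cgood F_calculus id by exact: cdom_good.
have PX (f : R[i] -> R[i]) k : cdom F_calculus f ->
    cdom F_calculus (fun z => f z ^+ k) /\ Psi (fun z => f z ^+ k) = Psi f ^+ k.
  move=> cf; elim: k => [|k [ih1 ih2]]; first by split; [exact: cdom1|exact: Psi1].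
  have E : (fun z => f z ^+ k.+1) = (fun z => f z * f z ^+ k).
    by apply/funext => z; rewrite exprS.
  rewrite E; split; first exact: cdomM.
  by rewrite (PsiM (Jop_sqr hV) Phi_Jop cf (cdom_good ih1)) ih2 exprSr.
have [c1 P1] := PX _ m (cdom_conj cid); have [c2 P2] := PX _ n cid.
rewrite /opmon (adj_Psi (adj_Jop hV) Phi_Jop gid) -P1 -P2.
have -> : mon m n = (fun z => z ^+ n * Num.conj z ^+ m) :> (R[i] -> R[i]).
  by apply/funext => z; rewrite /mon mulrC.
exact: (PsiM (Jop_sqr hV) Phi_Jop c2 (cdom_good c1)).
Qed.
End SpectralTheorem.

Lemma bop_iter (R : realType) (H : rhilbert R) (A : bop H) (f : H -> H) n x :
  (forall y, A y = f y) -> (A ^+ n) x = iter n f x.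
Proof.
by move=> Af; elim: n => [//|n ih]; rewrite exprS bopM ih iterS Af.
Qed.

Theorem theorem4p1 (R : realType) (V : completeNormedModType R[i])
    (dot : {dot V for Num.conj}) (hV : hilbert_norm dot)
    (T : V -> V) (hT : normal_operator dot T)
    (F : set (borelC R) -> V -> V)
    (hF : semispectral dot F) (hFc : compactly_supported F)
    (Xi : set (nat * nat))
    (hgcd : is_gcd [set (mn.1%:Z - mn.2%:Z)%R | mn in Xi] 1)
    (hpqr : exists p q r : nat,
        [/\ p <> q, (p + q < 2 * r)%N, Xi (p, q) & Xi (r, r)]) :
  is_spectral_measure_of dot T F <->
  (forall m n : nat, Xi (m, n) ->
     iter m (adjoint dot T) \o iter n T =
     op_integral dot F (fun z => (Num.conj z) ^+ m * z ^+ n)).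
Proof.
have [S [cS FS _] kS] := hFc.
have [bT nT] := hT.
have [A AJ AT] := (bounded_operatorP hV T).1 bT.
have adjT : adjoint dot T = adj A := adjoint_adj AJ AT.
have An : A * adj A = adj A * A.
  apply: bop_eq => x; rewrite !bopM -adjT !AT.
  exact: (congr1 (fun f => f x) nT).
have opmonE m n : iter m (adjoint dot T) \o iter n T = opmon A m n.
  apply/funext => x; rewrite /opmon bopM /=.
  have adjAT (y : real_hilbert hV) : adj A y = adjoint dot T y by rewrite adjT.
  by rewrite -(@bop_iter R (real_hilbert hV) A T n x AT) -(bop_iter _ _ adjAT).
split=> [[hS TE] m n _|hXi].
  have cid := cdom_of_spectral hV hF cS FS kS hS.
  rewrite opmonE (op_integral_mon hV hF cS FS kS) Psi_mon_spectral//.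
  suff -> : A = Psi (F_calculus hV hF cS FS) (Jop hV) id by [].
  by apply: bop_eq => x; rewrite AT TE (op_integral_id hV hF cS FS kS).
have [cid PsiT] : cdom (F_calculus hV hF cS FS) id /\ Psi (F_calculus hV hF cS FS) (Jop hV) id = A.
  apply: (moments_determine (Jop_sqr hV) (adj_Jop hV) (@Phi_Jop _ _ _ _ _ _ _ _ _)
    _ _ An (Xi := Xi)) => //.
  - exact: good_Re.
  - exact: good_Im.
  - move=> d hd; apply: hgcd.2 => _ [[m n] Xmn <-]; exact: hd.
  - move=> m n Xmn; apply: bop_eq => x.
    by rewrite -(op_integral_mon hV hF cS FS kS) -hXi// opmonE.
split; first exact: spectral_of_cdom cid.
by apply/funext => x; rewrite (op_integral_id hV hF cS FS kS) PsiT AT.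
Qed.
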